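(* Let $\ell\ge1$ and let $b,m\in C^\ell([0,\infty))$ be real-valued with $|\partial_t^jb(t)|\le C_j(1+t)^{-j-1}$ and $|\partial_t^jm(t)|\le C_j(1+t)^{-j-2}$ for $j=0,\dots,\ell$ and $t\ge 0$. Let $1\le k\le\ell$, let $D$, $N_k$, $F_{k-1}$, $B^{(k)}$ be the matrix functions defined in the context, let $N>0$ be so large that $N_k(t,\xi)$ is invertible on $\mathcal Z_{\rm hyp}(N)=\{(t,\xi)\in[0,\infty)\times\mathbb R^n:(1+t)|\xi|\ge N\}$ with $N_k^{-1}\in\mathcal S_N^{\ell-k+1}\{0,0\}$, and put $R_k=-N_k^{-1}B^{(k)}$. Then the fundamental solution $\mathcal E_k(t,s,\xi)$ of $$D_tV_k=\big(D(\xi)+F_{k-1}(t,\xi)+R_k(t,\xi)\big)V_k,$$ i.e. the matrix solution with $\mathcal E_k(s,s,\xi)=\mathrm I$, can be represented for $t\ge s$ and $(s,\xi)\in\mathcal Z_{\rm hyp}(N)$ as $$\mathcal E_k(t,s,\xi)=\frac{\lambda(s)}{\lambda(t)}\,\mathcal E_0(t,s,\xi)\,\mathcal Q_k(t,s,\xi),$$ where 1. $\lambda(t)=\exp\big(\frac12\int_0^tb(\tau)\,d\tau\big)$ describes the main influence of the dissipation $b$; 2. $\mathcal E_0(t,s,\xi)=\operatorname{diag}\big(e^{i(t-s)|\xi|},e^{-i(t-s)|\xi|}\big)$ is the fundamental solution of the free wave equation (in diagonalised form); 3. for all multi-indices $|\alpha|\le\min\{k-1,\ell-k-1\}$ the matrix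 $\mathcal Q_k$ satisfies $$\|D_\xi^\alpha\mathcal Q_k(t,s,\xi)\|\le C_\alpha|\xi|^{-|\alpha|}\quad\text{uniformly in } t\ge s\ge\theta_{|\xi|},$$ and $$\|D_\xi^\alpha\big[\mathcal Q_k(t,\theta_{|\xi|},\xi)\big]\|\le C_\alpha|\xi|^{-|\alpha|}\quad\text{uniformly in }(t,\xi)\in\mathcal Z_{\rm hyp}(N).$$ Furthermore, $\mathcal Q_k(t,s,\xi)$ is invertible and converges for $t\to\infty$ to an invertible matrix $\mathcal Q_k(\infty,s,\xi)$, locally uniformly with respect to $\xi\neq0$.
   Context: $D_t=-i\partial_t$, $D_\xi=-i\partial_\xi$. The function $\theta_{|\xi|}$ is given by $(1+\theta_{|\xi|})|\xi|=N$ for $0<|\xi|\le N$ and $\theta_{|\xi|}=0$ for $|\xi|\ge N$. Symbol classes: $a=a(t,\xi)$ (scalar or matrix valued) belongs to $\mathcal S_N^{\ell}\{m_1,m_2\}$ if $|D_t^jD_\xi^\alpha a(t,\xi)|\le C_{j,\alpha}|\xi|^{m_1-|\alpha|}(1+t)^{-m_2-j}$ for all $(t,\xi)\in\mathcal Z_{\rm hyp}(N)$, all integers $0\le j\le\ell$ and all multi-indices $\alpha$. Matrices: for $\xi\ne0$ let $$D(\xi)=\operatorname{diag}(|\xi|,-|\xi|),\quad B(t)=\frac{ib(t)}2\begin{pmatrix}1&1\\1&1\end{pmatrix},\quad C(t,\xi)=\frac{m(t)}{2|\xi|}\begin{pmatrix}1&-1\\1&-1\end{pmatrix}.$$ (The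 system $D_tV=(D+B+C)V$ is a first-order form of $\widehat u_{tt}+|\xi|^2\widehat u+b\widehat u_t+m\widehat u=0$.) Set $$F^{(0)}=\operatorname{diag}B=\frac{ib(t)}2\mathrm I,\qquad N^{(1)}=\frac{ib(t)}{4|\xi|}\begin{pmatrix}0&-1\\1&0\end{pmatrix}.$$ Recursively, with $N_j=\mathrm I+\sum_{i=1}^jN^{(i)}$ and $F_{j-1}=\sum_{i=0}^{j-1}F^{(i)}$, define $$B^{(j)}=(D_t-D-B-C)N_j-N_j(D_t-D-F_{j-1})$$ (an identity of operators, whose right-hand side is a multiplication operator, i.e. $B^{(j)}=(D_tN_j)-(D+B+C)N_j+N_j(D+F_{j-1})$), and for $j\ge1$ $$F^{(j)}=-\operatorname{diag}B^{(j)},\qquad N^{(j+1)}=\frac1{2|\xi|}\begin{pmatrix}0&(B^{(j)})_{12}\\-(B^{(j)})_{21}&0\end{pmatrix},$$ where $\operatorname{diag}$ denotes the diagonal part.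
   Formalization: In the second estimate, for Q_k(t,θ_|ξ|,ξ) with |α| ≥ 1, the sphere |ξ| = N is excluded, because θ_|ξ| has a kink there and the ξ-derivatives do not exist in general; the bound is uniform on the rest of Z_hyp(N). *)

(* Defs.v *)
From HB Require Import structures.
From mathcomp Require Import all_boot all_order all_algebra.
From mathcomp Require Import all_classical all_reals all_analysis.
From mathcomp Require Import complex.

Set Implicit Arguments.
Unset Strict Implicit.
Unset Printing Implicit Defensive.

Import Order.TTheory GRing.Theory Num.Theory.
Import numFieldNormedType.Exports.

Local Open Scope classical_set_scope.
Local Open Scope ring_scope.
Local Open Scope complex_scope.

(* Derivatives relative to a subset of the line: only increments h <> 0 with
   t + h in A are used, so that at an end point of an interval this is the
   one-sided derivative.  All sets A used below are such that t is an
   accumulation point of A. *)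
Section RelativeDerivative.
Variable R : realType.
Implicit Types (A : set R) (f : R -> R) (t : R).

Definition derivable_in A f t : Prop :=
  cvg ((fun h => h^-1 * (f (t + h) - f t)) @ within [set h | A (t + h)] (0 : R)^').

Definition derive_in A f t : R :=
  lim ((fun h => h^-1 * (f (t + h) - f t)) @ within [set h | A (t + h)] (0 : R)^').

Definition derive_in_n A (j : nat) f : R -> R := iter j (derive_in A) f.

Definition class_C A (l : nat) f : Prop :=
  (forall j t, (j < l)%N -> A t -> derivable_in A (derive_in_n A j f) t) /\
  (forall j, (j <= l)%N -> {within A, continuous (derive_in_n A j f)}).

Implicit Types G : R -> 'M[R[i]]_2.

Definition derivable_mx_in A G t : Prop :=
  forall p q, derivable_in A (fun x => complex.Re (G x p q)) t /\
              derivable_in A (fun x => complex.Im (G x p q)) t.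

Definition Dt A G t : 'M[R[i]]_2 :=
  - 'i *: \matrix_(p, q)
    (derive_in A (fun x => complex.Re (G x p q)) t +i*
     derive_in A (fun x => complex.Im (G x p q)) t).

(* Frobenius norm *)
Definition mxnorm (M : 'M[R[i]]_2) : R :=
  Num.sqrt (\sum_p \sum_q Normc.normc (M p q) ^+ 2).

(* D_t V = A V on [s, +oo[ with initial value I at t = s *)
Definition fundamental_solution (s : R) (A V : R -> 'M[R[i]]_2) : Prop :=
  V s = 1%:M /\
  forall t, s <= t ->
    derivable_mx_in `[s, +oo[ V t /\ Dt `[s, +oo[ V t = A t *m V t.

End RelativeDerivative.

Section Symbols.
Variables (R : realType) (n : nat).
Implicit Types (O : set 'rV[R]_n) (f : 'rV[R]_n -> 'M[R[i]]_2) (xi : 'rV[R]_n).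

(* Euclidean norm; the library norm on 'rV_n is the maximum norm *)
Definition enorm xi : R := Num.sqrt (\sum_i xi ord0 i ^+ 2).

(* only meaningful for 0 < r *)
Definition theta (N r : R) : R := if r <= N then N / r - 1 else 0.

(* Sets of pairs (t, xi) are represented by their sections at fixed t. *)
Definition Zhyp (N t : R) : set 'rV[R]_n :=
  [set xi | 0 <= t /\ N <= (1 + t) * enorm xi].

(* Partial derivatives in xi relative to O, so that boundary points of Zhyp
   are included and values outside O are irrelevant. *)
Definition line xi (i : 'I_n) (h : R) : 'rV[R]_n := xi + h *: delta_mx ord0 i.

Definition derivable_xi O i f xi : Prop :=
  derivable_mx_in (line xi i @^-1` O) (f \o line xi i) 0.

Definition Dxi1 O i f xi : 'M[R[i]]_2 :=
  Dt (line xi i @^-1` O) (f \o line xi i) 0.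

Definition multi_index := {ffun 'I_n -> nat}.
Definition mlen (alpha : multi_index) : nat := (\sum_i alpha i)%N.
Definition directions (alpha : multi_index) : seq 'I_n :=
  flatten [seq nseq (alpha i) i | i <- enum 'I_n].

Definition Dxi_seq O (s : seq 'I_n) f : 'rV[R]_n -> 'M[R[i]]_2 :=
  foldr (Dxi1 O) f s.

Fixpoint derivable_seq O (s : seq 'I_n) f : Prop :=
  if s is i :: s' then
    derivable_seq O s' f /\
    forall xi, O xi -> derivable_xi O i (Dxi_seq O s' f) xi
  else True.

Definition Dxi O alpha f := Dxi_seq O (directions alpha) f.
Definition has_Dxi O alpha f : Prop := derivable_seq O (directions alpha) f.

Implicit Types (Z : R -> set 'rV[R]_n) (a : R -> 'rV[R]_n -> 'M[R[i]]_2).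

Definition Dt_on Z a : R -> 'rV[R]_n -> 'M[R[i]]_2 :=
  fun t xi => Dt [set tau | Z tau xi] (fun tau => a tau xi) t.

Definition Dt_Dxi Z (j : nat) alpha a : R -> 'rV[R]_n -> 'M[R[i]]_2 :=
  iter j (Dt_on Z) (fun t => Dxi (Z t) alpha (a t)).

Definition has_Dt_Dxi Z (j : nat) alpha a : Prop :=
  (forall t, has_Dxi (Z t) alpha (a t)) /\
  (forall i t xi, (i < j)%N -> Z t xi ->
     derivable_mx_in [set tau | Z tau xi]
       (fun tau => Dt_Dxi Z i alpha a tau xi) t).

Definition symbol_class (N : R) (l : nat) (m1 m2 : R) a : Prop :=
  forall (j : nat) alpha, (j <= l)%N ->
    has_Dt_Dxi (Zhyp N) j alpha a /\
    exists C : R, forall t xi, Zhyp N t xi ->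
      mxnorm (Dt_Dxi (Zhyp N) j alpha a t xi)
      <= C * enorm xi `^ (m1 - (mlen alpha)%:R) * (1 + t) `^ (- m2 - j%:R).

End Symbols.

Section Diagonalisation.
Variables (R : realType) (n : nat) (b m : R -> R).
Implicit Types (t : R) (xi : 'rV[R]_n).

Definition mx22 (x00 x01 x10 x11 : R[i]) : 'M[R[i]]_2 :=
  \matrix_(p, q) if p == ord0 then (if q == ord0 then x00 else x01)
                 else (if q == ord0 then x10 else x11).

Definition diag_part (M : 'M[R[i]]_2) : 'M[R[i]]_2 :=
  mx22 (M ord0 ord0) 0 0 (M ord_max ord_max).

Definition Dmx xi : 'M[R[i]]_2 :=
  mx22 (enorm xi)%:C 0 0 (- (enorm xi)%:C).

Definition Bmx t : 'M[R[i]]_2 :=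
  ('i * (b t)%:C / 2) *: mx22 1 1 1 1.

Definition Cmx t xi : 'M[R[i]]_2 :=
  ((m t)%:C / (2 * (enorm xi)%:C)) *: mx22 1 (-1) 1 (-1).

Definition F0mx t : 'M[R[i]]_2 := diag_part (Bmx t).

Definition N1mx t xi : 'M[R[i]]_2 :=
  ('i * (b t)%:C / (4 * (enorm xi)%:C)) *: mx22 0 (-1) 1 0.

(* (D_t - D - B - C) NN - NN (D_t - D - FF) as a multiplication operator *)
Definition remainder (NN FF : R -> 'rV[R]_n -> 'M[R[i]]_2) t xi : 'M[R[i]]_2 :=
  Dt `[0, +oo[ (fun tau => NN tau xi) t
  - (Dmx xi + Bmx t + Cmx t xi) *m NN t xi
  + NN t xi *m (Dmx xi + FF t xi).

Definition offdiag_step (M : 'M[R[i]]_2) xi : 'M[R[i]]_2 :=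
  (2 * (enorm xi)%:C)^-1 *: mx22 0 (M ord0 ord_max) (- M ord_max ord0) 0.

(* NF j is the pair (N_j, F_{j-1}) of partial sums, with N_0 = I, F_{-1} = 0 *)
Fixpoint NF (j : nat) : (R -> 'rV[R]_n -> 'M[R[i]]_2) *
                        (R -> 'rV[R]_n -> 'M[R[i]]_2) :=
  if j is j'.+1 then
    let: (NN, FF) := NF j' in
    let Bj := remainder NN FF in
    if j' is 0 then
      ((fun t xi => NN t xi + N1mx t xi), (fun t xi => FF t xi + F0mx t))
    else
      ((fun t xi => NN t xi + offdiag_step (Bj t xi) xi),
       (fun t xi => FF t xi - diag_part (Bj t xi)))
  else ((fun _ _ => 1%:M), (fun _ _ => 0)).

Definition Nmx (k : nat) := (NF k).1.
Definition Fpred (k : nat) := (NF k).2.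
Definition Bk (k : nat) := remainder (Nmx k) (Fpred k).
Definition Rk (k : nat) t xi : 'M[R[i]]_2 := - (invmx (Nmx k t xi) *m Bk k t xi).

Definition lambda t : R :=
  expR (2^-1 * \int[lebesgue_measure]_(tau in `[0, t]) b tau).

Definition cis (x : R) : R[i] := cos x +i* sin x.

Definition E0mx t (s : R) xi : 'M[R[i]]_2 :=
  mx22 (cis ((t - s) * enorm xi)) 0 0 (cis (- ((t - s) * enorm xi))).

End Diagonalisation.

(* Main.v *)
(* Q_k is obtained from the fundamental solution by removing lambda and the
   free evolution; it solves Q' = A Q, where A is the sum of the diagonal
   remainders F^(1) + ... + F^(k-1) and the conjugate of R_k by the free
   evolution.  In the hyperbolic zone A = O(|xi|^-1 (1+t)^-2), which integrates
   to O(1/N) over [s, oo[.  Gronwall's inequality then bounds Q, its inverse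
   (through the determinant) and its variation near infinity, which gives the
   limit.

   For the derivatives in xi, put t' = s + sigma (t - s) with sigma in [0, 1],
   where s is either constant or s = theta(|xi|); both cases become one family
   of equations on the fixed interval [0, 1].  A xi-derivative of the
   oscillating factors exp(+-2i(t'-s)|xi|) costs 1 + t' instead of 1/|xi|; as
   R_k decays like (|xi|(1+t'))^-k, this is affordable for at most k-1
   derivatives.  Differentiating t' in xi costs time derivatives of b and m,
   whence the condition |alpha| <= l-k-1.  Bounds on the xi-derivatives of Q
   follow inductively from the variational equation. *)
Require Import Defs.
From HB Require Import structures.
From mathcomp Require Import all_boot all_order all_algebra.
From mathcomp Require Import all_classical all_reals all_analysis.
From mathcomp Require Import complex.
From mathcomp Require Import ring lra.
Set Implicit Arguments.
Unset Strict Implicit.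
Unset Printing Implicit Defensive.

Import Order.TTheory GRing.Theory Num.Theory.
Import numFieldNormedType.Exports.

Local Open Scope classical_set_scope.
Local Open Scope ring_scope.
Local Open Scope complex_scope.

(** Nothing is assumed about the xi-dependence of [E], so the existence of the xi-derivatives of Q
    has to be proved along with their bounds. A candidate derivative is built by variation of
    constants, with Q itself as homogeneous fundamental solution, and a quadratic bound on the
    Taylor remainder, uniform in sigma, identifies it as the derivative. Quadratic remainders are
    preserved by products, inverses and the solution of linear equations.

    Counting derivatives: after k steps of the diagonalisation B^(k) keeps l - k time derivatives.
    Since the times t' depend on xi, p derivatives in xi use p of these, and one more keeps the last
    one Lipschitz; hence p + 1 <= l - k.

    A second obstacle is that theta(|xi|) has a kink at |xi| = N. The regions on both sides of this
    sphere are treated separately and glued, and for alpha different from 0 the derivatives are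
    taken off the sphere.

    Invertibility needs a lower bound on the determinant, uniform in t, since the limit at infinity
    must be invertible as well; it comes from a reversed Gronwall inequality for the determinant. *)

Section Norm.
Variable R : realType.
Implicit Types (z w : R[i]) (M P : 'M[R[i]]_2).

(* The l^1 norm is used internally instead of the Frobenius norm [mxnorm]. *)
Definition cnorm1 z : R := `|complex.Re z| + `|complex.Im z|.
Definition nrm M : R := \sum_p \sum_q cnorm1 (M p q).

Lemma ReD z w : complex.Re (z + w) = complex.Re z + complex.Re w.
Proof. by case: z w => [a b] [c d]. Qed.
Lemma ImD z w : complex.Im (z + w) = complex.Im z + complex.Im w.
Proof. by case: z w => [a b] [c d]. Qed.
Lemma ReM z w : complex.Re (z * w) =
  complex.Re z * complex.Re w - complex.Im z * complex.Im w.
Proof. by case: z w => [a b] [c d]. Qed.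
Lemma ImM z w : complex.Im (z * w) =
  complex.Re z * complex.Im w + complex.Im z * complex.Re w.
Proof. by case: z w => [a b] [c d]. Qed.
Lemma ReN z : complex.Re (- z) = - complex.Re z.
Proof. by case: z. Qed.
Lemma ImN z : complex.Im (- z) = - complex.Im z.
Proof. by case: z. Qed.

Lemma ReRM (x : R) z : complex.Re (x%:C * z) = x * complex.Re z.
Proof. by rewrite ReM /= mul0r subr0. Qed.
Lemma ImRM (x : R) z : complex.Im (x%:C * z) = x * complex.Im z.
Proof. by rewrite ImM /= mul0r addr0. Qed.

Lemma cnorm1_ge0 z : 0 <= cnorm1 z.
Proof. by rewrite addr_ge0. Qed.

Lemma cnorm1D z w : cnorm1 (z + w) <= cnorm1 z + cnorm1 w.
Proof. by rewrite /cnorm1 ReD ImD addrACA lerD // ler_normD. Qed.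

Lemma cnorm1M z w : cnorm1 (z * w) <= cnorm1 z * cnorm1 w.
Proof.
rewrite /cnorm1 ReM ImM mulrDl !mulrDr.
apply: (le_trans (lerD (ler_normB _ _) (ler_normD _ _))).
by rewrite !normrM; lra.
Qed.

Lemma cnorm1R (x : R) z : cnorm1 (x%:C * z) = `|x| * cnorm1 z.
Proof. by rewrite /cnorm1 ReM ImM /= !mul0r subr0 addr0 !normrM mulrDr. Qed.

Lemma cnorm1_eq0 z : cnorm1 z = 0 -> z = 0.
Proof.
case: z => a b /eqP; rewrite /cnorm1 /= paddr_eq0 // !normr_eq0.
by case/andP=> /eqP-> /eqP->.
Qed.

Lemma nrmE M : nrm M = cnorm1 (M ord0 ord0) + cnorm1 (M ord0 ord_max)
  + (cnorm1 (M ord_max ord0) + cnorm1 (M ord_max ord_max)).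
Proof.
rewrite /nrm !big_ord_recl !big_ord0 !addr0.
by rewrite (_ : lift ord0 ord0 = ord_max) //; apply: val_inj.
Qed.

Lemma mx2P M P : M ord0 ord0 = P ord0 ord0 -> M ord0 ord_max = P ord0 ord_max ->
  M ord_max ord0 = P ord_max ord0 -> M ord_max ord_max = P ord_max ord_max ->
  M = P.
Proof.
have H (p : 'I_2) : p = ord0 \/ p = ord_max.
  by case: p => [[|[|//]]] ? ; [left|right]; apply: val_inj.
by move=> *; apply/matrixP => p q; case: (H p) => ->; case: (H q) => ->.
Qed.

Lemma mulmx2E M P p q :
  (M *m P) p q = M p ord0 * P ord0 q + M p ord_max * P ord_max q.
Proof.
rewrite mxE !big_ord_recl big_ord0 addr0.
by rewrite (_ : lift ord0 ord0 = ord_max) //; apply: val_inj.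
Qed.

Lemma nrm_ge0 M : 0 <= nrm M.
Proof. by do 2!apply: sumr_ge0 => ? _; exact: cnorm1_ge0. Qed.

Lemma nrm_entry M p q : cnorm1 (M p q) <= nrm M.
Proof.
rewrite /nrm (bigD1 p) //= (bigD1 q) //= -addrA lerDl addr_ge0 //.
  by apply: sumr_ge0 => ? _; exact: cnorm1_ge0.
by do 2!apply: sumr_ge0 => ? _; exact: cnorm1_ge0.
Qed.

Lemma nrmD M P : nrm (M + P) <= nrm M + nrm P.
Proof.
rewrite !nrmE !mxE.
have := cnorm1D (M ord0 ord0) (P ord0 ord0).
have := cnorm1D (M ord0 ord_max) (P ord0 ord_max).
have := cnorm1D (M ord_max ord0) (P ord_max ord0).
have := cnorm1D (M ord_max ord_max) (P ord_max ord_max).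
lra.
Qed.

Lemma nrmM M P : nrm (M *m P) <= nrm M * nrm P.
Proof.
rewrite !nrmE !mulmx2E.
set m0 := M _ _; set m1 := M _ _; set m2 := M _ _; set m3 := M _ _.
set p0 := P _ _; set p2 := P _ _; set p1 := P _ _; set p3 := P _ _.
have H a b c d : cnorm1 (a * b + c * d) <= cnorm1 a * cnorm1 b + cnorm1 c * cnorm1 d.
  by apply: (le_trans (cnorm1D _ _)); rewrite lerD // cnorm1M.
apply: (le_trans (lerD (lerD (H _ _ _ _) (H _ _ _ _)) (lerD (H _ _ _ _) (H _ _ _ _)))).
move: (cnorm1_ge0 m0) (cnorm1_ge0 m1) (cnorm1_ge0 m2) (cnorm1_ge0 m3).
move: (cnorm1_ge0 p0) (cnorm1_ge0 p1) (cnorm1_ge0 p2) (cnorm1_ge0 p3).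
move: (cnorm1 m0) (cnorm1 m1) (cnorm1 m2) (cnorm1 m3)
  (cnorm1 p0) (cnorm1 p1) (cnorm1 p2) (cnorm1 p3) => a0 a1 a2 a3 b0 b1 b2 b3 *.
have hm x y : 0 <= x -> 0 <= y -> 0 <= x * y :> R by apply: mulr_ge0.
rewrite -subr_ge0.
rewrite (_ : _ - _ = a0 * b2 + a0 * b3 + a1 * b0 + a1 * b1 + a2 * b2 + a2 * b3
   + a3 * b0 + a3 * b1); last by ring.
by rewrite !addr_ge0 // hm.
Qed.

Lemma nrmZ z M : nrm (z *: M) <= cnorm1 z * nrm M.
Proof.
rewrite !nrmE !mxE !mulrDr.
by apply: lerD; apply: lerD; rewrite -mulrDr; exact: cnorm1M.
Qed.

Lemma nrmR (x : R) M : nrm (x%:C *: M) = `|x| * nrm M.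
Proof. by rewrite !nrmE !mxE !cnorm1R !mulrDr. Qed.

Lemma nrm0 : nrm 0 = 0.
Proof. by rewrite nrmE !mxE /cnorm1 /= normr0 !addr0. Qed.

Lemma nrmN M : nrm (- M) = nrm M.
Proof. by rewrite !nrmE !mxE /cnorm1 !ReN !ImN !normrN. Qed.

Lemma nrmB M P : nrm (M - P) <= nrm M + nrm P.
Proof. by rewrite -(nrmN P) nrmD. Qed.

Lemma nrmBC M P : nrm (M - P) = nrm (P - M).
Proof. by rewrite -nrmN opprB. Qed.

Lemma nrm_eq0 M : nrm M = 0 -> M = 0.
Proof.
move=> h; apply/matrixP => p q; rewrite mxE; apply: cnorm1_eq0; apply/eqP.
by rewrite eq_le cnorm1_ge0 andbT -h nrm_entry.
Qed.

Lemma nrm_scalar (x : R) : nrm (x%:C%:M) = 2 * `|x|.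
Proof. by rewrite nrmE !mxE /cnorm1 /= !normr0; lra. Qed.

Lemma nrm1 : nrm 1%:M = 2.
Proof. by rewrite (_ : 1 = 1%:C) // nrm_scalar normr1 mulr1. Qed.

Lemma normc_sq z : Normc.normc z ^+ 2 = complex.Re z ^+ 2 + complex.Im z ^+ 2.
Proof. by case: z => a b /=; rewrite sqr_sqrtr // addr_ge0 // sqr_ge0. Qed.

Lemma mxnorm_sq M : mxnorm M ^+ 2 =
  \sum_p \sum_q (complex.Re (M p q) ^+ 2 + complex.Im (M p q) ^+ 2).
Proof.
rewrite /mxnorm sqr_sqrtr; last first.
  by do 2!apply: sumr_ge0 => ? _; exact: sqr_ge0.
by do 2!apply: eq_bigr => ? _; rewrite normc_sq.
Qed.

Lemma mxnorm_ge0 M : 0 <= mxnorm M.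
Proof. exact: sqrtr_ge0. Qed.

Lemma mxnorm_le_nrm M : mxnorm M <= nrm M.
Proof.
rewrite -ler_sqr ?nnegrE ?mxnorm_ge0 ?nrm_ge0 // mxnorm_sq.
have H (I : finType) (F G : I -> R) : (forall i, F i <= G i ^+ 2) -> (forall i, 0 <= G i) ->
    \sum_i F i <= (\sum_i G i) ^+ 2.
  move=> h1 h2.
  suff : \sum_i F i <= (\sum_i G i) ^+ 2 /\ 0 <= \sum_i G i by case.
  apply: (big_rec2 (fun x y => x <= y ^+ 2 /\ 0 <= y)) => [|i x y _ [ih1 ih2]].
    by rewrite expr2 mulr0.
  split; last exact: addr_ge0.
  apply: (le_trans (lerD (h1 i) ih1)).
  by rewrite sqrrD -addrA lerD2l lerDr mulrn_wge0 // mulr_ge0.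
apply: (H _ _ _) => [p|p]; last by apply: sumr_ge0 => ? _; exact: cnorm1_ge0.
apply: (H _ _ _) => [q|q]; last exact: cnorm1_ge0.
rewrite /cnorm1 sqrrD !real_normK ?num_real // -addrA lerD2l lerDr.
by rewrite mulrn_wge0 // mulr_ge0.
Qed.

(** Each of the eight real and imaginary parts is at most the Frobenius norm. *)
Lemma nrm_le_mxnorm M : nrm M <= 8 * mxnorm M.
Proof.
have H p q (x : R) : x ^+ 2 <= complex.Re (M p q) ^+ 2 + complex.Im (M p q) ^+ 2 ->
    `|x| <= mxnorm M.
  move=> h; rewrite -ler_sqr ?nnegrE ?mxnorm_ge0 // mxnorm_sq.
  rewrite real_normK ?num_real //; apply: (le_trans h).
  rewrite (bigD1 p) //= (bigD1 q) //= -addrA lerDl.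
  by rewrite addr_ge0 //; repeat (apply: sumr_ge0 => ? _); rewrite addr_ge0 ?sqr_ge0.
have H1 p q : cnorm1 (M p q) <= 2 * mxnorm M.
  rewrite mulr_natl mulr2n lerD //; apply: (H p q).
    by rewrite lerDl sqr_ge0.
  by rewrite lerDr sqr_ge0.
rewrite nrmE; have := H1 ord0 ord0; have := H1 ord0 ord_max.
have := H1 ord_max ord0; have := H1 ord_max ord_max; lra.
Qed.

(** The adjugate. As [adj2 M *m M] is the determinant times I, the product rule and the Gronwall
    estimates for matrices apply to determinants. *)
Definition adj2 M := mx22 (M ord_max ord_max) (- M ord0 ord_max)
  (- M ord_max ord0) (M ord0 ord0).

End Norm.

(** * Relative derivatives and Gronwall's inequality *)

Section RealDerivative.
Variable R : realType.
Implicit Types (A B : set R) (f g : R -> R) (t x d e : R).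

(* Relative derivatives in epsilon-delta form; unlike the filter version they
   make sense without any accumulation hypothesis. *)
Definition rder A f t d : Prop := forall e, 0 < e ->
  exists2 dl, 0 < dl & forall x, A x -> `|x - t| < dl ->
    `|f x - f t - (x - t) * d| <= e * `|x - t|.

Lemma rder_le A f t d : rder A f t d ->
  exists2 dl, 0 < dl & forall x, A x -> `|x - t| < dl ->
    `|f x - f t| <= (`|d| + 1) * `|x - t|.
Proof.
move=> /(_ 1 ltr01) [dl dl0 H]; exists dl => // x Ax xt.
have := H x Ax xt; rewrite mul1r => h.
rewrite -(subrK ((x - t) * d) (f x - f t)).
by apply: (le_trans (ler_normD _ _)); rewrite normrM; lra.
Qed.

Lemma rder_sub A B f t d : B `<=` A -> rder A f t d -> rder B f t d.
Proof.
by move=> BA H e e0; have [dl dl0 h] := H e e0; exists dl => // x /BA; exact: h.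
Qed.

Lemma rder_ext A f g t d : (forall x, A x -> f x = g x) -> A t ->
  rder A f t d -> rder A g t d.
Proof.
move=> fg At H e e0; have [dl dl0 h] := H e e0; exists dl => // x Ax.
by rewrite -!fg //; exact: h.
Qed.

Lemma rder_cst A c t : rder A (fun=> c) t 0.
Proof.
by move=> e e0; exists 1 => // x _ _; rewrite mulr0 !subrr normr0 mulr_ge0 // ltW.
Qed.

Lemma rder_id A t : rder A id t 1.
Proof.
by move=> e e0; exists 1 => // x _ _; rewrite mulr1 subrr normr0 mulr_ge0 // ltW.
Qed.

Lemma rderD A f g t df dg : rder A f t df -> rder A g t dg ->
  rder A (fun x => f x + g x) t (df + dg).
Proof.
move=> Hf Hg e e0; have e2 : 0 < e / 2 by rewrite divr_gt0.
have [d1 d10 h1] := Hf _ e2; have [d2 d20 h2] := Hg _ e2.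
exists (Num.min d1 d2); first by rewrite lt_min d10.
move=> x Ax; rewrite lt_min => /andP[/(h1 x Ax) {}h1 /(h2 x Ax) {}h2].
rewrite (_ : _ - _ = (f x - f t - (x - t) * df) + (g x - g t - (x - t) * dg)).
  by apply: (le_trans (ler_normD _ _)); lra.
by ring.
Qed.

(** The share of e given to one term of a product or chain rule: 1 + c in place of c keeps the
    quotient meaningful for c = 0. *)
Lemma absorb e k c : 0 <= e -> 0 < k -> 0 <= c -> e / (k * (1 + c)) * c <= e / k.
Proof.
move=> e0 k0 c0; rewrite invfM mulrA -mulrA ler_piMr ?(divr_ge0 e0 (ltW k0)) //.
by rewrite mulrC ler_pdivrMr ?mul1r ?ltr_pwDl // lerDr.
Qed.

Lemma rderM A f g t df dg : rder A f t df -> rder A g t dg ->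
  rder A (fun x => f x * g x) t (df * g t + f t * dg).
Proof.
move=> Hf Hg e e0.
have [d3 d30 h3] := rder_le Hf; have [d4 d40 h4] := rder_le Hg.
pose F := `|df| + 1; pose G := `|dg| + 1.
have F0 : 0 < F by rewrite ltr_pwDr.
have G0 : 0 < G by rewrite ltr_pwDr.
have e1 : 0 < e / (3 * (1 + `|g t|)) by rewrite divr_gt0 // mulr_gt0 // ltr_pwDl.
have e2 : 0 < e / (3 * (1 + `|f t|)) by rewrite divr_gt0 // mulr_gt0 // ltr_pwDl.
have [d1 d10 h1] := Hf _ e1; have [d2 d20 h2] := Hg _ e2.
(* The product of the two increments is at most F G |x - t|^2; a step below this bound makes it a
   third of the allowed error. *)
have d5 : 0 < e / (3 * (F * G)) by rewrite divr_gt0 // !mulr_gt0.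
exists (Num.min (Num.min d1 d2) (Num.min (e / (3 * (F * G))) (Num.min d3 d4))).
  by rewrite !lt_min d10 d20 d5 d30 d40.
move=> x Ax; rewrite !lt_min => /andP[/andP[/(h1 x Ax) {}h1 /(h2 x Ax) {}h2]].
move=> /andP[hx /andP[/(h3 x Ax) {}h3 /(h4 x Ax) {}h4]].
rewrite (_ : _ - _ = (f x - f t - (x - t) * df) * g t
  + f t * (g x - g t - (x - t) * dg) + (f x - f t) * (g x - g t)); last by ring.
apply: (le_trans (ler_normD _ _)); apply: (le_trans (lerD (ler_normD _ _) (lexx _))).
rewrite !normrM.
have k1 : `|f x - f t - (x - t) * df| * `|g t| <= e / 3 * `|x - t|.
  apply: (le_trans (ler_wpM2r (normr_ge0 _) h1)).
  by rewrite mulrAC ler_wpM2r // absorb // ltW.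
have k2 : `|f t| * `|g x - g t - (x - t) * dg| <= e / 3 * `|x - t|.
  apply: (le_trans (ler_wpM2l (normr_ge0 _) h2)).
  by rewrite mulrA ler_wpM2r // mulrC absorb // ltW.
have k3 : `|f x - f t| * `|g x - g t| <= e / 3 * `|x - t|.
  apply: (le_trans (ler_pM (normr_ge0 _) (normr_ge0 _) h3 h4)).
  rewrite -/F -/G mulrA ler_wpM2r //.
  have : `|x - t| * (3 * (F * G)) <= e.
    by rewrite -ler_pdivlMr ?ltW // !mulr_gt0.
  by lra.
lra.
Qed.

Lemma rderZ A f t d c : rder A f t d -> rder A (fun x => c * f x) t (c * d).
Proof.
by move=> H; have := rderM (rder_cst A c t) H; rewrite mul0r add0r.
Qed.

Lemma rderN A f t d : rder A f t d -> rder A (fun x => - f x) t (- d).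
Proof.
move=> /(rderZ (-1)); rewrite mulN1r; congr rder; apply/funext => x.
by rewrite mulN1r.
Qed.

Lemma rderB A f g t df dg : rder A f t df -> rder A g t dg ->
  rder A (fun x => f x - g x) t (df - dg).
Proof. by move=> Hf /rderN; exact: rderD. Qed.

Lemma rder_sum A (I : finType) (F : I -> R -> R) (D : I -> R) t :
  (forall i, rder A (F i) t (D i)) ->
  rder A (fun x => \sum_i F i x) t (\sum_i D i).
Proof.
move=> H.
rewrite (_ : (fun _ => _) = \sum_i (F i : R -> R)); last first.
  by apply/funext => x; rewrite fct_sumE.
apply: (big_ind2 (fun (f : R -> R) d => rder A f t d)) => //.
  exact: rder_cst.
by move=> *; exact: rderD.
Qed.

Lemma rder_comp A B p f t a d : (forall x, A x -> B (p x)) ->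
  rder A p t a -> rder B f (p t) d -> rder A (fun x => f (p x)) t (d * a).
Proof.
move=> AB Hp Hf e e0.
have [d1 d10 h1] := rder_le Hp.
pose P := `|a| + 1; have P0 : 0 < P by rewrite ltr_pwDr.
have e1 : 0 < e / (2 * P) by rewrite divr_gt0 // mulr_gt0.
have e2 : 0 < e / (2 * (1 + `|d|)) by rewrite divr_gt0 // mulr_gt0 // ltr_pwDl.
have [d2 d20 h2] := Hf _ e1; have [d3 d30 h3] := Hp _ e2.
exists (Num.min d1 (Num.min (d2 / P) d3)).
  by rewrite !lt_min d10 d30 divr_gt0.
move=> x Ax; rewrite !lt_min => /andP[/(h1 x Ax) {}h1] /andP[hx /(h3 x Ax) {}h3].
have px : `|p x - p t| < d2.
  by apply: (le_lt_trans h1); rewrite -/P mulrC -ltr_pdivlMr.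
have {}h2 := h2 _ (AB _ Ax) px.
rewrite (_ : _ - _ = (f (p x) - f (p t) - (p x - p t) * d)
  + (p x - p t - (x - t) * a) * d); last by ring.
apply: (le_trans (ler_normD _ _)); rewrite normrM.
have k1 : `|f (p x) - f (p t) - (p x - p t) * d| <= e / 2 * `|x - t|.
  apply: (le_trans h2); apply: (le_trans (ler_wpM2l (ltW e1) h1)).
  rewrite -/P mulrA invfM mulrA mulfVK // ?gt_eqF //.
have k2 : `|p x - p t - (x - t) * a| * `|d| <= e / 2 * `|x - t|.
  apply: (le_trans (ler_wpM2r (normr_ge0 _) h3)).
  by rewrite mulrAC ler_wpM2r // absorb // ltW.
lra.
Qed.

Lemma rder_cvg A f t d : rder A f t d ->
  (fun h => h^-1 * (f (t + h) - f t)) @ within [set h | A (t + h)] (0 : R)^' --> d.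
Proof.
move=> H; apply/cvgrPdist_le => e e0; have [dl dl0 h] := H e e0.
apply/nbhs_ballP; exists dl => //= x; rewrite /ball /= sub0r normrN => xd x0 Ax.
have {h} := h _ Ax; rewrite (addrC t) addrK => /(_ xd) h.
rewrite distrC -(ler_pM2l (_ : 0 < `|x|)) ?normr_gt0 // -normrM.
by rewrite mulrBr mulVKf // (mulrC `|x|).
Qed.

Lemma cvg_rder A f t d :
  (fun h => h^-1 * (f (t + h) - f t)) @ within [set h | A (t + h)] (0 : R)^' --> d ->
  rder A f t d.
Proof.
move=> /cvgrPdist_le H e e0.
have /nbhs_ballP[dl dl0 h] := H e e0; exists dl => // x Ax xt.
have [->|xt0] := eqVneq x t; first by rewrite !subrr mul0r subrr normr0 mulr0.
have x0 : x - t != 0 by rewrite subr_eq0.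
have := h (x - t); rewrite /ball /= sub0r normrN (addrC t) subrK => /(_ xt x0 Ax).
rewrite distrC -(ler_pM2l (_ : 0 < `|x - t|)) ?normr_gt0 // -normrM.
by rewrite mulrBr mulVKf // (mulrC _ e).
Qed.

(** Makes the filter behind [derivable_in] proper, so that limits along it are unique and
    [derive_in] returns the expected value. *)
Definition accum A t : Prop := forall e, 0 < e ->
  exists h, [/\ h != 0, `|h| < e & A (t + h)].

Lemma accum_proper A t : accum A t ->
  ProperFilter (within [set h | A (t + h)] (0 : R)^').
Proof.
move=> H; apply: Build_ProperFilter => /nbhs_ballP[e /= e0 h].
have [x [x0 xe Ax]] := H e e0.
by apply: (h x); rewrite // /ball /= sub0r normrN.
Qed.

Lemma rder_derive A f t d : accum A t -> rder A f t d ->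
  derivable_in A f t /\ derive_in A f t = d.
Proof.
move=> At H; have c := rder_cvg H.
have PF := accum_proper At.
split; first by apply/cvg_ex; exists d.
exact: (cvg_lim _ c).
Qed.

Lemma derivable_rder A f t : derivable_in A f t -> rder A f t (derive_in A f t).
Proof. by move=> H; apply: cvg_rder; exact: H. Qed.

Lemma is_derive_rder A f t d : is_derive t (1 : R) f d -> rder A f t d.
Proof.
move=> [H1 H2]; apply: cvg_rder.
have := H1; rewrite /derivable => /cvg_ex [l hl].
have ld : l = d by rewrite -H2 /derive; apply/esym/cvg_lim.
rewrite -ld; apply: cvg_trans hl.
move=> P [e /= e0 h]; exists e => //= x xe x0 Ax.
have := h x xe x0; rewrite /= (_ : x *: 1 = x); last exact: mulr1.
by rewrite (addrC x).
Qed.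

Lemma accum_ray s t : s <= t -> accum `[s, +oo[ t.
Proof.
move=> st e e0; exists (e / 2); split.
- by rewrite gt_eqF // divr_gt0.
- by rewrite gtr0_norm ?divr_gt0 // ltr_pdivrMr // ltr_pMr // ltr1n.
- by rewrite /= in_itv /= andbT (le_trans st) // lerDl divr_ge0 // ltW.
Qed.

(** Real induction: for fixed e > 0 the supremum of the points x with f x - f a <= e (x - a) is
    again such a point, and it can be moved to the right unless it is b; then e is made small. Since
    only upper bounds on increments enter, the lemma also serves for norms, which need not be
    differentiable. *)
Lemma dini f a b : a <= b ->
  (forall t, a <= t <= b -> forall e, 0 < e -> exists2 dl, 0 < dl &
     forall x, a <= x <= b -> `|x - t| < dl ->
       (t <= x -> f x - f t <= e * (x - t)) /\
       (x <= t -> f t - f x <= e * (t - x))) ->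
  f b <= f a.
Proof.
move=> ab H.
have K e : 0 < e -> f b - f a <= e * (b - a).
  move=> e0.
  pose S := [set x | a <= x <= b /\ f x - f a <= e * (x - a)].
  have Sa : S a by rewrite /S /= !subrr mulr0 !lexx ab.
  have hS : has_sup S.
    by split; [exists a | exists b => x [/andP[_ ?] _]].
  have ac : a <= sup S by apply: ub_le_sup => //; case: hS.
  have cb : sup S <= b by apply: ge_sup; [exists a | move=> x [/andP[_ ?] _]].
  have cab : a <= sup S <= b by rewrite ac.
  have [dl dl0 h] := H _ cab _ e0.
  have Sc : S (sup S).
    have [x Sx xd] := sup_adherent dl0 hS.
    have xc : x <= sup S by apply: ub_le_sup => //; case: hS.
    split=> //; case: Sx => xab hx.
    have := h x xab; rewrite ler0_norm ?subr_le0 // opprB => /(_ _)[].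
      by rewrite ltrBlDr addrC -ltrBlDr.
    by move=> _ /(_ xc); lra.
  have [bc|cb'] := leP b (sup S).
    have <- : sup S = b by apply/eqP; rewrite eq_le cb.
    by case: Sc.
  pose x := Num.min b (sup S + dl / 2).
  have xb : x <= b by rewrite ge_min lexx.
  have cx : sup S < x by rewrite lt_min cb' /= ltrDl divr_gt0.
  have xc : x - sup S < dl.
    rewrite ltrBlDl (le_lt_trans (_ : _ <= sup S + dl / 2)) ?ge_min ?lexx ?orbT //.
    by rewrite ltrD2l ltr_pdivrMr // ltr_pMr // ltr1n.
  have Sx : S x.
    split; first by rewrite xb andbT (le_trans ac) // ltW.
    have := h x; rewrite xb andbT (le_trans ac (ltW cx)) => /(_ isT).
    rewrite gtr0_norm ?subr_gt0 // => /(_ xc) [/(_ (ltW cx)) ? _].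
    by case: Sc => _; lra.
  have : x <= sup S by apply: ub_le_sup => //; case: hS.
  by rewrite leNgt cx.
rewrite leNgt; apply/negP => fab.
(* A slope below the mean slope gives the contradiction; the summand 1 keeps the denominator
   positive when a = b. *)
have := K ((f b - f a) / (2 * (b - a + 1))).
have b1 : 0 < b - a + 1 by rewrite ltr_pwDr // subr_ge0.
rewrite divr_gt0 ?subr_gt0 ?mulr_gt0 // => /(_ isT).
rewrite mulrAC ler_pdivlMr ?mulr_gt0 // mulrC.
have : 0 < f b - f a by rewrite subr_gt0.
by nra.
Qed.

Lemma rder_growth f f' a b M : a <= b ->
  (forall t, a <= t <= b -> rder [set x | a <= x <= b] f t (f' t)) ->
  (forall t, a <= t <= b -> f' t <= M) -> f b - f a <= M * (b - a).
Proof.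
move=> ab Hf HM.
suff : f b - M * b <= f a - M * a by lra.
apply: (@dini (fun x => f x - M * x) a b ab) => t tab e e0.
have [dl dl0 h] := Hf t tab e e0; exists dl => // x xab xt.
have := h x xab xt; rewrite ler_norml => /andP[h1 h2].
have hM := HM t tab.
split=> tx; move: h1 h2.
  rewrite ger0_norm ?subr_ge0 // => h1 h2.
  have : 0 <= (x - t) * (M - f' t) by rewrite mulr_ge0 ?subr_ge0.
  by lra.
rewrite ler0_norm ?subr_le0 // => h1 h2.
have : 0 <= (t - x) * (M - f' t) by rewrite mulr_ge0 ?subr_ge0.
by lra.
Qed.

Lemma rder_lipschitz f f' a b M : 
  (forall t, a <= t <= b -> rder [set x | a <= x <= b] f t (f' t)) ->
  (forall t, a <= t <= b -> `|f' t| <= M) ->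
  forall s t, a <= s <= b -> a <= t <= b -> `|f t - f s| <= M * `|t - s|.
Proof.
move=> Hf HM.
suff H s t : a <= s <= b -> a <= t <= b -> s <= t -> `|f t - f s| <= M * `|t - s|.
  move=> s t hs ht; have [?|/ltW ?] := leP s t; first exact: H.
  by rewrite distrC (distrC t); exact: H.
move=> /andP[as_ sb] /andP[at_ tb] st.
rewrite (ger0_norm (_ : 0 <= t - s)) ?subr_ge0 //.
have sub x : s <= x <= t -> a <= x <= b.
  by move=> /andP[h1 h2]; rewrite (le_trans as_ h1) (le_trans h2 tb).
have Hf' x : s <= x <= t -> rder [set x | s <= x <= t] f x (f' x).
  by move=> hx; apply: rder_sub (Hf x (sub x hx)) => y /sub.
rewrite ler_norml; apply/andP; split; last first.
  by apply: rder_growth st Hf' _ => x /sub /HM; exact/le_trans/ler_norm.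
rewrite lerNl opprB -[X in X - _]opprK addrC.
apply: (@rder_growth (fun x => - f x) (fun x => - f' x) s t M st) => x hx.
  exact/rderN/Hf'.
by apply: le_trans (HM x (sub x hx)); rewrite -normrN ler_norm.
Qed.

End RealDerivative.

(** * Derivatives of matrix functions and growth estimates *)

Section MatrixDerivative.
Variable R : realType.
Local Notation M2 := 'M[R[i]]_2.
Implicit Types (A B : set R) (y z : R -> M2) (f p : R -> R) (t x e : R) (D : M2).

Definition mder A y t D : Prop := forall e, 0 < e ->
  exists2 dl, 0 < dl & forall x, A x -> `|x - t| < dl ->
    nrm (y x - y t - (x - t)%:C *: D) <= e * `|x - t|.

Lemma mder_le A y t D : mder A y t D ->
  exists2 dl, 0 < dl & forall x, A x -> `|x - t| < dl ->
    nrm (y x - y t) <= (nrm D + 1) * `|x - t|.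
Proof.
move=> /(_ 1 ltr01) [dl dl0 H]; exists dl => // x Ax xt.
have := H x Ax xt; rewrite mul1r => h.
rewrite -(subrK ((x - t)%:C *: D) (y x - y t)).
by apply: (le_trans (nrmD _ _)); rewrite nrmR; lra.
Qed.

Lemma mder_sub A B y t D : B `<=` A -> mder A y t D -> mder B y t D.
Proof.
by move=> BA H e e0; have [dl dl0 h] := H e e0; exists dl => // x /BA; exact: h.
Qed.

Lemma mder_ext A y z t D : (forall x, A x -> y x = z x) -> A t ->
  mder A y t D -> mder A z t D.
Proof.
move=> fg At H e e0; have [dl dl0 h] := H e e0; exists dl => // x Ax.
by rewrite -!fg //; exact: h.
Qed.

Lemma mder_cst A D t : mder A (fun=> D) t 0.
Proof.
move=> e e0; exists 1 => // x _ _.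
by rewrite scaler0 !subrr nrm0 mulr_ge0 // ltW.
Qed.

Lemma mderD A y z t dy dz : mder A y t dy -> mder A z t dz ->
  mder A (fun x => y x + z x) t (dy + dz).
Proof.
move=> Hf Hg e e0; have e2 : 0 < e / 2 by rewrite divr_gt0.
have [d1 d10 h1] := Hf _ e2; have [d2 d20 h2] := Hg _ e2.
exists (Num.min d1 d2); first by rewrite lt_min d10.
move=> x Ax; rewrite lt_min => /andP[/(h1 x Ax) {}h1 /(h2 x Ax) {}h2].
rewrite (_ : _ - _ = (y x - y t - (x - t)%:C *: dy) + (z x - z t - (x - t)%:C *: dz)).
  by apply: (le_trans (nrmD _ _)); lra.
by apply/matrixP => a b; rewrite !mxE; ring.
Qed.

Lemma mderM A y z t dy dz : mder A y t dy -> mder A z t dz ->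
  mder A (fun x => y x *m z x) t (dy *m z t + y t *m dz).
Proof.
move=> Hf Hg e e0.
have [d3 d30 h3] := mder_le Hf; have [d4 d40 h4] := mder_le Hg.
pose F := nrm dy + 1; pose G := nrm dz + 1.
have F0 : 0 < F by rewrite ltr_pwDr // nrm_ge0.
have G0 : 0 < G by rewrite ltr_pwDr // nrm_ge0.
have gt0 := nrm_ge0 (z t); have ft0 := nrm_ge0 (y t).
have e1 : 0 < e / (3 * (1 + nrm (z t))) by rewrite divr_gt0 // mulr_gt0 // ltr_pwDl.
have e2 : 0 < e / (3 * (1 + nrm (y t))) by rewrite divr_gt0 // mulr_gt0 // ltr_pwDl.
have [d1 d10 h1] := Hf _ e1; have [d2 d20 h2] := Hg _ e2.
have d5 : 0 < e / (3 * (F * G)) by rewrite divr_gt0 // !mulr_gt0.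
exists (Num.min (Num.min d1 d2) (Num.min (e / (3 * (F * G))) (Num.min d3 d4))).
  by rewrite !lt_min d10 d20 d5 d30 d40.
move=> x Ax; rewrite !lt_min => /andP[/andP[/(h1 x Ax) {}h1 /(h2 x Ax) {}h2]].
move=> /andP[hx /andP[/(h3 x Ax) {}h3 /(h4 x Ax) {}h4]].
rewrite (_ : _ - _ = (y x - y t - (x - t)%:C *: dy) *m z t
  + y t *m (z x - z t - (x - t)%:C *: dz) + (y x - y t) *m (z x - z t)); last first.
  by apply/matrixP => a b; rewrite !(mulmx2E, mxE); ring.
apply: (le_trans (nrmD _ _)); apply: (le_trans (lerD (nrmD _ _) (lexx _))).
apply: (le_trans (lerD (lerD (nrmM _ _) (nrmM _ _)) (nrmM _ _))).
have k1 : nrm (y x - y t - (x - t)%:C *: dy) * nrm (z t) <= e / 3 * `|x - t|.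
  apply: (le_trans (ler_wpM2r gt0 h1)).
  by rewrite mulrAC ler_wpM2r // absorb // ltW.
have k2 : nrm (y t) * nrm (z x - z t - (x - t)%:C *: dz) <= e / 3 * `|x - t|.
  apply: (le_trans (ler_wpM2l ft0 h2)).
  by rewrite mulrA ler_wpM2r // mulrC absorb // ltW.
have k3 : nrm (y x - y t) * nrm (z x - z t) <= e / 3 * `|x - t|.
  apply: (le_trans (ler_pM (nrm_ge0 _) (nrm_ge0 _) h3 h4)).
  rewrite -/F -/G mulrA ler_wpM2r //.
  have : `|x - t| * (3 * (F * G)) <= e.
    by rewrite -ler_pdivlMr ?ltW // !mulr_gt0.
  by lra.
lra.
Qed.

Lemma mderMl A C y t D : mder A y t D -> mder A (fun x => C *m y x) t (C *m D).
Proof.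
by move=> H; have := mderM (mder_cst A C t) H; rewrite mul0mx add0r.
Qed.

Lemma mderZ A (c : R[i]) y t D : mder A y t D -> mder A (fun x => c *: y x) t (c *: D).
Proof.
have -> : (fun x => c *: y x) = (fun x => c%:M *m y x).
  by apply/funext => x; rewrite mul_scalar_mx.
by rewrite -(mul_scalar_mx c D); exact: mderMl.
Qed.

Lemma mderN A y t D : mder A y t D -> mder A (fun x => - y x) t (- D).
Proof.
have -> : (fun x => - y x) = (fun x => (-1 : R[i]) *: y x).
  by apply/funext => x; rewrite scaleN1r.
by rewrite -(scaleN1r D); exact: mderZ.
Qed.

Lemma mderB A y z t dy dz : mder A y t dy -> mder A z t dz ->
  mder A (fun x => y x - z x) t (dy - dz).
Proof. by move=> Hf /mderN; exact: mderD. Qed.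

Lemma mder_real A f t d D : rder A f t d ->
  mder A (fun x => (f x)%:C *: D) t (d%:C *: D).
Proof.
move=> H e e0; have e1 : 0 < e / (1 * (1 + nrm D)).
  by rewrite divr_gt0 // mul1r ltr_pwDl // nrm_ge0.
have [dl dl0 h] := H _ e1; exists dl => // x Ax xt.
rewrite scalerA -!scalerBl -rmorphM -!rmorphB /= nrmR.
apply: (le_trans (ler_wpM2r (nrm_ge0 _) (h x Ax xt))).
by rewrite mulrAC ler_wpM2r // -[leRHS]divr1 absorb // ?nrm_ge0 // ltW.
Qed.

Lemma mderMr_real A f y t d D : rder A f t d -> mder A y t D ->
  mder A (fun x => (f x)%:C *: y x) t (d%:C *: y t + (f t)%:C *: D).
Proof.
move=> /(@mder_real _ _ _ _ 1%:M) Hf Hy.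
have e (a : R) (P : M2) : a%:C *: P = a%:C *: 1%:M *m P by rewrite scalemx1 mul_scalar_mx.
have -> : (fun x => (f x)%:C *: y x) = (fun x => (f x)%:C *: 1%:M *m y x).
  by apply/funext => x; rewrite e.
by rewrite (e d (y t)) (e (f t) D); exact: mderM Hf Hy.
Qed.

Lemma mder_comp A B p y t a D : (forall x, A x -> B (p x)) ->
  rder A p t a -> mder B y (p t) D -> mder A (fun x => y (p x)) t (a%:C *: D).
Proof.
move=> AB Hp Hf e e0.
have [d1 d10 h1] := rder_le Hp.
pose P := `|a| + 1; have P0 : 0 < P by rewrite ltr_pwDr.
have e1 : 0 < e / (2 * P) by rewrite divr_gt0 // mulr_gt0.
have e2 : 0 < e / (2 * (1 + nrm D)).
  by rewrite divr_gt0 // mulr_gt0 // ltr_pwDl // nrm_ge0.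
have [d2 d20 h2] := Hf _ e1; have [d3 d30 h3] := Hp _ e2.
exists (Num.min d1 (Num.min (d2 / P) d3)).
  by rewrite !lt_min d10 d30 divr_gt0.
move=> x Ax; rewrite !lt_min => /andP[/(h1 x Ax) {}h1] /andP[hx /(h3 x Ax) {}h3].
have px : `|p x - p t| < d2.
  by apply: (le_lt_trans h1); rewrite -/P mulrC -ltr_pdivlMr.
have {}h2 := h2 _ (AB _ Ax) px.
rewrite (_ : _ - _ = (y (p x) - y (p t) - (p x - p t)%:C *: D)
  + (p x - p t - (x - t) * a)%:C *: D); last first.
  by apply/matrixP => i j; rewrite !mxE !rmorphB /= rmorphM /= rmorphB /=; ring.
apply: (le_trans (nrmD _ _)); rewrite nrmR.
have k1 : nrm (y (p x) - y (p t) - (p x - p t)%:C *: D) <= e / 2 * `|x - t|.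
  apply: (le_trans h2); apply: (le_trans (ler_wpM2l (ltW e1) h1)).
  rewrite -/P mulrA invfM mulrA mulfVK // ?gt_eqF //.
have k2 : `|p x - p t - (x - t) * a| * nrm D <= e / 2 * `|x - t|.
  apply: (le_trans (ler_wpM2r (nrm_ge0 _) h3)).
  by rewrite mulrAC ler_wpM2r // absorb // ?nrm_ge0 // ltW.
lra.
Qed.

Lemma mder_entry A y t D i j : mder A y t D ->
  rder A (fun x => complex.Re (y x i j)) t (complex.Re (D i j)) /\
  rder A (fun x => complex.Im (y x i j)) t (complex.Im (D i j)).
Proof.
move=> H; split=> e e0; have [dl dl0 h] := H e e0; exists dl => // x Ax xt;
  apply: le_trans (h x Ax xt); apply: le_trans (nrm_entry _ i j);
  rewrite /cnorm1 !mxE !(ReD, ImD, ReN, ImN) /= !ReRM !ImRM.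
  by rewrite lerDl.
by rewrite lerDr.
Qed.

Lemma entry_mder A y t D :
  (forall i j, rder A (fun x => complex.Re (y x i j)) t (complex.Re (D i j)) /\
    rder A (fun x => complex.Im (y x i j)) t (complex.Im (D i j))) ->
  mder A y t D.
Proof.
move=> H e e0; have e8 : 0 < e / 8 by rewrite divr_gt0.
have K i j : exists2 dl, 0 < dl & forall x, A x -> `|x - t| < dl ->
    cnorm1 ((y x - y t - (x - t)%:C *: D) i j) <= e / 4 * `|x - t|.
  have [/(_ _ e8)[d1 d10 h1] /(_ _ e8)[d2 d20 h2]] := H i j.
  exists (Num.min d1 d2); first by rewrite lt_min d10.
  move=> x Ax; rewrite lt_min => /andP[/(h1 x Ax) {}h1 /(h2 x Ax) {}h2].
  move: h1 h2; rewrite /cnorm1 !mxE !(ReD, ImD, ReN, ImN) /= !ReRM !ImRM.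
  by lra.
have [d1 d10 h1] := K ord0 ord0; have [d2 d20 h2] := K ord0 ord_max.
have [d3 d30 h3] := K ord_max ord0; have [d4 d40 h4] := K ord_max ord_max.
exists (Num.min (Num.min d1 d2) (Num.min d3 d4)); first by rewrite !lt_min d10 d20 d30.
move=> x Ax; rewrite !lt_min => /andP[/andP[/(h1 x Ax) {}h1 /(h2 x Ax) {}h2]].
move=> /andP[/(h3 x Ax) {}h3 /(h4 x Ax) {}h4].
by rewrite nrmE; lra.
Qed.

Lemma mder_Dt A y t D : accum A t -> mder A y t D ->
  derivable_mx_in A y t /\ Dt A y t = - 'i *: D.
Proof.
move=> At H; split=> [i j|].
  have [h1 h2] := mder_entry i j H.
  by have [? _] := rder_derive At h1; have [? _] := rder_derive At h2.
congr (_ *: _); apply/matrixP => i j; rewrite mxE.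
have [h1 h2] := mder_entry i j H.
have [_ ->] := rder_derive At h1; have [_ ->] := rder_derive At h2.
by case: (D i j).
Qed.

Lemma derivable_mder A y t : derivable_mx_in A y t -> mder A y t ('i *: Dt A y t).
Proof.
move=> H; apply: entry_mder => i j; have [h1 h2] := H i j.
rewrite /Dt scalerA mulrN -expr2 sqr_i opprK scale1r !mxE /=.
by split; exact: derivable_rder.
Qed.

Lemma adj2D D1 D2 : adj2 (D1 + D2) = adj2 D1 + adj2 D2.
Proof. by apply: mx2P; rewrite !mxE //= opprD. Qed.

Lemma adj2Z (c : R[i]) D : adj2 (c *: D) = c *: adj2 D.
Proof. by apply: mx2P; rewrite !mxE //= mulrN. Qed.

Lemma adj2N D : adj2 (- D) = - adj2 D.
Proof. by rewrite -scaleN1r adj2Z scaleN1r. Qed.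

Lemma cnorm1N (c : R[i]) : cnorm1 (- c) = cnorm1 c.
Proof. by rewrite /cnorm1 ReN ImN !normrN. Qed.

Lemma nrm_adj2 D : nrm (adj2 D) = nrm D.
Proof. by rewrite !nrmE !mxE /= !cnorm1N; lra. Qed.

Lemma mder_adj2 A y t D : mder A y t D -> mder A (fun x => adj2 (y x)) t (adj2 D).
Proof.
move=> H e e0; have [dl dl0 h] := H e e0; exists dl => // x Ax xt.
by rewrite -adj2Z -!adj2N -!adj2D nrm_adj2 h.
Qed.


(** Mean value inequality with [w] a primitive of a bound on the speed. The norm of an increment has
    no derivative in general, so [dini] is applied to this norm minus [w]. *)
Lemma mder_growth y y' (w w' : R -> R) a b : a <= b ->
  (forall t, a <= t <= b -> mder [set x | a <= x <= b] y t (y' t)) ->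
  (forall t, a <= t <= b -> rder [set x | a <= x <= b] w t (w' t)) ->
  (forall t, a <= t <= b -> nrm (y' t) <= w' t) ->
  nrm (y b - y a) <= w b - w a.
Proof.
move=> ab Hy Hw Hle.
suff : nrm (y b - y a) - w b <= nrm (y a - y a) - w a.
  by rewrite subrr nrm0; lra.
apply: (@dini _ (fun x => nrm (y x - y a) - w x) a b ab) => t tab e e0.
have e2 : 0 < e / 2 by rewrite divr_gt0.
have [d1 d10 h1] := Hy t tab _ e2; have [d2 d20 h2] := Hw t tab _ e2.
exists (Num.min d1 d2); first by rewrite lt_min d10.
move=> x xab; rewrite lt_min => /andP[/(h1 x xab) {}h1 /(h2 x xab) {}h2].
have hle := Hle t tab.
have tri u v : nrm (u - y a) <= nrm (u - v) + nrm (v - y a).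
  by apply: le_trans (nrmD _ _); rewrite addrA subrK.
have hd : nrm (y x - y t) <= e / 2 * `|x - t| + `|x - t| * w' t.
  rewrite -(subrK ((x - t)%:C *: y' t) (y x - y t)).
  apply: (le_trans (nrmD _ _)); rewrite nrmR.
  have := ler_wpM2l (normr_ge0 (x - t)) hle; lra.
move: h2; rewrite ler_norml => /andP[h2 h3].
split=> tx; move: h2 h3 hd.
  rewrite ger0_norm ?subr_ge0 // => h2 h3 hd.
  by have := tri (y x) (y t); lra.
rewrite ler0_norm ?subr_le0 // => h2 h3 hd.
by have := tri (y t) (y x); rewrite (nrmBC (y t) (y x)); lra.
Qed.

(** The squared Frobenius norm. It is a polynomial in the real components, hence differentiable,
    unlike [nrm]; the factors 64 below come from passing between the two. *)
Definition sqn D : R :=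
  \sum_i \sum_j (complex.Re (D i j) ^+ 2 + complex.Im (D i j) ^+ 2).

Lemma sqn_ge0 D : 0 <= sqn D.
Proof. by do 2!apply: sumr_ge0 => ? _; rewrite addr_ge0 ?sqr_ge0. Qed.

Lemma sqn_le D : sqn D <= nrm D ^+ 2.
Proof. by rewrite /sqn -mxnorm_sq ler_sqr ?nnegrE ?mxnorm_ge0 ?nrm_ge0 ?mxnorm_le_nrm. Qed.

Lemma nrm_le_sqn D : nrm D ^+ 2 <= 64 * sqn D.
Proof.
rewrite /sqn -mxnorm_sq (_ : 64 = 8 ^+ 2); last by ring.
by rewrite -exprMn ler_sqr ?nnegrE ?mulr_ge0 ?mxnorm_ge0 ?nrm_ge0 ?nrm_le_mxnorm.
Qed.

Lemma rder_sqn A y t D : mder A y t D ->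
  exists2 d, rder A (fun x => sqn (y x)) t d & `|d| <= 2 * (nrm (y t) * nrm D).
Proof.
move=> H.
exists (\sum_i \sum_j (2 * (complex.Re (y t i j) * complex.Re (D i j)
                     + complex.Im (y t i j) * complex.Im (D i j)))).
  apply: rder_sum => i; apply: rder_sum => j; have [h1 h2] := mder_entry i j H.
  have := rderD (rderM h1 h1) (rderM h2 h2).
  by congr rder; ring.
rewrite /nrm mulr_suml mulr_sumr (le_trans (ler_norm_sum _ _ _)) // ler_sum // => i _.
rewrite mulr_suml mulr_sumr (le_trans (ler_norm_sum _ _ _)) // ler_sum // => j _.
rewrite normrM ger0_norm // ler_wpM2l //.
apply: le_trans (ler_wpM2l (cnorm1_ge0 _) (nrm_entry D i j)).
rewrite /cnorm1; apply: (le_trans (ler_normD _ _)); rewrite !normrM.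
have hm (c d : R) : 0 <= `|c| * `|d| by rewrite mulr_ge0.
move: (hm (complex.Re (y t i j)) (complex.Im (D i j)))
  (hm (complex.Im (y t i j)) (complex.Re (D i j))); lra.
Qed.

Lemma rder_expR A f t d : rder A f t d ->
  rder A (fun x => expR (f x)) t (expR (f t) * d).
Proof.
move=> H; apply: (@rder_comp _ _ setT f expR) => //.
by apply: is_derive_rder; exact: is_derive_expR.
Qed.

(* Gronwall: [(|y|^2 + K^2) exp (- 192 p)] is nonincreasing. *)
Lemma gronwall y y' p p' K a b : a <= b -> 0 <= K ->
  (forall t, a <= t <= b -> mder [set x | a <= x <= b] y t (y' t)) ->
  (forall t, a <= t <= b -> rder [set x | a <= x <= b] p t (p' t)) ->
  (forall t, a <= t <= b -> 0 <= p' t /\ nrm (y' t) <= p' t * (nrm (y t) + K)) ->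
  nrm (y b) ^+ 2 <= 64 * (nrm (y a) ^+ 2 + K ^+ 2) * expR (192 * (p b - p a)).
Proof.
move=> ab K0 Hy Hp Hle.
have : (sqn (y b) + K ^+ 2) * expR (- (192 * p b)) <=
       (sqn (y a) + K ^+ 2) * expR (- (192 * p a)).
  have /choice[u' Hu] t : exists d, a <= t <= b ->
      rder [set x | a <= x <= b] (fun x => sqn (y x)) t d /\
      `|d| <= 2 * (nrm (y t) * nrm (y' t)).
    have [tab|] := boolP (a <= t <= b); last by exists 0.
    by have [d ? ?] := rder_sqn (Hy t tab); exists d.
  pose g t := (sqn (y t) + K ^+ 2) * expR (- (192 * p t)).
  pose g' t := (u' t - 192 * p' t * (sqn (y t) + K ^+ 2)) * expR (- (192 * p t)).
  suff : g b - g a <= 0 * (b - a) by rewrite /g; lra.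
  apply: (@rder_growth _ g g' a b 0 ab) => t tab; have [hu1 hu2] := Hu t tab.
    have := rderM (rderD hu1 (rder_cst _ (K ^+ 2) t))
      (rder_expR (rderN (rderZ 192 (Hp t tab)))).
    by congr rder; rewrite /g'; ring.
  rewrite /g' pmulr_lle0 ?expR_gt0 // subr_le0.
  have [p0 hle] := Hle t tab.
  apply: (le_trans (ler_norm _)); apply: (le_trans hu2).
  have n0 := nrm_ge0 (y t).
  apply: (@le_trans _ _ (2 * (nrm (y t) * (p' t * (nrm (y t) + K))))).
    by rewrite ler_wpM2l // ler_wpM2l.
  rewrite (_ : 2 * _ = p' t * (2 * (nrm (y t) * (nrm (y t) + K)))); last by ring.
  rewrite (mulrC 192) -mulrA ler_wpM2l //.
  (* With r = nrm (y t): 2 r (r + K) <= 3 r^2 + K^2 and r^2 <= 64 sqn (y t). This is the origin of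
     192 = 3 * 64. *)
  have := nrm_le_sqn (y t); nra.
move=> h; rewrite -(ler_pM2r (expR_gt0 (- (192 * p b)))) -[leRHS]mulrA -expRD.
have -> : 192 * (p b - p a) + - (192 * p b) = - (192 * p a) by ring.
have ea := expR_gt0 (- (192 * p a)); have eb := expR_gt0 (- (192 * p b)).
have h1 : nrm (y b) ^+ 2 * expR (- (192 * p b)) <=
    64 * ((sqn (y b) + K ^+ 2) * expR (- (192 * p b))).
  rewrite mulrA ler_pM2r // mulrDr; have := nrm_le_sqn (y b).
  by have := sqr_ge0 K; lra.
apply: (le_trans h1); rewrite -mulrA ler_pM2l //; apply: (le_trans h).
by rewrite ler_pM2r // lerD2r sqn_le.
Qed.

(** Reversed Gronwall: [sqn y] times exp (192 p) is nondecreasing. Applied to a determinant, it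
    keeps it away from zero. *)
Lemma gronwall_lower y y' p p' a b : a <= b ->
  (forall t, a <= t <= b -> mder [set x | a <= x <= b] y t (y' t)) ->
  (forall t, a <= t <= b -> rder [set x | a <= x <= b] p t (p' t)) ->
  (forall t, a <= t <= b -> 0 <= p' t /\ nrm (y' t) <= p' t * nrm (y t)) ->
  sqn (y a) <= sqn (y b) * expR (192 * (p b - p a)).
Proof.
move=> ab Hy Hp Hle.
have /choice[u' Hu] t : exists d, a <= t <= b ->
    rder [set x | a <= x <= b] (fun x => sqn (y x)) t d /\
    `|d| <= 2 * (nrm (y t) * nrm (y' t)).
  have [tab|] := boolP (a <= t <= b); last by exists 0.
  by have [d ? ?] := rder_sqn (Hy t tab); exists d.
pose g t := - (sqn (y t) * expR (192 * p t)).
pose g' t := - ((u' t + 192 * p' t * sqn (y t)) * expR (192 * p t)).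
have : g b - g a <= 0 * (b - a).
  apply: (@rder_growth _ g g' a b 0 ab) => t tab; have [hu1 hu2] := Hu t tab.
    have := rderN (rderM hu1 (rder_expR (rderZ 192 (Hp t tab)))).
    by congr rder; rewrite /g'; ring.
  rewrite /g' oppr_le0 pmulr_lge0 ?expR_gt0 //.
  have [p0 hle] := Hle t tab.
  have n0 := nrm_ge0 (y t).
  have : `|u' t| <= 192 * p' t * sqn (y t).
    apply: (le_trans hu2).
    apply: (@le_trans _ _ (2 * (nrm (y t) * (p' t * nrm (y t))))).
      by rewrite ler_wpM2l // ler_wpM2l.
    rewrite (_ : 2 * _ = p' t * (2 * nrm (y t) ^+ 2)); last by ring.
    rewrite (mulrC 192) -mulrA ler_wpM2l //.
    have := nrm_le_sqn (y t); have := sqn_ge0 (y t); nra.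
  by rewrite ler_norml => /andP[]; lra.
rewrite /g mul0r => h; rewrite -(ler_pM2r (expR_gt0 (192 * p a))) -[leRHS]mulrA -expRD.
have -> : 192 * (p b - p a) + 192 * p a = 192 * p b by ring.
lra.
Qed.

End MatrixDerivative.

(** * Primitives of Lipschitz functions *)

Section Primitive.
Variable R : realType.
Local Notation M2 := 'M[R[i]]_2.
Local Notation mu := (@lebesgue_measure R).
Implicit Types (g : R -> R) (a b x L : R).

Lemma continuous_rder_integral g : continuous g ->
  forall x, 0 <= x ->
  rder `[0, +oo[ (fun x => \int[mu]_(t in `[0, x]) g t) x (g x).
Proof.
move=> cg x x0.
have ig a b : mu.-integrable `[a, b] (EFin \o g).
  apply: continuous_compact_integrable; first exact: segment_compact.
  exact: continuous_subspaceT.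
(* With base point -1 also x = 0 is interior and the two-sided fundamental theorem applies; H 0 is
   subtracted afterwards. *)
pose H x := \int[mu]_(t in `[-1, x]) g t.
have Hx : rder `[0, +oo[ (fun x => H x - H 0) x (g x).
  rewrite -[g x]subr0; apply: rderB; last exact: rder_cst.
  apply: is_derive_rder.
  have x1 : x < x + 1 by rewrite ltrDl.
  have x2 : -1 < x by rewrite (lt_le_trans _ x0) // oppr_lt0.
  have [h1 h2] := continuous_FTC1_closed x1 (ig _ _) x2 (cg x).
  by apply: DeriveDef; [exact: h1|rewrite -derive1E; exact: h2].
apply: rder_ext Hx => [y|]; last by rewrite /= in_itv /= andbT.
rewrite /= in_itv /= andbT => y0.
rewrite /H (Rintegral_itvB (ig _ _)) ?bnd_simp ?lerN10 //.
apply: Rintegral_itv_obnd_cbnd; apply: integrableS (ig 0 y) => //.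
by apply: subset_itvr; rewrite bnd_simp.
Qed.

Lemma lipschitz_continuous g L : (forall x y, `|g x - g y| <= L * `|x - y|) ->
  continuous g.
Proof.
move=> H x; apply/cvgrPdist_le => e e0.
have L0 : 0 <= L.
  have := H 1 0; rewrite subr0 normr1 mulr1; exact: le_trans.
have d0 : 0 < e / (1 * (1 + L)) by rewrite divr_gt0 // mul1r ltr_pwDl.
apply/nbhs_ballP; exists (e / (1 * (1 + L))) => // y.
rewrite /ball /= => xy; apply: (le_trans (H x y)); rewrite mulrC.
apply: (le_trans (ler_wpM2r L0 (ltW xy))).
by rewrite -[leRHS]divr1 absorb // ltW.
Qed.

Lemma rder_integral g L :
  (forall x y, 0 <= x -> 0 <= y -> `|g x - g y| <= L * `|x - y|) ->
  forall x, 0 <= x ->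
  rder `[0, +oo[ (fun x => \int[mu]_(t in `[0, x]) g t) x (g x).
Proof.
move=> H x x0.
have L0 : 0 <= L.
  have := H 1 0 ler01 (lexx _); rewrite subr0 normr1 mulr1; exact: le_trans.
(* Constant extension to the left of 0: continuous on the whole line, with the same integrals over
   [0, x]. *)
pose h y := g (Num.max 0 y).
have hg y : 0 <= y -> h y = g y by move=> y0; rewrite /h max_r.
have ch : continuous h.
  apply: (@lipschitz_continuous _ L) => y z; rewrite /h.
  apply: (le_trans (H _ _ _ _)); rewrite ?le_max ?lexx // ler_wpM2l //.
  wlog yz : y z / y <= z.
    move=> W; have [?|/ltW ?] := leP y z; first exact: W.
    by rewrite distrC (distrC y); exact: W.
  rewrite distrC (distrC y) [leRHS]ger0_norm ?subr_ge0 //.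
  by have [y0|y0] := leP 0 y; have [z0|z0] := leP 0 z; rewrite ger0_norm; lra.
rewrite -hg //; apply: rder_ext (continuous_rder_integral ch x0); last first.
  by rewrite /= in_itv /= andbT.
move=> y _; apply: eq_Rintegral => z; rewrite inE /= in_itv /= => /andP[z0 _].
exact: hg.
Qed.

(** Provides the integral in the variation of constants formula. It is taken for each real component
    separately, with the argument cut off at 1 to obtain integrands on the half-line. *)
Lemma mder_integral (G : R -> M2) L :
  (forall x y, 0 <= x <= 1 -> 0 <= y <= 1 -> nrm (G x - G y) <= L * `|x - y|) ->
  exists W, W 0 = 0 /\
    forall x, 0 <= x <= 1 -> mder [set x | 0 <= x <= 1] W x (G x).
Proof.
move=> H.
have L0 : 0 <= L.
  have := H 1 0; rewrite !lexx ler01 subr0 normr1 mulr1 => /(_ isT isT).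
  exact/le_trans/nrm_ge0.
pose cl (x : R) := Num.min 1 x.
have clP x : 0 <= x -> 0 <= cl x <= 1.
  by move=> x0; rewrite le_min x0 ler01 ge_min lexx.
have clL x y : `|cl x - cl y| <= `|x - y|.
  rewrite /cl; wlog xy : x y / y <= x.
    move=> W; have [?|/ltW ?] := leP y x; first exact: W.
    by rewrite distrC (distrC x); exact: W.
  rewrite [leRHS]ger0_norm ?subr_ge0 //.
  have [x1|x1] := leP 1 x; have [y1|y1] := leP 1 y; rewrite ger0_norm; lra.
have K (f : M2 -> R) (fL : forall u v, `|f u - f v| <= nrm (u - v)) :
    exists w : R -> R, w 0 = 0 /\
    forall x, 0 <= x <= 1 -> rder [set x | 0 <= x <= 1] w x (f (G x)).
  exists (fun x => \int[mu]_(t in `[0, x]) f (G (cl t))).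
  split; first by rewrite set_itv1 Rintegral_set1.
  move=> x /andP[x0 x1].
  have -> : G x = G (cl x) by rewrite /cl min_r.
  have := @rder_integral (fun t => f (G (cl t))) L _ x x0.
  move=> h; apply: rder_sub (h _) => [y /andP[y0 y1]|y z y0 z0].
    by rewrite /= in_itv /= y0.
  apply: (le_trans (fL _ _)); apply: (le_trans (H _ _ (clP _ y0) (clP _ z0))).
  by rewrite ler_wpM2l.
have hR i j (u v : M2) : `|complex.Re (u i j) - complex.Re (v i j)| <= nrm (u - v).
  apply: le_trans (nrm_entry _ i j); rewrite /cnorm1 !mxE ReD ReN lerDl //.
have hI i j (u v : M2) : `|complex.Im (u i j) - complex.Im (v i j)| <= nrm (u - v).
  apply: le_trans (nrm_entry _ i j); rewrite /cnorm1 !mxE ImD ImN lerDr //.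
have /choice[wr Hr] (ij : 'I_2 * 'I_2) := K _ (hR ij.1 ij.2).
have /choice[wi Hi] (ij : 'I_2 * 'I_2) := K _ (hI ij.1 ij.2).
exists (fun x => \matrix_(i, j) (wr (i, j) x +i* wi (i, j) x)); split.
  apply/matrixP => i j; rewrite !mxE.
  by have [-> _] := Hr (i, j); have [-> _] := Hi (i, j).
move=> x x01; apply: entry_mder => i j.
have [_ /(_ x x01) h1] := Hr (i, j); have [_ /(_ x x01) h2] := Hi (i, j).
by split; [move: h1|move: h2]; apply: rder_ext => // y _; rewrite mxE.
Qed.

End Primitive.

(** Exact remainder of inversion: with G = F^-1 and g = k^-1 the first term is quadratic in F - k,
    and the second contains the Taylor remainder of F itself. *)
Lemma inv_taylor (R : realType) (G g F k D : 'M[R[i]]_2) (c : R[i]) :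
  G *m F = 1%:M -> k *m g = 1%:M ->
  G - g - c *: - (g *m D *m g) =
  G *m (F - k) *m g *m (F - k) *m g - g *m (F - k - c *: D) *m g.
Proof.
move=> GF kg.
have e1 : G *m (F - k) *m g = g - G.
  by rewrite mulmxBr mulmxBl GF mul1mx -mulmxA kg mulmx1.
have e2 : g *m (F - k - c *: D) *m g = g *m (F - k) *m g - c *: (g *m D *m g).
  by rewrite mulmxBr mulmxBl -scalemxAr -scalemxAl.
have e3 : (g - G) *m (F - k) *m g = g *m (F - k) *m g - G *m (F - k) *m g.
  by rewrite mulmxBl [LHS]mulmxBl.
rewrite e2 e1 e3 e1; move: (g *m (F - k) *m g) (g *m D *m g) => U V.
by apply/matrixP => p q; rewrite !mxE; ring.
Qed.

(** * Symbol families and parameter dependence of linear equations *)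

Section Symb.
Variable R : realType.
Local Notation M2 := 'M[R[i]]_2.
Variables (X I : Type) (mv : I -> R -> X -> X) (O : set X).
Implicit Types (f g : R -> X -> M2) (w rho : R -> X -> R) (x : X) (i : I) (J : nat)
  (s h : R).

(* Families [f s x] of matrices depend on a variable [s] in [0, 1], in which
   everything is uniform, and on a point [x] of [O]; [mv i h x] moves [x] by [h]
   in direction [i].  In [symb J rho w f] the family is bounded by a multiple of
   the weight [w], and each of up to [J] derivatives costs a factor [rho].
   Derivatives are encoded by second order remainders ([dquad]), so that no
   continuity of the last derivative is needed. *)
Definition bnd w f : Prop := exists2 C, 0 <= C &
  forall s x, 0 <= s <= 1 -> O x -> nrm (f s x) <= C * w s x.

Definition lip f : Prop := forall x, O x -> exists2 L, 0 <= L &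
  forall s s', 0 <= s <= 1 -> 0 <= s' <= 1 ->
    nrm (f s x - f s' x) <= L * `|s - s'|.

Definition dquad i f g : Prop := forall x, O x -> exists K e, [/\ 0 <= K, 0 < e &
  forall s h, 0 <= s <= 1 -> `|h| < e -> O (mv i h x) ->
    nrm (f s (mv i h x) - f s x - h%:C *: g s x) <= K * h ^+ 2].

Fixpoint symb J rho w f : Prop := [/\ bnd w f, lip f &
  if J is J'.+1 then forall i, exists2 g, dquad i f g &
    symb J' rho (fun s x => w s x * rho s x) g
  else True].

Lemma symb_bnd J rho w f : symb J rho w f -> bnd w f.
Proof. by case: J => [|J] []. Qed.

Lemma symb_lip J rho w f : symb J rho w f -> lip f.
Proof. by case: J => [|J] []. Qed.

Lemma symbS J rho w f : symb J.+1 rho w f -> symb J rho w f.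
Proof.
elim: J w f => [|J IH] w f; first by case.
by case=> h1 h2 h3; split=> // i; have [g ? /IH ?] := h3 i; exists g.
Qed.

Lemma symb_ext J rho w f g :
  (forall s x, 0 <= s <= 1 -> O x -> f s x = g s x) ->
  symb J rho w f -> symb J rho w g.
Proof.
move=> fg H.
have {}H : [/\ bnd w f, lip f & if J is J'.+1 then forall i, exists2 g, dquad i f g &
    symb J' rho (fun s x => w s x * rho s x) g else True].
  by case: J H.
have K : [/\ bnd w g, lip g & if J is J'.+1 then forall i, exists2 k, dquad i g k &
    symb J' rho (fun s x => w s x * rho s x) k else True]; last by case: J {H} K.
case: H => [[C C0 h1] h2 h3]; split.
- by exists C => // s x s01 Ox; rewrite -fg //; exact: h1.
- move=> x Ox; have [L L0 h] := h2 x Ox; exists L => // s s' s01 s01'.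
  by rewrite -!fg //; exact: h.
- case: J h3 => // J h3 i; have [k h4 h5] := h3 i; exists k => // x Ox.
  have [K [e [K0 e0 h]]] := h4 x Ox; exists K, e; split=> // s d s01 de Od.
  by rewrite -!fg //; exact: h.
Qed.

Lemma symb_eqw J rho w w' f : (forall s x, w s x = w' s x) ->
  symb J rho w f -> symb J rho w' f.
Proof. by move=> ww'; rewrite (_ : w' = w) //; do 2!apply/funext => ?. Qed.

(** Only the products w rho^j with j <= J occur as bounds, so a better weight can pay for a higher
    cost per derivative. In this way a loss of 1 + t' per derivative is later turned into a loss of
    1/|xi|. *)
Lemma symb_weight J rho w rho' w' f :
  (forall j, (j <= J)%N -> exists2 C, 0 <= C & forall s x, 0 <= s <= 1 -> O x ->
     w s x * rho s x ^+ j <= C * (w' s x * rho' s x ^+ j)) ->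
  symb J rho w f -> symb J rho' w' f.
Proof.
have B w1 w2 k : (exists2 C, 0 <= C & forall s x, 0 <= s <= 1 -> O x ->
     w1 s x * rho s x ^+ 0 <= C * (w2 s x * rho' s x ^+ 0)) ->
    bnd w1 k -> bnd w2 k.
  move=> [C C0 h] [D D0 hD]; exists (D * C); first exact: mulr_ge0.
  move=> s x s01 Ox; have := h s x s01 Ox; rewrite !expr0 !mulr1 => h'.
  apply: (le_trans (hD s x s01 Ox)); rewrite -mulrA ler_wpM2l //.
elim: J w w' f => [|J IH] w w' f H.
  by case=> [h1 h2 _]; split=> //; apply: B h1; exact: H.
case=> [h1 h2 h3]; split=> //; first by apply: B h1; exact: H.
move=> i; have [g h4 h5] := h3 i; exists g => //; apply: IH h5 => j jJ.
have [C C0 h] := H j.+1 jJ; exists C => // s x s01 Ox.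
by have := h s x s01 Ox; rewrite !exprS !mulrA.
Qed.

Lemma lip_bounded f : lip f -> forall x, O x -> exists2 B, 0 <= B &
  forall s, 0 <= s <= 1 -> nrm (f s x) <= B.
Proof.
move=> H x Ox; have [L L0 h] := H x Ox; exists (nrm (f 0 x) + L).
  by rewrite addr_ge0 // nrm_ge0.
move=> s s01; have h1 : nrm (f s x - f 0 x) <= L * `|s - 0|.
  by apply: h; rewrite // lexx ler01.
rewrite -(subrK (f 0 x) (f s x)); apply: (le_trans (nrmD _ _)).
rewrite addrC lerD2l (le_trans h1) // subr0 ler_piMr //.
by case/andP: s01 => ? ?; rewrite ger0_norm.
Qed.

(** The first order consequence of a quadratic remainder; for |h| < 1 the term K h^2 is absorbed
    into K |h|. *)
Lemma dquad_le i f g : dquad i f g -> lip g -> forall x, O x -> exists B e,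
  [/\ 0 <= B, 0 < e & forall s h, 0 <= s <= 1 -> `|h| < e -> O (mv i h x) ->
    nrm (f s (mv i h x) - f s x) <= B * `|h|].
Proof.
move=> H Hg x Ox; have [K [e [K0 e0 h]]] := H x Ox.
have [B B0 hB] := lip_bounded Hg Ox.
exists (K + B), (Num.min e 1); split; [exact: addr_ge0|by rewrite lt_min e0 ltr01|].
move=> s d s01; rewrite lt_min => /andP[de d1] Od.
rewrite -(subrK (d%:C *: g s x) (f s (mv i d x) - f s x)).
apply: (le_trans (nrmD _ _)); rewrite nrmR mulrDl; apply: lerD.
  apply: (le_trans (h s d s01 de Od)); rewrite ler_wpM2l //.
  by rewrite -(@real_normK _ d) ?num_real // expr2 ler_piMr // ltW.
by rewrite mulrC ler_wpM2r // hB.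
Qed.

Lemma lip_cst (F : X -> M2) : lip (fun=> F).
Proof. by move=> x _; exists 0 => // *; rewrite subrr nrm0 mul0r. Qed.

Lemma lipD f g : lip f -> lip g -> lip (fun s x => f s x + g s x).
Proof.
move=> Hf Hg x Ox; have [L L0 h] := Hf x Ox; have [L' L0' h'] := Hg x Ox.
exists (L + L'); first exact: addr_ge0.
move=> s s' s01 s01'; rewrite opprD addrACA mulrDl.
apply: (le_trans (nrmD _ _)); apply: lerD; [exact: h|exact: h'].
Qed.

Lemma lipM f g : lip f -> lip g -> lip (fun s x => f s x *m g s x).
Proof.
move=> Hf Hg x Ox; have [L L0 h] := Hf x Ox; have [L' L0' h'] := Hg x Ox.
have [B B0 hB] := lip_bounded Hf Ox; have [B' B0' hB'] := lip_bounded Hg Ox.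
exists (L * B' + B * L'); first by rewrite addr_ge0 ?mulr_ge0.
move=> s s' s01 s01'.
have -> : f s x *m g s x - f s' x *m g s' x =
    (f s x - f s' x) *m g s x + f s' x *m (g s x - g s' x).
  by rewrite mulmxBl mulmxBr addrA subrK.
apply: (le_trans (nrmD _ _)); rewrite mulrDl; apply: lerD.
  apply: (le_trans (nrmM _ _)); rewrite mulrAC.
  by apply: ler_pM; rewrite ?nrm_ge0 ?h ?hB'.
apply: (le_trans (nrmM _ _)); rewrite -mulrA.
by apply: ler_pM; rewrite ?nrm_ge0 ?h' ?hB.
Qed.

Lemma lip_inv f : lip f -> (forall s x, 0 <= s <= 1 -> O x -> f s x \in unitmx) ->
  (forall x, O x -> exists2 B, 0 <= B & forall s, 0 <= s <= 1 -> nrm (invmx (f s x)) <= B) ->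
  lip (fun s x => invmx (f s x)).
Proof.
move=> Hf Hu HB x Ox; have [L L0 h] := Hf x Ox; have [B B0 hB] := HB x Ox.
exists (B * (L * B)); first by rewrite !mulr_ge0.
move=> s s' s01 s01'.
have -> : invmx (f s x) - invmx (f s' x) =
    - (invmx (f s x) *m ((f s x - f s' x) *m invmx (f s' x))).
  by rewrite mulmxBl mulmxBr mulmxV ?Hu // mulmx1 mulKmx ?Hu // opprB.
rewrite nrmN; apply: (le_trans (nrmM _ _)); rewrite -mulrA; apply: ler_pM;
  rewrite ?nrm_ge0 ?hB //.
apply: (le_trans (nrmM _ _)); rewrite mulrAC; apply: ler_pM; rewrite ?nrm_ge0 ?hB //.
exact: h.
Qed.

Lemma dquadD i f g f' g' : dquad i f f' -> dquad i g g' ->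
  dquad i (fun s x => f s x + g s x) (fun s x => f' s x + g' s x).
Proof.
move=> Hf Hg x Ox; have [K [e [K0 e0 h]]] := Hf x Ox.
have [K' [e' [K0' e0' h']]] := Hg x Ox.
exists (K + K'), (Num.min e e'); split; [exact: addr_ge0|by rewrite lt_min e0|].
move=> s d s01; rewrite lt_min => /andP[de de'] Od.
rewrite (_ : _ - _ = (f s (mv i d x) - f s x - d%:C *: f' s x) +
  (g s (mv i d x) - g s x - d%:C *: g' s x)); last first.
  by apply/matrixP => a b; rewrite !mxE; ring.
by apply: (le_trans (nrmD _ _)); rewrite mulrDl; apply: lerD; [exact: h|exact: h'].
Qed.

Lemma dquadM i f g f' g' : lip f -> lip g -> lip f' -> lip g' ->
  dquad i f f' -> dquad i g g' ->
  dquad i (fun s x => f s x *m g s x) (fun s x => f' s x *m g s x + f s x *m g' s x).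
Proof.
move=> lf lg lf' lg' Hf Hg x Ox.
have [K1 [e1 [K10 e10 h1]]] := Hf x Ox; have [K2 [e2 [K20 e20 h2]]] := Hg x Ox.
have [K3 [e3 [K30 e30 h3]]] := dquad_le Hf lf' Ox.
have [K4 [e4 [K40 e40 h4]]] := dquad_le Hg lg' Ox.
have [B1 B10 b1] := lip_bounded lf Ox; have [B2 B20 b2] := lip_bounded lg Ox.
exists (K1 * B2 + B1 * K2 + K3 * K4), (Num.min (Num.min e1 e2) (Num.min e3 e4)).
split; [by rewrite !addr_ge0 ?mulr_ge0|by rewrite !lt_min e10 e20 e30|].
move=> s d s01; rewrite !lt_min => /andP[/andP[d1 d2] /andP[d3 d4]] Od.
have {}h1 := h1 s d s01 d1 Od; have {}h2 := h2 s d s01 d2 Od.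
have {}h3 := h3 s d s01 d3 Od; have {}h4 := h4 s d s01 d4 Od.
rewrite (_ : _ - _ = (f s (mv i d x) - f s x - d%:C *: f' s x) *m g s x +
  f s x *m (g s (mv i d x) - g s x - d%:C *: g' s x) +
  (f s (mv i d x) - f s x) *m (g s (mv i d x) - g s x)); last first.
  by apply/matrixP => a b; rewrite !(mulmx2E, mxE); ring.
apply: (le_trans (nrmD _ _)); apply: (le_trans (lerD (nrmD _ _) (lexx _))).
rewrite !mulrDl; apply: lerD; first apply: lerD.
- apply: (le_trans (nrmM _ _)); rewrite mulrAC.
  by apply: ler_pM; rewrite ?nrm_ge0 // b2.
- apply: (le_trans (nrmM _ _)); rewrite -mulrA.
  by apply: ler_pM; rewrite ?nrm_ge0 // b1.
- apply: (le_trans (nrmM _ _)); rewrite -[d ^+ 2]ger0_norm ?sqr_ge0 // normrX expr2.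
  by rewrite mulrACA; apply: ler_pM; rewrite ?nrm_ge0.
Qed.

Lemma symbD J rho w f g : symb J rho w f -> symb J rho w g ->
  symb J rho w (fun s x => f s x + g s x).
Proof.
have B w' k k' : bnd w' k -> bnd w' k' -> bnd w' (fun s x => k s x + k' s x).
  move=> [C C0 h] [C' C0' h']; exists (C + C'); first exact: addr_ge0.
  move=> s x s01 Ox; apply: (le_trans (nrmD _ _)).
  by rewrite mulrDl; apply: lerD; [exact: h|exact: h'].
elim: J w f g => [|J IH] w f g.
  by move=> [h1 h2 _] [k1 k2 _]; split; [exact: B|exact: lipD|].
move=> [h1 h2 h3] [k1 k2 k3]; split; [exact: B|exact: lipD|] => i.
have [f' h4 h5] := h3 i; have [g' k4 k5] := k3 i.
by exists (fun s x => f' s x + g' s x); [exact: dquadD|exact: IH].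
Qed.

Lemma symbM J rho w1 w2 f g : symb J rho w1 f -> symb J rho w2 g ->
  symb J rho (fun s x => w1 s x * w2 s x) (fun s x => f s x *m g s x).
Proof.
have B w' w'' k k' : bnd w' k -> bnd w'' k' ->
    bnd (fun s x => w' s x * w'' s x) (fun s x => k s x *m k' s x).
  move=> [C C0 h] [C' C0' h']; exists (C * C'); first exact: mulr_ge0.
  move=> s x s01 Ox; apply: (le_trans (nrmM _ _)).
  by rewrite mulrACA; apply: ler_pM; rewrite ?nrm_ge0 ?h ?h'.
elim: J w1 w2 f g => [|J IH] w1 w2 f g.
  by move=> [h1 h2 _] [k1 k2 _]; split; [exact: B|exact: lipM|].
move=> H1 H2; case: (H1) => [h1 h2 h3]; case: (H2) => [k1 k2 k3].
split; [exact: B|exact: lipM|] => i.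
have [f' h4 h5] := h3 i; have [g' k4 k5] := k3 i.
exists (fun s x => f' s x *m g s x + f s x *m g' s x).
  by apply: dquadM => //; [exact: symb_lip h5|exact: symb_lip k5].
apply: symbD.
  apply: symb_eqw (IH _ _ _ _ h5 (symbS H2)) => s x /=; ring.
by apply: symb_eqw (IH _ _ _ _ (symbS H1) k5) => s x /=; ring.
Qed.

Lemma symb_cst J rho w f : bnd w f -> lip f ->
  (forall i h s x, f s (mv i h x) = f s x) -> symb J rho w f.
Proof.
elim: J w f => // J IH w f h1 h2 h3; split=> // i.
exists (fun _ _ => 0).
  move=> x Ox; exists 0, 1; split=> // s d s01 d1 Od.
  by rewrite h3 scaler0 !subrr nrm0 mul0r.
apply: IH => //; last exact: lip_cst.
by exists 0 => // s x _ _; rewrite nrm0 mul0r.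
Qed.

Lemma symbMl J rho w f (D : M2) : symb J rho w f -> symb J rho w (fun s x => D *m f s x).
Proof.
move=> H; apply: symb_eqw (symbM (w1 := fun _ _ => 1) (f := fun _ _ => D) _ H).
  by move=> s x /=; rewrite mul1r.
apply: symb_cst => //; last exact: lip_cst.
by exists (nrm D) => [|s x _ _]; rewrite ?nrm_ge0 // mulr1.
Qed.

Lemma symbMr J rho w f (D : M2) : symb J rho w f -> symb J rho w (fun s x => f s x *m D).
Proof.
move=> H; apply: symb_eqw (symbM (w2 := fun _ _ => 1) (g := fun _ _ => D) H _).
  by move=> s x /=; rewrite mulr1.
apply: symb_cst => //; last exact: lip_cst.
by exists (nrm D) => [|s x _ _]; rewrite ?nrm_ge0 // mulr1.
Qed.

Lemma symbZ J rho w f (c : R[i]) : symb J rho w f -> symb J rho w (fun s x => c *: f s x).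
Proof.
by move/(symbMl c%:M); apply: symb_ext => s x _ _; rewrite mul_scalar_mx.
Qed.

Lemma symbN J rho w f : symb J rho w f -> symb J rho w (fun s x => - f s x).
Proof.
by move/(symbZ (-1)); apply: symb_ext => s x _ _; rewrite scaleN1r.
Qed.

(** The derivative -f^-1 f' f^-1 contains the inverse at one order less, hence the induction; w w'
    <= C reduces its weight w' (w rho) w' to w' rho. The bounds on w' at x and near x, uniform in s,
    make the constant in the remainder from [inv_taylor] independent of s. *)
Lemma symb_inv J rho w w' f :
  (forall s x, 0 <= s <= 1 -> O x -> f s x \in unitmx) ->
  bnd w' (fun s x => invmx (f s x)) ->
  (exists2 C, 0 <= C & forall s x, 0 <= s <= 1 -> O x -> w s x * w' s x <= C) ->
  (forall s x, 0 <= s <= 1 -> O x -> 0 <= rho s x /\ 0 <= w' s x) ->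
  (forall x, O x -> exists2 B, 0 <= B & forall s, 0 <= s <= 1 -> w' s x <= B) ->
  (forall i x, O x -> exists B e, [/\ 0 <= B, 0 < e & forall s h, 0 <= s <= 1 ->
     `|h| < e -> O (mv i h x) -> w' s (mv i h x) <= B]) ->
  symb J rho w f -> symb J rho w' (fun s x => invmx (f s x)).
Proof.
move=> Hu [C C0 hC] [D D0 hD] H0 Hx Hi.
have HB x : O x -> exists2 B, 0 <= B & forall s, 0 <= s <= 1 -> nrm (invmx (f s x)) <= B.
  move=> Ox; have [B B0 hB] := Hx x Ox; exists (C * B); first exact: mulr_ge0.
  by move=> s s01; apply: (le_trans (hC s x s01 Ox)); rewrite ler_wpM2l // hB.
elim: J => [|J IH].
  by case=> h1 h2 _; split=> //; [exists C|exact: lip_inv].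
move=> H; case: (H) => h1 h2 h3; split; [by exists C|exact: lip_inv|] => i.
have {}IH := IH (symbS H).
have [f' h4 h5] := h3 i.
exists (fun s x => - (invmx (f s x) *m f' s x *m invmx (f s x))); last first.
  apply: symbN; apply: symb_weight (symbM (symbM IH h5) IH) => j _.
  exists D => // s x s01 Ox; have [r0 w0] := H0 s x s01 Ox.
  have := hD s x s01 Ox; set u := w s x; set v := w' s x; set r := rho s x => uv.
  rewrite (_ : v * (u * r) * v * r ^+ j = (u * v) * (v * r * r ^+ j)); last by ring.
  by rewrite ler_wpM2r // !mulr_ge0 // exprn_ge0.
move=> x Ox; have [B B0 hB] := HB x Ox.
have [B1 [e1 [B10 e10 hB1]]] := Hi i x Ox.
have [K2 [e2 [K20 e20 h6]]] := h4 x Ox.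
have [K3 [e3 [K30 e30 h7]]] := dquad_le h4 (symb_lip h5) Ox.
exists (C * B1 * K3 * B * K3 * B + B * K2 * B), (Num.min e1 (Num.min e2 e3)).
split; [by rewrite addr_ge0 // !mulr_ge0|by rewrite !lt_min e10 e20|].
move=> s d s01; rewrite !lt_min => /andP[d1 /andP[d2 d3]] Od.
have {}h6 := h6 s d s01 d2 Od; have {}h7 := h7 s d s01 d3 Od.
have ux := Hu s x s01 Ox; have ud := Hu s _ s01 Od.
have h8 : nrm (invmx (f s (mv i d x))) <= C * B1.
  by apply: (le_trans (hC s _ s01 Od)); rewrite ler_wpM2l // hB1.
set G := invmx (f s (mv i d x)) in h8 *; set g := invmx (f s x).
have hg : nrm g <= B by exact: hB.
set F := f s (mv i d x) in h6 h7 *; set k := f s x in h6 h7 *.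
have GF : G *m F = 1%:M by rewrite /G mulVmx.
have kg : k *m g = 1%:M by rewrite /g mulmxV.
rewrite (inv_taylor (f' s x) d%:C GF kg).
apply: (le_trans (nrmB _ _)); rewrite mulrDl; apply: lerD.
  rewrite -[d ^+ 2]ger0_norm ?sqr_ge0 // normrX expr2.
  rewrite (_ : _ * (`|d| * `|d|) = C * B1 * (K3 * `|d|) * B * (K3 * `|d|) * B); last by ring.
  do 4!(apply: (le_trans (nrmM _ _)); apply: ler_pM; rewrite ?nrm_ge0 //).
apply: (le_trans (nrmM _ _)); rewrite mulrAC; apply: ler_pM; rewrite ?nrm_ge0 //.
by apply: (le_trans (nrmM _ _)); rewrite -mulrA; apply: ler_pM; rewrite ?nrm_ge0.
Qed.

End Symb.

(** * Linear equations depending on a parameter *)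

Section SymbOde.
Variable R : realType.
Local Notation M2 := 'M[R[i]]_2.
Local Notation I01 := [set z : R | 0 <= z <= 1].

Lemma expR_sqr (x : R) : expR x ^+ 2 = expR (2 * x).
Proof. by rewrite expRM_natl. Qed.

(** Square root of [gronwall] for zero initial value: 64 = 8^2 and 192 = 2 * 96. *)
Lemma gronwall_unit (y y' : R -> M2) M K : 0 <= M -> 0 <= K -> y 0 = 0 ->
  (forall t, 0 <= t <= 1 -> mder I01 y t (y' t)) ->
  (forall t, 0 <= t <= 1 -> nrm (y' t) <= M * (nrm (y t) + K)) ->
  forall s, 0 <= s <= 1 -> nrm (y s) <= 8 * expR (96 * M) * K.
Proof.
move=> M0 K0 y0 Hy Hle s /andP[s0 s1].
have sub t : 0 <= t <= s -> 0 <= t <= 1.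
  by case/andP=> -> ts /=; exact: le_trans s1.
have := @gronwall R y y' (fun t => M * t) (fun=> M) K 0 s s0 K0.
rewrite y0 nrm0 expr0n /= add0r mulr0 subr0 => h.
have {}h : nrm (y s) ^+ 2 <= 64 * K ^+ 2 * expR (192 * (M * s)); first apply: h.
- by move=> t ts; apply: mder_sub (Hy t (sub _ ts)) => z; exact: sub.
- move=> t ts; have := rderZ M (@rder_id R [set x | 0 <= x <= s] t); by rewrite mulr1.
- by move=> t ts; split=> //; apply: Hle; exact: sub.
rewrite -ler_sqr ?nnegrE ?nrm_ge0 ?mulr_ge0 ?expR_ge0 //.
apply: (le_trans h).
have e1 : expR (192 * (M * s)) <= expR (96 * M) ^+ 2.
  rewrite expR_sqr ler_expR (_ : 2 * (96 * M) = 192 * M); last by ring.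
  by rewrite ler_wpM2l // -[leRHS]mulr1 ler_wpM2l.
have k2 : 0 <= 64 * K ^+ 2 by rewrite mulr_ge0 // sqr_ge0.
by have := ler_wpM2l k2 e1; lra.
Qed.

Variables (X I : Type) (mv : I -> R -> X -> X) (O : set X).
Local Notation symb := (symb mv O).
(** [a] is the weight of the generator [A], and [p] a primitive of [a] in s. As the increase of [p]
    is at most [Cp] for all x, the Gronwall constant in [ode_bnd] is uniform in x. [Phi] solves the
    homogeneous equation and serves for variation of constants. *)
Variables (r : X -> R) (a p : R -> X -> R) (Cp : R) (A Phi : R -> X -> M2).
Hypothesis r0 : forall x, O x -> 0 <= r x.
Hypothesis a0 : forall s x, 0 <= s <= 1 -> O x -> 0 <= a s x.
Hypothesis pa : forall s x, 0 <= s <= 1 -> O x -> rder I01 (p^~ x) s (a s x).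
Hypothesis pC : forall s x, 0 <= s <= 1 -> O x -> p s x - p 0 x <= Cp.
Hypothesis PhiA : forall s x, 0 <= s <= 1 -> O x ->
  mder I01 (Phi^~ x) s (A s x *m Phi s x).
Hypothesis Phi1 : forall x, O x -> Phi 0 x = 1%:M.
Hypothesis Phiu : forall s x, 0 <= s <= 1 -> O x -> Phi s x \in unitmx.
Hypothesis Phiv : forall x, O x -> exists2 B, 0 <= B &
  forall s, 0 <= s <= 1 -> nrm (invmx (Phi s x)) <= B.

Let rho := fun (_ : R) (x : X) => r x.

Let ode_lip (y y' : R -> X -> M2) :
  (forall s x, 0 <= s <= 1 -> O x -> mder I01 (y^~ x) s (y' s x)) ->
  (forall x, O x -> exists2 B, 0 <= B & forall s, 0 <= s <= 1 -> nrm (y' s x) <= B) ->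
  lip O y.
Proof.
move=> H HB x Ox; have [B B0 hB] := HB x Ox; exists B => //.
have K s s' : 0 <= s <= 1 -> 0 <= s' <= 1 -> s <= s' ->
    nrm (y s' x - y s x) <= B * `|s' - s|.
  move=> /andP[s0 s1] /andP[s0' s1'] ss'.
  have sub t : s <= t <= s' -> 0 <= t <= 1.
    by case/andP=> h1 h2; rewrite (le_trans s0 h1) (le_trans h2 s1').
  rewrite ger0_norm ?subr_ge0 // mulrBr.
  apply: (@mder_growth R (y^~ x) (y'^~ x) (fun t => B * t) (fun=> B)) => // t ts.
  - by apply: mder_sub (H t x (sub t ts) Ox) => z; exact: sub.
  - by have := rderZ B (@rder_id R [set x | s <= x <= s'] t); rewrite mulr1.
  - by apply: hB; exact: sub.
move=> s s' hs hs'; have [ss'|/ltW ss'] := leP s' s; first exact: K.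
by rewrite nrmBC distrC; exact: K.
Qed.

(** The speed A Phi is bounded once Phi is, and Phi is bounded by Gronwall for Phi - I, which starts
    at 0. The constants may depend on x, as [lip] permits. *)
Let Phi_lip J : symb J rho a A -> lip O Phi.
Proof.
move=> HA; apply: (ode_lip PhiA) => x Ox.
have [B B0 hB] := lip_bounded (symb_lip HA) Ox.
have [C C0 hC] : exists2 C, 0 <= C & forall s, 0 <= s <= 1 -> nrm (Phi s x) <= C.
  exists (2 + 8 * expR (96 * B) * 2).
    by rewrite addr_ge0 // !mulr_ge0 // expR_ge0.
  move=> s s01; rewrite -(subrK 1%:M (Phi s x)) addrC.
  apply: (le_trans (nrmD _ _)); rewrite nrm1 lerD2l.
  apply: (@gronwall_unit (fun s => Phi s x - 1%:M) (fun s => A s x *m Phi s x)) => //.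
    by rewrite Phi1 // subrr.
    move=> t t01; have := mderB (PhiA t01 Ox) (mder_cst I01 1%:M t).
    by rewrite subr0.
  move=> t t01; apply: (le_trans (nrmM _ _)).
  apply: ler_pM; rewrite ?nrm_ge0 ?hB //.
  by rewrite -{1}(subrK 1%:M (Phi t x)) (le_trans (nrmD _ _)) // nrm1.
exists (B * C); first exact: mulr_ge0.
by move=> s s01; apply: (le_trans (nrmM _ _)); apply: ler_pM; rewrite ?nrm_ge0 ?hB ?hC.
Qed.

(** The source carries the weight of A times kappa, so both terms enter Gronwall through the same
    exponent C p, with kappa x as the constant K. *)
Let ode_bnd (kappa : X -> R) (g y : R -> X -> M2) :
  (forall x, O x -> 0 <= kappa x) ->
  bnd O a A -> bnd O (fun s x => a s x * kappa x) g ->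
  (forall s x, 0 <= s <= 1 -> O x ->
     mder I01 (y^~ x) s (A s x *m y s x + g s x)) ->
  (exists2 C, 0 <= C & forall x, O x -> nrm (y 0 x) <= C * kappa x) ->
  bnd O (fun _ x => kappa x) y.
Proof.
move=> k0 [CA CA0 hA] [Cg Cg0 hg] Hy [C0 C00 h0].
pose C := CA + Cg.
have C1 : 0 <= C by exact: addr_ge0.
exists (8 * (C0 + 1) * expR (96 * (C * Cp))).
  by rewrite !mulr_ge0 ?expR_ge0 ?addr_ge0.
move=> s x s01 Ox; have [s0 s1] := andP s01; have kx := k0 x Ox.
have sub t : 0 <= t <= s -> 0 <= t <= 1.
  by case/andP=> -> ts /=; exact: le_trans s1.
have : nrm (y s x) ^+ 2 <= 64 * (nrm (y 0 x) ^+ 2 + kappa x ^+ 2) *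
    expR (192 * (C * p s x - C * p 0 x)).
  apply: (@gronwall R (y^~ x) (fun t => A t x *m y t x + g t x)
    (fun t => C * p t x) (fun t => C * a t x) (kappa x) 0 s) => // t ts.
  - by apply: mder_sub (Hy t x (sub t ts) Ox) => z; exact: sub.
  - by apply: rder_sub (rderZ C (pa (sub t ts) Ox)) => z; exact: sub.
  have t01 := sub t ts; have at0 := a0 t01 Ox.
  split; first exact: mulr_ge0.
  apply: (le_trans (nrmD _ _)); apply: (le_trans (lerD (nrmM _ _) (hg t x t01 Ox))).
  have := ler_wpM2r (nrm_ge0 (y t x)) (hA t x t01 Ox).
  have h1 : 0 <= Cg * (a t x * nrm (y t x)) by rewrite !mulr_ge0 ?nrm_ge0.
  have h2 : 0 <= CA * (a t x * kappa x) by rewrite !mulr_ge0.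
  by rewrite /C; lra.
rewrite -mulrBr => h.
rewrite -ler_sqr ?nnegrE ?nrm_ge0 ?mulr_ge0 ?expR_ge0 ?addr_ge0 //.
apply: (le_trans h).
have e1 : expR (192 * (C * (p s x - p 0 x))) <= expR (96 * (C * Cp)) ^+ 2.
  rewrite expR_sqr ler_expR (_ : 2 * (96 * (C * Cp)) = 192 * (C * Cp)); last by ring.
  by rewrite ler_wpM2l // ler_wpM2l // pC.
have e2 : nrm (y 0 x) ^+ 2 + kappa x ^+ 2 <= (C0 + 1) ^+ 2 * kappa x ^+ 2.
  have h1 : nrm (y 0 x) ^+ 2 <= (C0 * kappa x) ^+ 2.
    by rewrite ler_sqr ?nnegrE ?nrm_ge0 ?mulr_ge0 // h0.
  have : 0 <= C0 * kappa x ^+ 2 by rewrite mulr_ge0 // sqr_ge0.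
  by move: h1; lra.
have e3 : 0 <= nrm (y 0 x) ^+ 2 + kappa x ^+ 2 by rewrite addr_ge0 ?sqr_ge0.
have e4 := ler_pM e3 (expR_ge0 _) e2 e1.
move: (expR (192 * _)) (expR (96 * _)) e4 => e E; lra.
Qed.


Let sol_lip (kappa : X -> R) (g y : R -> X -> M2) :
  lip O A -> lip O g -> bnd O (fun _ x => kappa x) y ->
  (forall s x, 0 <= s <= 1 -> O x ->
     mder I01 (y^~ x) s (A s x *m y s x + g s x)) ->
  lip O y.
Proof.
move=> lA lg [C C0 hC] Hy; apply: (ode_lip Hy) => x Ox.
have [B1 B10 h1] := lip_bounded lA Ox; have [B2 B20 h2] := lip_bounded lg Ox.
exists (B1 * (C * kappa x) + B2).
  rewrite addr_ge0 // mulr_ge0 //.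
  by apply: le_trans (nrm_ge0 _) (hC 0 x _ Ox); rewrite lexx ler01.
move=> s s01; apply: (le_trans (nrmD _ _)); apply: lerD; last exact: h2.
by apply: (le_trans (nrmM _ _)); apply: ler_pM; rewrite ?nrm_ge0 ?h1 // hC.
Qed.

(* The derivative in the parameter is the solution [v] of the variational
   equation given by variation of constants; two applications of Gronwall
   bound the second order Taylor remainder. *)
Let sol_dquad i (A' g g' y v : R -> X -> M2) :
  lip O A -> lip O A' -> lip O g -> lip O g' -> lip O y ->
  dquad mv O i A A' -> dquad mv O i g g' ->
  (forall s x, 0 <= s <= 1 -> O x ->
     mder I01 (y^~ x) s (A s x *m y s x + g s x)) ->
  (forall i h x, y 0 (mv i h x) = y 0 x) ->
  (forall s x, 0 <= s <= 1 -> O x ->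
     mder I01 (v^~ x) s (A s x *m v s x + (A' s x *m y s x + g' s x))) ->
  (forall x, O x -> v 0 x = 0) ->
  dquad mv O i y v.
Proof.
move=> lA lA' lg lg' ly dA dg Hy my Hv v0 x Ox.
have [MA MA0 hMA] := lip_bounded lA Ox; have [Y Y0 hY] := lip_bounded ly Ox.
have [KA [e1 [KA0 e10 h1]]] := dA x Ox; have [Kg [e2 [Kg0 e20 h2]]] := dg x Ox.
have [BA [e3 [BA0 e30 h3]]] := dquad_le dA lA' Ox.
have [Bg [e4 [Bg0 e40 h4]]] := dquad_le dg lg' Ox.
pose M := MA + BA + 1; have M0 : 0 <= M by rewrite !addr_ge0.
have M1 : 1 <= M by rewrite lerDr addr_ge0.
pose E := 8 * expR (96 * M); have E0 : 0 <= E by rewrite mulr_ge0 ?expR_ge0.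
pose Ky := BA * Y + Bg; have Ky0 : 0 <= Ky by rewrite addr_ge0 ?mulr_ge0.
pose Kv := BA * (E * Ky) + KA * Y + Kg.
have Kv0 : 0 <= Kv by rewrite !addr_ge0 ?mulr_ge0.
exists (E * Kv), (Num.min (Num.min (Num.min e1 e2) (Num.min e3 e4)) 1).
split; [exact: mulr_ge0|by rewrite !lt_min e10 e20 e30 e40 ltr01|].
move=> s d s01; rewrite !lt_min.
move=> /andP[/andP[/andP[d1 d2] /andP[d3 d4]] d5] Od.
have hMd t : 0 <= t <= 1 -> nrm (A t (mv i d x)) <= M.
  move=> t01; rewrite -(subrK (A t x) (A t (mv i d x))).
  apply: (le_trans (nrmD _ _)); have := h3 t d t01 d3 Od; have := hMA t t01.
  have : BA * `|d| <= BA by rewrite ler_piMr // ltW.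
  by rewrite /M; lra.
have hMx t : 0 <= t <= 1 -> nrm (A t x) <= M.
  by move=> t01; apply: (le_trans (hMA t t01)); rewrite /M; lra.
have dy t : 0 <= t <= 1 -> nrm (y t (mv i d x) - y t x) <= E * (Ky * `|d|).
  apply: (@gronwall_unit (fun t => y t (mv i d x) - y t x)
    (fun t => A t (mv i d x) *m (y t (mv i d x) - y t x) +
      ((A t (mv i d x) - A t x) *m y t x + (g t (mv i d x) - g t x)))) => //.
  - exact: mulr_ge0.
  - by rewrite my subrr.
  - move=> u u01; have := mderB (Hy u _ u01 Od) (Hy u x u01 Ox).
    congr mder; rewrite mulmxBr mulmxBl.
    by apply/matrixP => j k; rewrite !mxE; ring.
  move=> u u01; apply: (le_trans (nrmD _ _)); rewrite mulrDr; apply: lerD.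
    by apply: (le_trans (nrmM _ _)); rewrite ler_wpM2r ?nrm_ge0 // hMd.
  apply: (@le_trans _ _ (Ky * `|d|)); last first.
    by rewrite -{1}[_ * `|d|]mul1r ler_wpM2r // mulr_ge0.
  apply: (le_trans (nrmD _ _)); rewrite mulrDl; apply: lerD; last exact: h4.
  apply: (le_trans (nrmM _ _)); rewrite mulrAC.
  by apply: ler_pM; rewrite ?nrm_ge0 ?hY // h3.
rewrite -mulrA.
apply: (@gronwall_unit (fun t => y t (mv i d x) - y t x - d%:C *: v t x)
    (fun t => A t x *m (y t (mv i d x) - y t x - d%:C *: v t x) +
      ((A t (mv i d x) - A t x) *m (y t (mv i d x) - y t x) +
       (A t (mv i d x) - A t x - d%:C *: A' t x) *m y t x +
       (g t (mv i d x) - g t x - d%:C *: g' t x)))) => //.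
- by rewrite mulr_ge0 // sqr_ge0.
- by rewrite my v0 // scaler0 !subrr.
- move=> u u01.
  have := mderB (mderB (Hy u _ u01 Od) (Hy u x u01 Ox)) (mderZ d%:C (Hv u x u01 Ox)).
  congr mder; apply/matrixP => j k; rewrite !(mulmx2E, mxE); ring.
move=> u u01; apply: (le_trans (nrmD _ _)); rewrite mulrDr; apply: lerD.
  by apply: (le_trans (nrmM _ _)); rewrite ler_wpM2r ?nrm_ge0 // hMx.
apply: (@le_trans _ _ (Kv * d ^+ 2)); last first.
  by rewrite -{1}[_ * d ^+ 2]mul1r ler_wpM2r // mulr_ge0 // sqr_ge0.
apply: (le_trans (nrmD _ _)); rewrite mulrDl; apply: lerD; last exact: h2.
apply: (le_trans (nrmD _ _)); rewrite mulrDl; apply: lerD.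
  apply: (le_trans (nrmM _ _)).
  rewrite -(@real_normK _ d) ?num_real // expr2.
  rewrite (_ : _ * _ * (_ * _) = BA * `|d| * (E * (Ky * `|d|))); last by ring.
  by apply: ler_pM; rewrite ?nrm_ge0 ?dy // h3.
apply: (le_trans (nrmM _ _)); rewrite mulrAC.
by apply: ler_pM; rewrite ?nrm_ge0 ?hY // h1.
Qed.

(** The derivative v of y solves the same equation with source A' y + g', whose weight is a kappa r,
    and starts from 0. The induction hypothesis with kappa r in place of kappa therefore applies to
    v; each derivative costs one factor r. *)
Lemma symb_ode J (kappa : X -> R) (g y : R -> X -> M2) :
  (forall x, O x -> 0 <= kappa x) ->
  symb J rho a A -> symb J rho (fun s x => a s x * kappa x) g ->
  (forall s x, 0 <= s <= 1 -> O x ->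
     mder I01 (y^~ x) s (A s x *m y s x + g s x)) ->
  (forall i h x, y 0 (mv i h x) = y 0 x) ->
  (exists2 C, 0 <= C & forall x, O x -> nrm (y 0 x) <= C * kappa x) ->
  symb J rho (fun _ x => kappa x) y.
Proof.
elim: J kappa g y => [|J IH] kappa g y k0 HA Hg Hy my0 by0;
  have yb := ode_bnd k0 (symb_bnd HA) (symb_bnd Hg) Hy by0;
  have yl := sol_lip (symb_lip HA) (symb_lip Hg) yb Hy; split=> // i.
have [_ _ /(_ i)[A' dA HA']] := HA.
have [_ _ /(_ i)[g' dg Hg']] := Hg.
have Hyj := IH kappa g y k0 (symbS HA) (symbS Hg) Hy my0 by0.
pose F s x := A' s x *m y s x + g' s x.
have HF : symb J rho (fun s x => a s x * (kappa x * r x)) F.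
  apply: symbD; last by apply: symb_eqw Hg' => s x; rewrite /rho mulrA.
  by apply: symb_eqw (symbM HA' Hyj) => s x; rewrite /rho; ring.
have lF : lip O (fun s x => invmx (Phi s x) *m F s x).
  by apply: lipM (symb_lip HF); apply: lip_inv => //; exact: (Phi_lip HA).
(* Variation of constants: v = Phi W with W' = Phi^-1 F. W 0 = 0 holds outside [O] too, since the
   induction hypothesis wants the initial value of v unchanged by moves from arbitrary points. *)
have /choice[W HW] x : exists W : R -> M2, W 0 = 0 /\
    forall s, 0 <= s <= 1 -> O x -> mder I01 W s (invmx (Phi s x) *m F s x).
  have [Ox|] := pselect (O x); last by exists (fun=> 0).
  have [L L0 hL] := lF x Ox.
  by have [W hW] := @mder_integral R (fun s => invmx (Phi s x) *m F s x) L hL; exists W; case: hW => ? h; split=> // s *; exact: h.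
pose v s x := Phi s x *m W x s.
have v0 x : v 0 x = 0.
  by rewrite /v; have [-> _] := HW x; rewrite mulmx0.
have Hv s x : 0 <= s <= 1 -> O x -> mder I01 (v^~ x) s (A s x *m v s x + F s x).
  move=> s01 Ox; have [_ /(_ s s01 Ox) hW] := HW x.
  have := mderM (PhiA s01 Ox) hW; congr mder.
  by rewrite /v mulmxA mulKVmx // Phiu.
exists v.
  apply: (sol_dquad (symb_lip HA) (symb_lip HA') (symb_lip Hg) (symb_lip Hg')) => //.
apply: (IH (fun x => kappa x * r x) F v) => //.
- by move=> x Ox; rewrite mulr_ge0 ?k0 ?r0.
- exact: symbS.
- by move=> j h x; rewrite !v0.
- by exists 0 => // x _; rewrite v0 nrm0 mul0r.
Qed.

End SymbOde.

(** * Symbols of the diagonalisation scheme *)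

Section TimeSymbols.
Variable R : realType.
Implicit Types (c f : R -> R) (L m j : nat) (t : R).

(* [c] has [L] derivatives on [0, oo[, the [i]-th being O((1 + t)^-(m + i)). *)
Fixpoint tcl L m c : Prop :=
  (exists2 C, 0 <= C & forall t, 0 <= t -> `|c t| <= C * (1 + t)^-1 ^+ m) /\
  if L is L'.+1 then exists2 c', (forall t, 0 <= t -> rder `[0, +oo[ c t (c' t)) &
    tcl L' m.+1 c'
  else True.

Lemma tcl_bnd L m c : tcl L m c ->
  exists2 C, 0 <= C & forall t, 0 <= t -> `|c t| <= C * (1 + t)^-1 ^+ m.
Proof. by case: L => [|L] []. Qed.

Lemma tclS L m c : tcl L.+1 m c -> tcl L m c.
Proof.
elim: L m c => [|L IH] m c [h1 [c' h2 h3]]; split=> //.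
by exists c' => //; exact: IH.
Qed.

Lemma tcl_le L K m c : (L <= K)%N -> tcl K m c -> tcl L m c.
Proof.
move=> /subnK <-; elim: (K - L)%N => [|k IH /tclS]; [by rewrite add0n|exact: IH].
Qed.

Lemma tclD L m c c' : tcl L m c -> tcl L m c' -> tcl L m (fun t => c t + c' t).
Proof.
have B k d d' :
    (exists2 C, 0 <= C & forall t, 0 <= t -> `|d t| <= C * (1 + t)^-1 ^+ k) ->
    (exists2 C, 0 <= C & forall t, 0 <= t -> `|d' t| <= C * (1 + t)^-1 ^+ k) ->
    exists2 C, 0 <= C & forall t, 0 <= t -> `|d t + d' t| <= C * (1 + t)^-1 ^+ k.
  move=> [C C0 h] [C' C0' h']; exists (C + C'); first exact: addr_ge0.
  move=> t t0; apply: (le_trans (ler_normD _ _)); rewrite mulrDl.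
  by apply: lerD; [exact: h|exact: h'].
elim: L m c c' => [|L IH] m c c' [h1 h2] [k1 k2]; split=> //; try exact: B.
have [d h3 h4] := h2; have [d' k3 k4] := k2; exists (fun t => d t + d' t).
  by move=> t t0; apply: rderD; [exact: h3|exact: k3].
exact: IH.
Qed.

Lemma tclM L m m' c c' : tcl L m c -> tcl L m' c' ->
  tcl L (m + m') (fun t => c t * c' t).
Proof.
have B k k' d d' :
    (exists2 C, 0 <= C & forall t, 0 <= t -> `|d t| <= C * (1 + t)^-1 ^+ k) ->
    (exists2 C, 0 <= C & forall t, 0 <= t -> `|d' t| <= C * (1 + t)^-1 ^+ k') ->
    exists2 C, 0 <= C & forall t, 0 <= t -> `|d t * d' t| <= C * (1 + t)^-1 ^+ (k + k').
  move=> [C C0 h] [C' C0' h']; exists (C * C'); first exact: mulr_ge0.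
  move=> t t0; rewrite normrM exprD mulrACA.
  by apply: ler_pM; rewrite // ?h ?h'.
elim: L m m' c c' => [|L IH] m m' c c' H K; move: (H) (K);
  move=> [h1 h2] [k1 k2]; split=> //; try exact: B.
have [d h3 h4] := h2; have [d' k3 k4] := k2.
exists (fun t => d t * c' t + c t * d' t).
  by move=> t t0; apply: rderM; [exact: h3|exact: k3].
apply: tclD; first by rewrite -addSn; apply: IH => //; exact: tclS.
by rewrite -addnS; apply: IH => //; exact: tclS.
Qed.

Lemma class_C_tcl l a f : class_C `[0, +oo[ l f ->
  (forall j, (j <= l)%N -> exists C : R, forall t : R, 0 <= t ->
     `|derive_in_n `[0, +oo[ j f t| <= C * (1 + t) ^- (j + a)) ->
  tcl l a f.
Proof.
move=> [hd _] hb.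
have B j : (j <= l)%N -> exists2 C, 0 <= C & forall t, 0 <= t ->
    `|derive_in_n `[0, +oo[ j f t| <= C * (1 + t)^-1 ^+ (j + a).
  move=> jl; have [C hC] := hb j jl.
  have C0 : 0 <= C.
    have := hC 0 (lexx _); rewrite addr0 expr1n invr1 mulr1; exact: le_trans.
  by exists C => // t t0; rewrite exprVn; exact: hC.
suff H : forall L j, (j + L <= l)%N -> tcl L (j + a) (derive_in_n `[0, +oo[ j f).
  by have := H l 0%N; rewrite add0n => /(_ (leqnn _)).
elim=> [|L IH] j jl; split.
- by apply: B; rewrite addn0 in jl.
- by [].
- by apply: B; rewrite (leq_trans _ jl) // leq_addr.
exists (derive_in_n `[0, +oo[ j.+1 f); last first.
  by rewrite -addSn; apply: IH; rewrite addSnnS.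
move=> t t0; apply: derivable_rder; apply: hd.
  by rewrite (leq_trans _ jl) // addnS ltnS leq_addr.
by rewrite /= in_itv /= t0.
Qed.

End TimeSymbols.

(** * Sums of negative powers of |xi| with time symbols as coefficients *)

Section GradedSymbols.
Variables (R : realType) (n : nat).
Local Notation M2 := 'M[R[i]]_2.
Implicit Types (F G : R -> 'rV[R]_n -> M2) (p m L q : nat) (D : M2) (t : R)
  (xi : 'rV[R]_n).

(* All the matrices of the diagonalisation scheme are polynomials in |xi|^-1
   whose coefficients are time symbols.  In the hyperbolic zone the terms with
   [q >= p] are O(|xi|^-p (1 + t)^-(p + m)). *)
Inductive gsum p m L : (R -> 'rV[R]_n -> M2) -> Prop :=
| gsum0 : gsum p m L (fun _ _ => 0)
| gsumD F G : gsum p m L F -> gsum p m L G -> gsum p m L (fun t xi => F t xi + G t xi)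
| gsum_mono q c D : (p <= q)%N -> tcl L (q + m) c ->
    gsum p m L (fun t xi => (c t * (enorm xi)^-1 ^+ q)%:C *: D).

Definition gsym p m L F : Prop := exists2 G, gsum p m L G &
  forall t xi, 0 <= t -> 0 < enorm xi -> F t xi = G t xi.

Lemma gsym_ext p m L F G :
  (forall t xi, 0 <= t -> 0 < enorm xi -> F t xi = G t xi) ->
  gsym p m L F -> gsym p m L G.
Proof. by move=> FG [H h e]; exists H => // t xi t0 xi0; rewrite -FG // e. Qed.

Lemma gsymD p m L F G : gsym p m L F -> gsym p m L G ->
  gsym p m L (fun t xi => F t xi + G t xi).
Proof.
move=> [H h e] [K k f]; exists (fun t xi => H t xi + K t xi); first exact: gsumD.
by move=> t xi t0 xi0; rewrite e // f.
Qed.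

Lemma gsym_lin p m L F (T : M2 -> M2) : (forall D D', T (D + D') = T D + T D') ->
  (forall z D, T (z *: D) = z *: T D) -> gsym p m L F ->
  gsym p m L (fun t xi => T (F t xi)).
Proof.
move=> TD TZ [G h e].
apply: (@gsym_ext _ _ _ (fun t xi => T (G t xi))).
  by move=> t xi t0 xi0; rewrite e.
elim: h => {F G e} [|F G _ IH1 _ IH2|q c D pq hc].
- exists (fun _ _ => 0); first exact: gsum0.
  by move=> t xi _ _; have := TZ 0 0; rewrite !scale0r.
- by apply: gsym_ext (gsymD IH1 IH2) => t xi _ _; rewrite TD.
- exists (fun t xi => (c t * (enorm xi)^-1 ^+ q)%:C *: T D); first exact: gsum_mono.
  by move=> t xi _ _; rewrite TZ.
Qed.

Lemma gsymZ p m L F (z : R[i]) : gsym p m L F -> gsym p m L (fun t xi => z *: F t xi).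
Proof.
apply: (gsym_lin (T := fun D => z *: D)) => [D D'|w D]; first exact: scalerDr.
by rewrite !scalerA mulrC.
Qed.

Lemma gsymN p m L F : gsym p m L F -> gsym p m L (fun t xi => - F t xi).
Proof.
by move/(gsymZ (-1)); apply: gsym_ext => t xi _ _; rewrite scaleN1r.
Qed.

Lemma gsym_le p p' m L L' F : (p' <= p)%N -> (L' <= L)%N ->
  gsym p m L F -> gsym p' m L' F.
Proof.
move=> pp LL [G h e]; exists G => //; elim: h => [|G1 G2 _ h1 _ h2|q c D pq hc].
- exact: gsum0.
- exact: gsumD.
- by apply: gsum_mono; [exact: leq_trans pq|exact: tcl_le hc].
Qed.

Lemma gsymM p1 p2 m1 m2 L F G : gsym p1 m1 L F -> gsym p2 m2 L G ->
  gsym (p1 + p2) (m1 + m2) L (fun t xi => F t xi *m G t xi).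
Proof.
move=> [F' h e] [G' h' e'].
apply: (@gsym_ext _ _ _ (fun t xi => F' t xi *m G' t xi)).
  by move=> t xi t0 xi0; rewrite e // e'.
elim: h => {F F' e} [|F1 F2 _ h1 _ h2|q c D pq hc].
- exists (fun _ _ => 0); first exact: gsum0.
  by move=> *; rewrite mul0mx.
- by apply: gsym_ext (gsymD h1 h2) => t xi _ _; rewrite mulmxDl.
elim: h' => {G G' e'} [|G1 G2 _ h1 _ h2|q' c' D' pq' hc'].
- exists (fun _ _ => 0); first exact: gsum0.
  by move=> *; rewrite mulmx0.
- by apply: gsym_ext (gsymD h1 h2) => t xi _ _; rewrite mulmxDr.
exists (fun t xi => ((c t * c' t) * (enorm xi)^-1 ^+ (q + q'))%:C *: (D *m D')).
  apply: gsum_mono; first exact: leq_add.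
  by rewrite addnACA; exact: tclM.
move=> t xi _ _; rewrite -scalemxAl -scalemxAr scalerA -rmorphM /= exprD.
by congr (_%:C *: _); ring.
Qed.

Lemma gsym_der p m L F : gsym p m L.+1 F -> exists2 F',
  forall t xi, 0 <= t -> 0 < enorm xi -> mder `[0, +oo[ (F^~ xi) t (F' t xi) &
  gsym p m.+1 L F'.
Proof.
move=> [G h e].
suff [F' h1 h2] : exists2 F',
    forall t xi, 0 <= t -> 0 < enorm xi -> mder `[0, +oo[ (G^~ xi) t (F' t xi) &
    gsym p m.+1 L F'.
  exists F' => // t xi t0 xi0; apply: mder_ext (h1 t xi t0 xi0).
    by move=> x; rewrite /= in_itv /= andbT => x0; rewrite e.
  by rewrite /= in_itv /= t0.
elim: h => {F G e} [|F G _ [F' h1 h2] _ [G' h3 h4]|q c D pq [_ [c' h1 h2]]].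
- exists (fun _ _ => 0); first by move=> *; exact: mder_cst.
  by exists (fun _ _ => 0) => //; exact: gsum0.
- exists (fun t xi => F' t xi + G' t xi); last exact: gsymD.
  by move=> t xi t0 xi0; apply: mderD; [exact: h1|exact: h3].
- exists (fun t xi => (c' t * (enorm xi)^-1 ^+ q)%:C *: D); last first.
    exists (fun t xi => (c' t * (enorm xi)^-1 ^+ q)%:C *: D) => //.
    by apply: gsum_mono => //; rewrite addnS.
  move=> t xi t0 _; apply: mder_real.
  have := rderM (h1 t t0) (rder_cst _ ((enorm xi)^-1 ^+ q) t).
  by rewrite mulr0 addr0.
Qed.

(** m counts the time decay in excess of the power of |xi|^-1. Division by |xi| raises this power
    and leaves the coefficients alone, so the excess drops by one while no time derivative is
    lost. *)
Lemma gsymV p m L F : gsym p m.+1 L F ->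
  gsym p.+1 m L (fun t xi => ((enorm xi)^-1)%:C *: F t xi).
Proof.
move=> [G h e].
apply: (@gsym_ext _ _ _ (fun t xi => ((enorm xi)^-1)%:C *: G t xi)).
  by move=> t xi t0 xi0; rewrite e.
elim: h => {F G e} [|F G _ h1 _ h2|q c D pq hc].
- by exists (fun _ _ => 0) => [|*]; [exact: gsum0|rewrite scaler0].
- by apply: gsym_ext (gsymD h1 h2) => t xi _ _; rewrite scalerDr.
exists (fun t xi => (c t * (enorm xi)^-1 ^+ q.+1)%:C *: D).
  by apply: gsum_mono => //; rewrite addSnnS.
by move=> t xi _ _; rewrite scalerA -rmorphM /= exprS; congr (_%:C *: _); ring.
Qed.

(** Each of the q - p surplus factors ((1 + t) e)^-1 is at most 1/N. This makes the terms with
    higher powers of |xi|^-1 harmless. *)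
Lemma zhyp_pow (N t e : R) p q m : 0 < N -> 0 <= t -> 0 < e -> N <= (1 + t) * e ->
  (p <= q)%N ->
  (1 + t)^-1 ^+ (q + m) * e^-1 ^+ q <=
  N^-1 ^+ (q - p) * (e^-1 ^+ p * (1 + t)^-1 ^+ (p + m)).
Proof.
move=> N0 t0 e0 Nt /subnK => pq; set d := (q - p)%N in pq *.
rewrite -pq -addnA !exprD.
rewrite (_ : _ * _ = ((1 + t)^-1 ^+ d * e^-1 ^+ d) * (e^-1 ^+ p * ((1 + t)^-1 ^+ p * (1 + t)^-1 ^+ m))); last by ring.
have t1 : 0 < 1 + t by rewrite ltr_pwDl.
have e1 := mulr_gt0 t1 e0.
rewrite ler_wpM2r //; first by rewrite !mulr_ge0 // exprn_ge0 // invr_ge0 ltW.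
rewrite -exprMn -invfM; apply: lerXn2r; rewrite ?nnegrE ?invr_ge0 ?(ltW N0) ?(ltW e1) //.
by rewrite lef_pV2 ?posrE.
Qed.

Lemma gsym_bound N p m L F : 0 < N -> gsym p m L F -> exists2 C, 0 <= C &
  forall t xi, 0 <= t -> 0 < enorm xi -> N <= (1 + t) * enorm xi ->
    nrm (F t xi) <= C * ((enorm xi)^-1 ^+ p * (1 + t)^-1 ^+ (p + m)).
Proof.
move=> N0 [G h e].
suff [C C0 hC] : exists2 C, 0 <= C &
  forall t xi, 0 <= t -> 0 < enorm xi -> N <= (1 + t) * enorm xi ->
    nrm (G t xi) <= C * ((enorm xi)^-1 ^+ p * (1 + t)^-1 ^+ (p + m)).
  by exists C => // t xi *; rewrite e // hC.
elim: h => {F G e} [|F G _ [C1 C10 h1] _ [C2 C20 h2]|q c D pq hc].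
- by exists 0 => // *; rewrite nrm0 mul0r.
- exists (C1 + C2); first exact: addr_ge0.
  move=> t xi t0 xi0 Nt; apply: (le_trans (nrmD _ _)); rewrite mulrDl.
  by apply: lerD; [exact: h1|exact: h2].
have [C C0 hC] := tcl_bnd hc.
exists (C * nrm D * N^-1 ^+ (q - p)).
  by rewrite !mulr_ge0 ?nrm_ge0 // exprn_ge0 // invr_ge0 ltW.
move=> t xi t0 xi0 Nt; rewrite nrmR normrM.
have k : 0 <= (enorm xi)^-1 ^+ q by rewrite exprn_ge0 // invr_ge0 ltW.
rewrite (ger0_norm k) -mulrA.
apply: (@le_trans _ _ (C * nrm D * ((1 + t)^-1 ^+ (q + m) * (enorm xi)^-1 ^+ q))).
  have := ler_wpM2r (mulr_ge0 (nrm_ge0 D) k) (hC t t0); lra.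
by rewrite -!mulrA ler_wpM2l // ler_wpM2l ?nrm_ge0 // !mulrA -[leRHS]mulrA; exact: zhyp_pow.
Qed.

End GradedSymbols.

(** * The matrices of the diagonalisation scheme *)

Section DiagonalisationSymbols.
Variables (R : realType) (n l : nat) (b m : R -> R).
Hypotheses (hb : tcl l 1 b) (hm : tcl l 2 m).
Local Notation M2 := 'M[R[i]]_2.
Implicit Types (xi : 'rV[R]_n) (t : R) (j : nat).
Local Notation gsym := (@gsym R n).
Local Notation NN := (@Nmx R n b m).
Local Notation FF := (@Fpred R n b m).
Local Notation BB := (@Bk R n b m).

Lemma Nmx1 : NN 1 = fun t xi => 1%:M + N1mx b t xi.
Proof. by []. Qed.

Lemma Fpred1 : FF 1 = fun t xi => 0 + F0mx b t.
Proof. by []. Qed.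

Lemma NmxSS j : NN j.+2 = fun t xi => NN j.+1 t xi + offdiag_step (BB j.+1 t xi) xi.
Proof.
rewrite /Bk /Nmx /Fpred.
have -> : NF n b m j.+2 = let: (N', F') := NF n b m j.+1 in
  ((fun t xi => N' t xi + offdiag_step (remainder b m N' F' t xi) xi),
   (fun t xi => F' t xi - diag_part (remainder b m N' F' t xi))) by [].
by case: (NF n b m j.+1).
Qed.

Lemma FpredSS j : FF j.+2 = fun t xi => FF j.+1 t xi - diag_part (BB j.+1 t xi).
Proof.
rewrite /Bk /Nmx /Fpred.
have -> : NF n b m j.+2 = let: (N', F') := NF n b m j.+1 in
  ((fun t xi => N' t xi + offdiag_step (remainder b m N' F' t xi) xi),
   (fun t xi => F' t xi - diag_part (remainder b m N' F' t xi))) by [].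
by case: (NF n b m j.+1).
Qed.

Lemma BkE k t xi : BB k t xi = Dt `[0, +oo[ (fun tau => NN k tau xi) t -
  (Dmx xi + Bmx b t + Cmx m t xi) *m NN k t xi + NN k t xi *m (Dmx xi + FF k t xi).
Proof. by []. Qed.

Lemma diag_partD (D D' : M2) : diag_part (D + D') = diag_part D + diag_part D'.
Proof. by apply: mx2P; rewrite !mxE //= ?addr0. Qed.

Lemma diag_partZ (z : R[i]) (D : M2) : diag_part (z *: D) = z *: diag_part D.
Proof. by apply: mx2P; rewrite !mxE //= ?mulr0. Qed.

Lemma diag_part_idem (D : M2) : diag_part (diag_part D) = diag_part D.
Proof. by apply: mx2P; rewrite !mxE. Qed.

Lemma diag_partN (D : M2) : diag_part (- D) = - diag_part D.
Proof. by rewrite -scaleN1r diag_partZ scaleN1r. Qed.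

Lemma F0mxE t : F0mx b t = ('i * (b t)%:C / 2)%:M.
Proof. by apply: mx2P; rewrite !mxE /= ?mulr1. Qed.

Lemma gsym_Bmx : gsym 0 1 l (fun t _ => Bmx b t).
Proof.
exists (fun t xi => (b t * (enorm xi)^-1 ^+ 0)%:C *: (('i / 2) *: mx22 1 1 1 1)).
  exact: gsum_mono.
by move=> t xi _ _; rewrite scalerA expr0 mulr1 /Bmx mulrCA mulrA.
Qed.

Lemma gsym_Cmx : gsym 1 1 l (Cmx m).
Proof.
exists (fun t xi => (m t * (enorm xi)^-1 ^+ 1)%:C *: ((1 / 2) *: mx22 1 (-1) 1 (-1))).
  exact: gsum_mono.
move=> t xi _ _; rewrite scalerA expr1 rmorphM /= fmorphV /Cmx; congr (_ *: _).
by rewrite invfM div1r; ring.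
Qed.

Lemma gsym_F0mx : gsym 0 1 l (fun t _ => F0mx b t).
Proof. exact: (gsym_lin diag_partD diag_partZ gsym_Bmx). Qed.

Lemma gsym_N1mx : gsym 1 0 l (N1mx b).
Proof.
exists (fun t xi => (b t * (enorm xi)^-1 ^+ 1)%:C *: (('i / 4) *: mx22 0 (-1) 1 0)).
  exact: gsum_mono.
move=> t xi _ _; rewrite scalerA expr1 rmorphM /= fmorphV /N1mx; congr (_ *: _).
by rewrite invfM; ring.
Qed.

(** Commuting with [Dmx] multiplies the off-diagonal entries by 2|xi| and -2|xi|, which explains the
    denominator and the signs in [offdiag_step]: the new correction removes the off-diagonal part of
    the remainder. *)
Lemma commutator_offdiag (D : M2) xi : 0 < enorm xi ->
  Dmx xi *m offdiag_step D xi - offdiag_step D xi *m Dmx xi = D - diag_part D.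
Proof.
move=> xi0; have e0 : (enorm xi)%:C != 0 :> R[i].
  by rewrite fmorph_eq0 gt_eqF.
by apply: mx2P; rewrite !(mulmx2E, mxE) /=; field.
Qed.

Lemma commutator_N1 t xi : 0 < enorm xi ->
  Dmx xi *m N1mx b t xi - N1mx b t xi *m Dmx xi = F0mx b t - Bmx b t.
Proof.
move=> xi0; have e0 : (enorm xi)%:C != 0 :> R[i].
  by rewrite fmorph_eq0 gt_eqF.
by apply: mx2P; rewrite !(mulmx2E, mxE) /=; field.
Qed.

Lemma Dt_ray (y : R -> M2) t D : 0 <= t -> mder `[0, +oo[ y t D ->
  Dt `[0, +oo[ y t = - 'i *: D.
Proof. by move=> t0 /(mder_Dt (accum_ray t0))[]. Qed.

Lemma gsym_offdiag p q k (F : R -> 'rV[R]_n -> M2) : gsym p q.+1 k F ->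
  gsym p.+1 q k (fun t xi => offdiag_step (F t xi) xi).
Proof.
move=> H; pose T (D : M2) := 2^-1 *: mx22 0 (D ord0 ord_max) (- D ord_max ord0) 0.
apply: (@gsym_ext _ _ _ _ _ (fun t xi => ((enorm xi)^-1)%:C *: T (F t xi))).
  move=> t xi _ _; rewrite /T /offdiag_step scalerA; congr (_ *: _).
  by rewrite fmorphV invfM mulrC.
apply: gsymV; apply: gsym_lin H => [D D'|z D]; rewrite /T.
  by rewrite -scalerDr; congr (_ *: _); apply: mx2P; rewrite !mxE /= ?addr0 // opprD.
by rewrite scalerA mulrC -scalerA; congr (_ *: _); apply: mx2P;
  rewrite !mxE /= ?mulr0 // mulrN.
Qed.

Lemma gsym_BC : gsym 0 1 l (fun t xi => Bmx b t + Cmx m t xi).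
Proof. by apply: gsymD; [exact: gsym_Bmx|exact: gsym_le gsym_Cmx]. Qed.

(** e counts the time derivatives left in the remainder, one being used up by D_t in each step. The
    commutator and the new diagonal term together cancel the old remainder; every surviving term has
    one more factor |xi|^-1 (1 + t)^-1. *)
Lemma NF_struct j e : (j.+1 + e = l)%N ->
  [/\ gsym 1 0 e.+1 (fun t xi => NN j.+1 t xi - 1%:M),
      gsym 1 1 e.+1 (fun t xi => FF j.+1 t xi - F0mx b t),
      (forall t xi, diag_part (FF j.+1 t xi) = FF j.+1 t xi) &
      gsym j.+1 1 e (BB j.+1)].
Proof.
elim: j e => [|j IH] e el.
  have l1 : l = e.+1 by rewrite -el add1n.
  split.
  - by rewrite -l1; apply: gsym_ext gsym_N1mx => t xi _ _; rewrite Nmx1 addrC addKr.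
  - exists (fun _ _ => 0); first exact: gsum0.
    by move=> t xi _ _; rewrite Fpred1 add0r subrr.
  - by move=> t xi; rewrite Fpred1 add0r /F0mx diag_part_idem.
  have [N1' h1 h2] : exists2 N1', forall t xi, 0 <= t -> 0 < enorm xi ->
      mder `[0, +oo[ ((N1mx b)^~ xi) t (N1' t xi) & gsym 1 1 e N1'.
    by apply: gsym_der; rewrite -l1; exact: gsym_N1mx.
  have el' : (e <= l)%N by rewrite l1.
  apply: (@gsym_ext _ _ _ _ _ (fun t xi => (- 'i *: N1' t xi - Cmx m t xi)
     + (N1mx b t xi *m F0mx b t - (Bmx b t + Cmx m t xi) *m N1mx b t xi))).
    move=> t xi t0 xi0; rewrite /Bk /remainder Nmx1 Fpred1.
    have h3 := mderD (mder_cst `[0, +oo[ 1%:M t) (h1 t xi t0 xi0).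
    rewrite (Dt_ray t0 h3) !add0r.
    have := commutator_N1 t xi0.
    move: (N1mx b t xi) (F0mx b t) (Bmx b t) (Cmx m t xi) (Dmx xi) (N1' t xi).
    move=> N F B C D N' /eqP; rewrite subr_eq => /eqP DN.
    rewrite !(mulmxDl, mulmxDr, mulmx1, mul1mx) DN.
    by apply/matrixP => p q; rewrite !mxE; ring.
  apply: gsymD; apply: gsymD.
  - exact: gsymZ.
  - by apply: gsymN; exact: gsym_le gsym_Cmx.
  - by apply: (gsym_le (leqnn _) el' (gsymM gsym_N1mx gsym_F0mx)).
  - apply: gsymN.
    by apply: (gsym_le (leqnn _) el' (gsymM gsym_BC gsym_N1mx)).
have [hN hF dF hB] : [/\ gsym 1 0 e.+2 (fun t xi => NN j.+1 t xi - 1%:M),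
      gsym 1 1 e.+2 (fun t xi => FF j.+1 t xi - F0mx b t),
      (forall t xi, diag_part (FF j.+1 t xi) = FF j.+1 t xi) &
      gsym j.+1 1 e.+1 (BB j.+1)].
  by apply: IH; rewrite -el addnS.
have el1 : (e.+1 <= l)%N by rewrite -el addSn ltnS leq_addl.
have hX : gsym j.+2 0 e.+1 (fun t xi => offdiag_step (BB j.+1 t xi) xi).
  exact: gsym_offdiag.
have hd : gsym j.+1 1 e.+1 (fun t xi => diag_part (BB j.+1 t xi)).
  exact: gsym_lin diag_partD diag_partZ hB.
have hF' : gsym 1 1 e.+1 (fun t xi => FF j.+2 t xi - F0mx b t).
  rewrite FpredSS.
  apply: (@gsym_ext _ _ _ _ _ (fun t xi => (FF j.+1 t xi - F0mx b t) -
    diag_part (BB j.+1 t xi))); first by move=> *; rewrite addrAC.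
  by apply: gsymD; [exact: gsym_le hF|apply: gsymN; exact: gsym_le hd].
split => //.
- rewrite NmxSS.
  apply: (@gsym_ext _ _ _ _ _ (fun t xi => (NN j.+1 t xi - 1%:M) +
    offdiag_step (BB j.+1 t xi) xi)); first by move=> *; rewrite addrAC.
  by apply: gsymD; [exact: gsym_le hN|exact: gsym_le hX].
- by move=> t xi; rewrite FpredSS diag_partD diag_partN diag_part_idem dF.
have [X' h1 h2] := gsym_der hX.
have [N' h3 h4] := gsym_der hN.
(* What survives, with X the new correction: D_t X - (N_(j+1) - I) diag B^(j+1) + X F - (B + C) X,
   where F is the updated diagonal sum. *)
apply: (@gsym_ext _ _ _ _ _ (fun t xi =>
   (- 'i *: X' t xi - (NN j.+1 t xi - 1%:M) *m diag_part (BB j.+1 t xi))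
   + (offdiag_step (BB j.+1 t xi) xi *m (F0mx b t + (FF j.+2 t xi - F0mx b t))
      - (Bmx b t + Cmx m t xi) *m offdiag_step (BB j.+1 t xi) xi))).
  move=> t xi t0 xi0.
  have h5 := mderD (h3 t xi t0 xi0) (mder_cst `[0, +oo[ 1%:M t).
  have h6 := mderD h5 (h1 t xi t0 xi0).
  have e1 : BB j.+1 t xi = - 'i *: N' t xi -
      (Dmx xi + Bmx b t + Cmx m t xi) *m NN j.+1 t xi +
      NN j.+1 t xi *m (Dmx xi + FF j.+1 t xi).
    rewrite BkE.
    have -> : (fun tau => NN j.+1 tau xi) = fun tau => NN j.+1 tau xi - 1%:M + 1%:M.
      by apply/funext => tau; rewrite subrK.
    by rewrite (Dt_ray t0 h5) addr0.
  have DX := commutator_offdiag (BB j.+1 t xi) xi0.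
  have -> : BB j.+2 t xi = - 'i *: (N' t xi + X' t xi) -
      (Dmx xi + Bmx b t + Cmx m t xi) *m (NN j.+1 t xi + offdiag_step (BB j.+1 t xi) xi) +
      (NN j.+1 t xi + offdiag_step (BB j.+1 t xi) xi) *m (Dmx xi + FF j.+2 t xi).
    have NE tau : NN j.+2 tau xi = NN j.+1 tau xi + offdiag_step (BB j.+1 tau xi) xi.
      by rewrite NmxSS.
    rewrite BkE NE.
    have -> : (fun tau => NN j.+2 tau xi) =
        fun tau => NN j.+1 tau xi - 1%:M + 1%:M + offdiag_step (BB j.+1 tau xi) xi.
      by apply/funext => tau; rewrite NE subrK.
    by rewrite (Dt_ray t0 h6) addr0.
  rewrite (addrCA (F0mx b t)) subrr addr0.
  have -> : FF j.+2 t xi = FF j.+1 t xi - diag_part (BB j.+1 t xi) by rewrite FpredSS.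
  move: DX e1; set X := offdiag_step _ _; set dB := diag_part _.
  move: X dB (NN _ _ _) (FF _ _ _) (BB _ _ _) (F0mx b t) (Bmx b t) (Cmx m t xi)
    (Dmx xi) (N' t xi) (X' t xi).
  move=> X dB N F Bj F0 B C D P Q /eqP; rewrite subr_eq => /eqP DX e1.
  rewrite !(mulmxDl, mulmxDr, mulmxN, mulNmx, mul1mx) DX e1.
  rewrite !(mulmxDl, mulmxDr).
  by apply/matrixP => p q; rewrite !mxE; ring.
have el2 : (e <= l)%N by exact: ltnW.
apply: gsymD; apply: gsymD.
- exact: gsymZ.
- apply: gsymN.
  by have := gsymM (gsym_le (leqnn 1) (ltnW (ltnSn _)) hN) hd; apply: gsym_le.
- have hFF : gsym 0 1 e.+1 (fun t xi => F0mx b t + (FF j.+2 t xi - F0mx b t)).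
    by apply: gsymD; [exact: gsym_le gsym_F0mx|exact: gsym_le hF'].
  by have := gsymM hX hFF; apply: gsym_le; rewrite ?addn0.
- apply: gsymN.
  by have := gsymM (gsym_le (leqnn 0) el1 gsym_BC) hX; apply: gsym_le.
Qed.

End DiagonalisationSymbols.

(** * Symbols along the interpolated time *)

Section EuclideanNorm.
Variables (R : realType) (n : nat).
Implicit Types (xi : 'rV[R]_n) (i : 'I_n) (h : R).

Lemma enorm_ge0 xi : 0 <= enorm xi.
Proof. exact: sqrtr_ge0. Qed.

Lemma enorm_sqr xi : enorm xi ^+ 2 = \sum_i xi ord0 i ^+ 2.
Proof. by rewrite sqr_sqrtr // sumr_ge0 // => i _; exact: sqr_ge0. Qed.

Lemma enorm_gt0 xi : xi != 0 -> 0 < enorm xi.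
Proof.
move=> xi0; rewrite lt_neqAle enorm_ge0 andbT eq_sym; apply: contra_neq xi0 => e0.
have := enorm_sqr xi; rewrite e0 expr0n /= => /esym/eqP.
rewrite psumr_eq0 => [/allP H|i _]; last exact: sqr_ge0.
apply/rowP => i; rewrite mxE; apply/eqP.
by have := H i; rewrite mem_index_enum sqrf_eq0 => /(_ isT).
Qed.

Lemma entry_le_enorm xi i : `|xi ord0 i| <= enorm xi.
Proof.
rewrite -ler_sqr ?nnegrE ?enorm_ge0 // real_normK ?num_real // enorm_sqr.
by rewrite (bigD1 i) //= lerDl sumr_ge0 // => j _; exact: sqr_ge0.
Qed.

Lemma line_entry xi i h j : line xi i h ord0 j = xi ord0 j + h * (j == i)%:R.
Proof. by rewrite !mxE eqxx. Qed.

Lemma enorm_line xi i h :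
  enorm (line xi i h) ^+ 2 = enorm xi ^+ 2 + 2 * h * xi ord0 i + h ^+ 2.
Proof.
rewrite !enorm_sqr (bigD1 i) //= [in RHS](bigD1 i) //= line_entry eqxx mulr1.
rewrite (eq_bigr (fun j => xi ord0 j ^+ 2)) => [|j ji]; first by ring.
by rewrite line_entry (negPf ji) mulr0 addr0.
Qed.

Lemma enorm_line_dist xi i h : `|enorm (line xi i h) - enorm xi| <= `|h|.
Proof.
have e0 := enorm_ge0 xi; have e1 := enorm_ge0 (line xi i h).
have H := enorm_line xi i h; have xe := entry_le_enorm xi i.
have h2 : `|h| ^+ 2 = h ^+ 2 by rewrite real_normK ?num_real.
have hx : `|h * xi ord0 i| <= `|h| * enorm xi by rewrite normrM ler_wpM2l.
move: hx; rewrite ler_norml => /andP[k1 k2]; have h0 := normr_ge0 h.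
rewrite ler_norml lerBlDr lerBrDr; apply/andP; split; last first.
  rewrite -ler_sqr ?nnegrE ?addr_ge0 // H sqrrD h2; lra.
have [k|k] := leP (- `|h| + enorm xi) 0; first exact: le_trans k e1.
by rewrite -ler_sqr ?nnegrE ?(ltW k) // H sqrrD sqrrN h2; lra.
Qed.

Lemma enorm_line_quad xi i h : 0 < enorm xi ->
  `|enorm (line xi i h) - enorm xi - h * (xi ord0 i * (enorm xi)^-1)|
  <= 2 * (enorm xi)^-1 * h ^+ 2.
Proof.
move=> e0; have e1 := enorm_ge0 (line xi i h).
have H := enorm_line xi i h; have xe := entry_le_enorm xi i.
have hd := enorm_line_dist xi i h.
set e := enorm xi in e0 H xe hd *; set f := enorm (line xi i h) in e1 H hd *.
set x := xi ord0 i in H xe *.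
have ef : 0 < e + f by rewrite ltr_pwDl.
(* From f^2 - e^2 = 2 h x + h^2 after division by e + f; what remains is visibly quadratic in h
   because |e - f| <= |h|. *)
have -> : f - e - h * (x * e^-1) =
    e^-1 * (e + f)^-1 * (h * x * (e - f) + h ^+ 2 * e).
  apply: (mulIf (lt0r_neq0 e0)); apply: (mulIf (lt0r_neq0 ef)).
  rewrite [RHS](_ : _ = h * x * (e - f) + h ^+ 2 * e); last first.
    by field; rewrite (lt0r_neq0 ef) (lt0r_neq0 e0).
  rewrite !mulrBl [X in _ - X](_ : _ = h * x * (e + f)); last first.
    by field; rewrite (lt0r_neq0 e0).
  move: H; rewrite -/e -/f -/x; nra.
have ei : 0 <= e^-1 * (e + f)^-1 by rewrite mulr_ge0 // invr_ge0 ltW.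
rewrite normrM (ger0_norm ei).
have k : `|h * x * (e - f) + h ^+ 2 * e| <= 2 * h ^+ 2 * e.
  apply: (le_trans (ler_normD _ _)); rewrite !normrM (ger0_norm (ltW e0)).
  rewrite distrC in hd.
  have : `|h| * `|x| * `|e - f| <= `|h| * e * `|h|.
    by apply: ler_pM; rewrite ?mulr_ge0 // ler_wpM2l.
  have h3 : `|h| * `|h| * e = h ^+ 2 * e by rewrite -expr2 real_normK ?num_real.
  lra.
apply: (@le_trans _ _ (e^-1 * (e + f)^-1 * (2 * h ^+ 2 * e))).
  by rewrite ler_wpM2l.
rewrite (_ : _ * _ = (2 * e^-1 * h ^+ 2) * (e / (e + f))); last by ring.
have k1 : e / (e + f) <= 1 by rewrite ler_pdivrMr // mul1r lerDl.
by rewrite ler_piMr // mulr_ge0 ?sqr_ge0 // mulr_ge0 // invr_ge0 ltW.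
Qed.

End EuclideanNorm.

(** * The norm |xi| and its powers as symbols *)

Section BaseSymbols.
Variables (R : realType) (n : nat).
Local Notation M2 := 'M[R[i]]_2.
Local Notation X := (R * R * 'rV[R]_n)%type.

(** Only xi moves. The times t and s are part of the point, so that all bounds over [O] are uniform
    in them. *)
Definition mvx (i : 'I_n) (h : R) (x : X) : X := (x.1, line x.2 i h).

Variable O : set X.
Hypothesis O_gt0 : forall x, O x -> 0 < enorm x.2.
Local Notation symb := (symb mvx O).
Local Notation E := (fun (_ : R) (x : X) => enorm x.2).
Local Notation rho := (fun (_ : R) (x : X) => (enorm x.2)^-1).

Lemma dquad_real i (f g : R -> X -> R) :
  (forall x, O x -> exists K e, [/\ 0 <= K, 0 < e & forall s h, 0 <= s <= 1 ->
     `|h| < e -> O (mvx i h x) ->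
     `|f s (mvx i h x) - f s x - h * g s x| <= K * h ^+ 2]) ->
  dquad mvx O i (fun s x => (f s x)%:C%:M) (fun s x => (g s x)%:C%:M).
Proof.
move=> H x Ox; have [K [e [K0 e0 h]]] := H x Ox.
exists (2 * K), e; split=> //; first exact: mulr_ge0.
move=> s d s01 de Od.
have -> : (f s (mvx i d x))%:C%:M - (f s x)%:C%:M - d%:C *: (g s x)%:C%:M =
    (f s (mvx i d x) - f s x - d * g s x)%:C%:M :> M2.
  rewrite scale_scalar_mx !rmorphB /= !rmorphM /=.
  by apply/matrixP => j k; rewrite !mxE; case: (j == k); rewrite ?mulr1n ?mulr0n ?subrr.
by rewrite nrm_scalar -mulrA ler_wpM2l // h.
Qed.

Lemma symb_entry J i : symb J rho E (fun _ x => (x.2 ord0 i)%:C%:M).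
Proof.
have B : bnd O E (fun _ x => (x.2 ord0 i)%:C%:M).
  by exists 2 => // s x _ _; rewrite nrm_scalar ler_wpM2l // entry_le_enorm.
case: J => [|J]; split=> //; try exact: lip_cst.
move=> j; exists (fun _ _ => (i == j)%:R%:C%:M).
  apply: (@dquad_real j (fun _ x => x.2 ord0 i) (fun _ _ => (i == j)%:R)) => x Ox.
  exists 0, 1; split=> // s h _ _ _.
  rewrite /mvx /= line_entry (_ : _ - _ = 0) ?normr0 ?mul0r //; ring.
apply: symb_cst => //; last exact: lip_cst.
exists 2 => // s x _ /O_gt0 e0; rewrite nrm_scalar ler_wpM2l // mulfV ?lt0r_neq0 //.
by case: (i == j); rewrite /= ?normr1 ?normr0.
Qed.

Lemma scalar_real_unit (a : R) : a != 0 -> (a%:C%:M : M2) \in unitmx.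
Proof. by move=> a0; rewrite unitmxE det_scalar unitfE expf_neq0 // fmorph_eq0. Qed.

Lemma invmx_scalar_real (a : R) : invmx (a%:C%:M : M2) = (a^-1)%:C%:M.
Proof. by rewrite invmx_scalar -(fmorphV (real_complex R)). Qed.

(** The hypothesis is at the same order J: the derivative xi_i/|xi| of |xi| needs |xi|^-1 at order J
    to give |xi| at order J + 1, and the two statements climb together. *)
Lemma symb_enorm_inv J : symb J rho E (fun _ x => (enorm x.2)%:C%:M) ->
  symb J rho rho (fun _ x => ((enorm x.2)^-1)%:C%:M).
Proof.
move=> H; apply: (@symb_ext _ _ _ _ _ _ _ _ (fun _ x => invmx ((enorm x.2)%:C%:M))).
  by move=> s x _ _; rewrite invmx_scalar_real.
apply: (symb_inv _ _ _ _ _ _ H).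
- by move=> s x _ /O_gt0 e0; rewrite scalar_real_unit // gt_eqF.
- exists 2 => // s x _ /O_gt0 e0; rewrite invmx_scalar_real nrm_scalar.
  by rewrite ger0_norm // invr_ge0 ltW.
- by exists 1 => // s x _ /O_gt0 e0; rewrite mulfV // gt_eqF.
- by move=> s x _ /O_gt0 e0; rewrite invr_ge0 ltW.
- move=> x /O_gt0 e0; exists (enorm x.2)^-1 => //; by rewrite invr_ge0 ltW.
(* A move by less than |xi|/2 leaves the norm at least |xi|/2, so the inverse at most doubles. *)
move=> i x /O_gt0 e0; exists (2 * (enorm x.2)^-1), (enorm x.2 / 2); split.
- by rewrite mulr_ge0 // invr_ge0 ltW.
- by rewrite divr_gt0.
move=> s h _ hx _; have := enorm_line_dist x.2 i h.
rewrite ler_norml => /andP[k _]; rewrite /mvx /=.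
have k2 : enorm x.2 / 2 <= enorm (line x.2 i h) by lra.
have k3 : 0 < enorm x.2 / 2 by rewrite divr_gt0.
rewrite -[2]invrK -invfM [_^-1 * _]mulrC lef_pV2 ?posrE //.
exact: lt_le_trans k2.
Qed.

Lemma symb_enorm J : symb J rho E (fun _ x => (enorm x.2)%:C%:M).
Proof.
have B : bnd O E (fun _ x => (enorm x.2)%:C%:M).
  by exists 2 => // s x _ _; rewrite nrm_scalar ger0_norm // enorm_ge0.
elim: J => [|J IH]; split=> //; try exact: lip_cst.
move=> i; exists (fun _ (x : X) => (x.2 ord0 i * (enorm x.2)^-1)%:C%:M).
  apply: (@dquad_real i (fun _ (x : X) => enorm x.2) (fun _ (x : X) => x.2 ord0 i * (enorm x.2)^-1)).
  move=> x /O_gt0 e0; exists (2 * (enorm x.2)^-1), 1; split=> //.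
    by rewrite mulr_ge0 // invr_ge0 ltW.
  by move=> s h _ _ _; rewrite /mvx /= enorm_line_quad.
apply: symb_ext (symbM (symb_entry J i) (symb_enorm_inv IH)) => s x _ _.
by rewrite -scalar_mxM -rmorphM.
Qed.

Lemma symb_enormV J : symb J rho rho (fun _ x => ((enorm x.2)^-1)%:C%:M).
Proof. exact/symb_enorm_inv/symb_enorm. Qed.

Lemma symb_cst1 J w (D : M2) : (forall s x, 0 <= s <= 1 -> O x -> 1 <= w s x) ->
  symb J rho w (fun _ _ => D).
Proof.
move=> w1; apply: symb_cst => //; last exact: lip_cst.
exists (nrm D); first exact: nrm_ge0.
by move=> s x s01 Ox; rewrite ler_peMr ?nrm_ge0 // w1.
Qed.

Lemma symb_enormV_exp J q :
  symb J rho (fun _ x => (enorm x.2)^-1 ^+ q) (fun _ x => ((enorm x.2)^-1 ^+ q)%:C%:M).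
Proof.
elim: q => [|q IH].
  apply: (@symb_ext _ _ _ _ _ _ _ _ (fun _ _ => 1%:M)) => [s x _ _|].
    by rewrite expr0.
  exact: symb_cst1.
apply: symb_ext (symb_eqw _ (symbM (symb_enormV J) IH)) => s x *.
  by rewrite -scalar_mxM -rmorphM exprS.
by rewrite exprS.
Qed.

End BaseSymbols.

(** * The oscillating factors *)

Section Phase.
Variable R : realType.
Local Notation M2 := 'M[R[i]]_2.
Implicit Types (d u v : R).

Lemma trig_lip d : `|sin d| <= `|d| /\ `|cos d - 1| <= `|d|.
Proof.
have seg : - `|d| <= 0 <= `|d| by rewrite oppr_le0 !normr_ge0.
have dd : - `|d| <= d <= `|d| by rewrite -ler_norml.
split.
  have := @rder_lipschitz R (@sin R) (@cos R) (- `|d|) `|d| 1 _ _ 0 d seg dd.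
  rewrite sin0 !subr0 mul1r; apply=> t _; last exact: cos_max.
  by apply: is_derive_rder; exact: is_derive_sin.
have := @rder_lipschitz R (@cos R) (fun t => - sin t) (- `|d|) `|d| 1 _ _ 0 d seg dd.
rewrite cos0 !subr0 mul1r; apply=> t _; last by rewrite normrN sin_max.
by apply: is_derive_rder; exact: is_derive_cos.
Qed.

(** The bounds of [trig_lip] on the derivatives, integrated once more, give the second factor
    |d|. *)
Lemma trig_quad d : `|sin d - d| <= d ^+ 2 /\ `|cos d - 1| <= d ^+ 2.
Proof.
have seg : - `|d| <= 0 <= `|d| by rewrite oppr_le0 !normr_ge0.
have dd : - `|d| <= d <= `|d| by rewrite -ler_norml.
rewrite -(@real_normK _ d) ?num_real // expr2.
split.
  have := @rder_lipschitz R (fun t => sin t - t) (fun t => cos t - 1) (- `|d|) `|d| `|d| _ _ 0 d seg dd.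
  rewrite sin0 !subr0; apply=> t td.
    by apply: rderB; [apply: is_derive_rder; exact: is_derive_sin|exact: rder_id].
  by apply: (le_trans (trig_lip t).2); rewrite ler_norml.
have := @rder_lipschitz R (@cos R) (fun t => - sin t) (- `|d|) `|d| `|d| _ _ 0 d seg dd.
rewrite cos0 !subr0; apply=> t td.
  by apply: is_derive_rder; exact: is_derive_cos.
by rewrite normrN; apply: (le_trans (trig_lip t).1); rewrite ler_norml.
Qed.

(** exp (i u J0), the free evolution as a one-parameter group; [PhD] reduces every increment to one
    at u = 0. *)
Definition Ph u : M2 := mx22 (cis u) 0 0 (cis (- u)).
Definition J0 : M2 := mx22 1 0 0 (-1).

Lemma cisD u v : cis (u + v) = cis u * cis v.
Proof.
rewrite /cis cosD sinD; apply/eqP; rewrite eq_complex /= eqxx /=.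
by rewrite addrC.
Qed.

Lemma Ph0 : Ph 0 = 1%:M.
Proof.
by apply: mx2P; rewrite !mxE //= /cis ?oppr0 cos0 sin0.
Qed.

Lemma PhD u v : Ph (u + v) = Ph u *m Ph v.
Proof.
by apply: mx2P; rewrite !(mulmx2E, mxE) /= ?opprD ?cisD; ring.
Qed.

Lemma PhN u : Ph u *m Ph (- u) = 1%:M.
Proof. by rewrite -PhD subrr Ph0. Qed.

Lemma J0_Ph u : J0 *m Ph u = Ph u *m J0.
Proof. by apply: mx2P; rewrite !(mulmx2E, mxE) /=; ring. Qed.

Lemma nrm_Ph u : nrm (Ph u) <= 4.
Proof.
rewrite nrmE !mxE /= /cnorm1 /= !normr0.
have := cos_max u; have := cos_max (- u); have := sin_max u; have := sin_max (- u).
lra.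
Qed.

Lemma nrm_Ph1 d : nrm (Ph d - 1%:M) <= 4 * `|d|.
Proof.
rewrite nrmE !mxE /= /cnorm1 /= !subr0 normr0.
have [h1 h2] := trig_lip d; have [h3 h4] := trig_lip (- d).
by rewrite normrN in h3 h4; lra.
Qed.

Lemma nrm_Ph2 d : nrm (Ph d - 1%:M - d%:C *: ('i *: J0)) <= 4 * d ^+ 2.
Proof.
have [h1 h2] := trig_quad d; have [h3 h4] := trig_quad (- d).
rewrite nrmE !mxE /= /cnorm1 /=.
rewrite !(mulr0, mul0r, mulr1, mulrN1, subr0, sub0r, addr0, add0r, oppr0, normr0, opprK).
rewrite sqrrN opprK in h3 h4; lra.
Qed.

Lemma mder_quad A (y : R -> M2) t D K e : 0 < e -> 0 <= K ->
  (forall x, A x -> `|x - t| < e ->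
     nrm (y x - y t - (x - t)%:C *: D) <= K * (x - t) ^+ 2) ->
  mder A y t D.
Proof.
move=> e0 K0 H c c0.
have d0 : 0 < c / (1 * (1 + K)) by rewrite divr_gt0 // mul1r ltr_pwDl.
exists (Num.min e (c / (1 * (1 + K)))); first by rewrite lt_min e0.
move=> x Ax; rewrite lt_min => /andP[h1 h2]; apply: (le_trans (H x Ax h1)).
rewrite -(@real_normK _ (x - t)) ?num_real // expr2 mulrA ler_wpM2r //.
apply: (le_trans (ler_wpM2l K0 (ltW h2))).
by rewrite mulrC -[leRHS]divr1 absorb // ltW.
Qed.

Lemma mder_Ph A f t d : rder A f t d ->
  mder A (fun x => Ph (f x)) t (d%:C *: ('i *: (J0 *m Ph (f t)))).
Proof.
move=> H; apply: (@mder_comp _ _ setT f Ph) => //.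
apply: (@mder_quad _ _ _ _ 16 1) => // x _ _.
rewrite (_ : _ - _ = (Ph (x - f t) - 1%:M - (x - f t)%:C *: ('i *: J0)) *m Ph (f t)).
  apply: (le_trans (nrmM _ _)).
  have := ler_pM (nrm_ge0 _) (nrm_ge0 _) (nrm_Ph2 (x - f t)) (nrm_Ph (f t)); lra.
by rewrite !mulmxBl -PhD subrK mul1mx -!scalemxAl.
Qed.

End Phase.

Section TimeFacts.
Variable R : realType.
Implicit Types (c : R -> R) (u v : R).

Lemma tcl_bounded L m c : tcl L m c -> exists2 B, 0 <= B & forall t, 0 <= t -> `|c t| <= B.
Proof.
move=> /tcl_bnd[C C0 h]; exists C => // t t0; apply: (le_trans (h t t0)).
rewrite ler_piMr // exprn_ile1 // ?invr_ge0 ?addr_ge0 // invf_le1 ?ltr_pwDl //.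
by rewrite lerDl.
Qed.

Lemma rder_lip_ray c c' B : (forall t, 0 <= t -> rder `[0, +oo[ c t (c' t)) ->
  (forall t, 0 <= t -> `|c' t| <= B) ->
  forall u v, 0 <= u -> 0 <= v -> `|c v - c u| <= B * `|v - u|.
Proof.
move=> H HB u v u0 v0.
apply: (@rder_lipschitz R c c' 0 (u + v) B) => [t /andP[t0 _]|t /andP[t0 _]||].
- apply: rder_sub (H t t0) => x /andP[x0 _]; by rewrite /= in_itv /= x0.
- exact: HB.
- by rewrite u0 lerDl.
- by rewrite v0 lerDr.
Qed.

Lemma tcl_lip L m c : tcl L.+1 m c -> exists2 B, 0 <= B &
  forall u v, 0 <= u -> 0 <= v -> `|c v - c u| <= B * `|v - u|.
Proof.
move=> [_ [c' h /tcl_bounded[B B0 hB]]]; exists B => //; exact: rder_lip_ray h hB.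
Qed.

(** Taylor's formula as a Lipschitz bound for x -> c x - c' u * x, whose derivative c' x - c' u is
    at most B |v - u| between u and v. *)
Lemma tcl_quad L m c c' : (forall t, 0 <= t -> rder `[0, +oo[ c t (c' t)) ->
  tcl L.+1 m c' -> exists2 B, 0 <= B & forall u v, 0 <= u -> 0 <= v ->
    `|c v - c u - c' u * (v - u)| <= B * (v - u) ^+ 2.
Proof.
move=> H /tcl_lip[B B0 hB]; exists B => // u v u0 v0.
rewrite -(@real_normK _ (v - u)) ?num_real // expr2 mulrA.
pose g x := c x - c' u * x.
have -> : c v - c u - c' u * (v - u) = g v - g u by rewrite /g; ring.
pose a := Num.min u v; pose b := Num.max u v.
have a0 : 0 <= a by rewrite le_min u0.
have ab : forall t, a <= t <= b -> `|t - u| <= `|v - u|.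
  by move=> t; rewrite /a /b; have [h|h] := leP u v => /andP[k1 k2];
    [rewrite !ger0_norm ?subr_ge0 // lerD2r|rewrite !ler0_norm ?subr_le0 ?(ltW h) //; lra].
apply: (@rder_lipschitz R g (fun x => c' x - c' u) a b) => [t /andP[t0 _]|t tab||].
- have t1 := le_trans a0 t0.
  rewrite -[c' u]mulr1; apply: rderB; last by rewrite mulr1; have := rderZ (c' u) (@rder_id R [set x | a <= x <= b] t); rewrite mulr1.
  by apply: rder_sub (H t t1) => x /andP[x0 _]; rewrite /= in_itv /= (le_trans a0 x0).
- have t1 : 0 <= t by case/andP: tab => h _; exact: le_trans h.
  by apply: (le_trans (hB u t u0 t1)); rewrite ler_wpM2l // ab.
- by rewrite /a /b ge_min le_max !lexx.
- by rewrite /a /b ge_min le_max !lexx !orbT.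
Qed.

End TimeFacts.

(** * Composition with the interpolated time *)

Section ComposedSymbols.
Variables (R : realType) (n : nat).
Local Notation M2 := 'M[R[i]]_2.
Local Notation X := (R * R * 'rV[R]_n)%type.
Variables (O : set X) (sx : X -> R) (N : R).
Hypothesis N0 : 0 < N.
Hypothesis O_gt0 : forall x, O x -> 0 < enorm x.2.
Hypothesis sx0 : forall x, O x -> 0 <= sx x.
Hypothesis sxt : forall x, O x -> sx x <= x.1.1.
Hypothesis sxN : forall x, O x -> N <= (1 + sx x) * enorm x.2.
Local Notation symb := (symb (@mvx R n) O).
Local Notation rho := (fun (_ : R) (x : X) => (enorm x.2)^-1).
Hypothesis sxS : forall J, symb J rho (fun _ x => 1 + sx x) (fun _ x => (1 + sx x)%:C%:M).

(* The interpolated time between [sx x] at [s = 0] and [t] at [s = 1], where a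
   point is [x = ((t, s), xi)] and [sx x] is the initial time. *)
Definition itime (s : R) (x : X) : R := sx x + s * (x.1.1 - sx x).

Lemma tau_bnd s x : 0 <= s <= 1 -> O x -> sx x <= itime s x <= x.1.1.
Proof.
move=> /andP[s0 s1] Ox; have := sxt Ox; rewrite -subr_ge0 => h.
rewrite /itime lerDl mulr_ge0 //=.
have := ler_wpM2r h s1; lra.
Qed.

Lemma tau_ge0 s x : 0 <= s <= 1 -> O x -> 0 <= itime s x.
Proof. by move=> s01 Ox; case/andP: (tau_bnd s01 Ox) => h _; exact: le_trans (sx0 Ox) h. Qed.

Lemma tau_gt0 s x : 0 <= s <= 1 -> O x -> 0 < 1 + itime s x.
Proof. by move=> s01 Ox; rewrite ltr_pwDl // tau_ge0. Qed.

Lemma tauN s x : 0 <= s <= 1 -> O x -> N <= (1 + itime s x) * enorm x.2.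
Proof.
move=> s01 Ox; apply: (le_trans (sxN Ox)); apply: ler_wpM2r; first exact: enorm_ge0.
by rewrite lerD2l; case/andP: (tau_bnd s01 Ox).
Qed.

Lemma symb_wle J w w' f : (exists2 C, 0 <= C &
    forall s x, 0 <= s <= 1 -> O x -> w s x <= C * w' s x) ->
  symb J rho w f -> symb J rho w' f.
Proof.
move=> [C C0 h]; apply: symb_weight => j _; exists C => // s x s01 Ox.
rewrite mulrA ler_wpM2r ?h // exprn_ge0 // invr_ge0 enorm_ge0 //.
Qed.

Lemma symb_t J : symb J rho (fun _ x => 1 + x.1.1) (fun _ x => (1 + x.1.1)%:C%:M).
Proof.
apply: symb_cst => //; last exact: lip_cst.
exists 2 => // s x _ Ox; rewrite nrm_scalar ger0_norm // addr_ge0 //.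
exact: le_trans (sx0 Ox) (sxt Ox).
Qed.

Lemma symb_sigma J : symb J rho (fun s _ => s) (fun s _ => s%:C%:M).
Proof.
apply: symb_cst => //.
  by exists 2 => // s x /andP[s0 _] _; rewrite nrm_scalar ger0_norm.
move=> x _; exists 2 => // s s' _ _.
by rewrite -raddfB /= -rmorphB nrm_scalar.
Qed.

Lemma symb_1sigma J : symb J rho (fun s _ => 1 - s) (fun s _ => (1 - s)%:C%:M).
Proof.
apply: symb_cst => //.
  by exists 2 => // s x /andP[_ s1] _; rewrite nrm_scalar ger0_norm // subr_ge0.
move=> x _; exists 2 => // s s' _ _.
rewrite -raddfB /= -rmorphB nrm_scalar distrC.
by rewrite (_ : 1 - s' - (1 - s) = s - s') //; ring.
Qed.

Lemma symb_tau J : symb J rho (fun s x => 1 + itime s x) (fun s x => (1 + itime s x)%:C%:M).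
Proof.
(* 1 + t' is a convex combination of 1 + [sx] and 1 + t, so each of the two nonnegative terms is
   dominated by the sum. *)
apply: (@symb_ext _ _ _ _ _ _ _ _ (fun s x => (1 - s)%:C%:M *m (1 + sx x)%:C%:M
    + s%:C%:M *m (1 + x.1.1)%:C%:M)).
  move=> s x _ _; rewrite -!scalar_mxM -raddfD /= -!rmorphM -rmorphD /=.
  by congr (_%:C%:M); rewrite /itime; ring.
apply: symbD.
  apply: symb_wle (symbM (symb_1sigma J) (sxS J)); exists 1 => // s x s01 Ox.
  have [s0 s1] := andP s01; have := sx0 Ox; have := sxt Ox.
  by rewrite /itime; nra.
apply: symb_wle (symbM (symb_sigma J) (symb_t J)); exists 1 => // s x s01 Ox.
have [s0 s1] := andP s01; have := sx0 Ox; have := sxt Ox.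
by rewrite /itime; nra.
Qed.

Lemma symb_dt J : symb J rho (fun _ x => 1 + x.1.1) (fun _ x => (x.1.1 - sx x)%:C%:M).
Proof.
apply: (@symb_ext _ _ _ _ _ _ _ _ (fun s x => (1 + x.1.1)%:C%:M - (1 + sx x)%:C%:M)).
  move=> s x _ _; rewrite -raddfB /= -rmorphB /=.
  by congr (_%:C%:M); ring.
apply: symbD; first exact: symb_t.
apply: symbN; apply: symb_wle (sxS J); exists 1 => // s x _ Ox.
by rewrite mul1r lerD2l sxt.
Qed.

Lemma tau_lip x s s' : O x -> `|itime s x - itime s' x| <= x.1.1 * `|s - s'|.
Proof.
move=> Ox; rewrite (_ : itime s x - itime s' x = (s - s') * (x.1.1 - sx x)); last first.
  by rewrite /itime; ring.
rewrite normrM mulrC ler_wpM2r // ger0_norm ?subr_ge0 ?sxt //.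
by rewrite lerBlDr lerDl sx0.
Qed.

(** Chain rule: c' decays by one power of 1 + t' more than c, and the derivative of t' in xi has
    weight (1 + t')/|xi|, so the net cost is 1/|xi|. The derivative beyond J gives the Lipschitz
    bound in s and the last quadratic remainder. *)
Lemma symb_tcl J L m c : (J.+1 <= L)%N -> tcl L m c ->
  symb J rho (fun s x => (1 + itime s x)^-1 ^+ m) (fun s x => (c (itime s x))%:C%:M).
Proof.
elim: J L m c => [|J IH] L m c JL Hc.
all: have B : bnd O (fun s x => (1 + itime s x)^-1 ^+ m) (fun s x => (c (itime s x))%:C%:M).
1,3: have [C C0 h] := tcl_bnd Hc; exists (2 * C); first exact: mulr_ge0.
1,2: by move=> s x s01 Ox; rewrite nrm_scalar -mulrA ler_wpM2l // h // tau_ge0.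
all: have Lc : lip O (fun s x => (c (itime s x))%:C%:M).
1,3: case: L JL Hc {B} => // L JL Hc x Ox; have [C C0 h] := tcl_lip Hc.
1,2: exists (2 * (C * x.1.1)); first by rewrite !mulr_ge0 // (le_trans (sx0 Ox)) ?sxt.
1,2: move=> s s' s01 s01'; rewrite -raddfB /= -rmorphB nrm_scalar -mulrA ler_wpM2l //.
1,2: apply: (le_trans (h _ _ (tau_ge0 s01' Ox) (tau_ge0 s01 Ox))).
1,2: by rewrite -mulrA ler_wpM2l // tau_lip.
  by [].
split=> // i.
have [_ _ /(_ i)[f' hf hf']] := symb_tau J.+1.
case: L JL Hc {B Lc} => // L JL [_ [c' h1 h2]].
exists (fun s x => (c' (itime s x))%:C%:M *m f' s x); last first.
  apply: symb_wle (symbM (IH L m.+1 c' JL h2) hf'); exists 1 => // s x s01 Ox.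
  have t0 := tau_gt0 s01 Ox.
  rewrite mul1r exprS.
  rewrite (_ : forall y z w v : R, y * z * (w * v) = y * w * (z * v)).
    by rewrite mulVf ?gt_eqF // mul1r.
  by move=> *; ring.
case: L JL h2 => // L JL h2 x Ox.
have [B B0 hB] := tcl_quad h1 h2.
have [B' B0' hB'] := tcl_bounded (h2 : tcl L.+1 m.+1 c').
have [K [e [K0 e0 hK]]] := hf x Ox.
have [K' [e' [K0' e0' hK']]] := dquad_le hf (symb_lip hf') Ox.
exists (2 * (B * K' ^+ 2) + 2 * B' * K), (Num.min e e').
split; [by rewrite addr_ge0 // !mulr_ge0 ?sqr_ge0|by rewrite lt_min e0|].
move=> s h s01; rewrite lt_min => /andP[he he'] Oh.
have {}hK := hK s h s01 he Oh; have {}hK' := hK' s h s01 he' Oh.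
set u := itime s x in hK hK' *; set v := itime s (mvx i h x) in hK hK' *.
have u0 : 0 <= u by exact: tau_ge0.
have v0 : 0 <= v by exact: tau_ge0.
clearbody u v.
have vu : `|v - u| <= K' * `|h|.
  move: hK'; rewrite -raddfB /= -rmorphB nrm_scalar.
  rewrite (_ : 1 + v - (1 + u) = v - u); last by ring.
  by have := normr_ge0 (v - u); lra.
rewrite (_ : _ - _ = (c v - c u - c' u * (v - u))%:C%:M +
   (c' u)%:C%:M *m ((1 + v)%:C%:M - (1 + u)%:C%:M - h%:C *: f' s x)); last first.
  rewrite !mul_scalar_mx; apply/matrixP => j k; rewrite !mxE.
  case: (j == k); rewrite /= ?mulr1n ?mulr0n; last by ring.
  by rewrite !(rmorphB, rmorphD, rmorphM) /=; ring.
apply: (le_trans (nrmD _ _)); rewrite mulrDl; apply: lerD.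
  rewrite nrm_scalar (_ : 2 * _ * _ = 2 * (B * (K' ^+ 2 * h ^+ 2))); last by ring.
  rewrite ler_wpM2l //; apply: (le_trans (hB u v u0 v0)); rewrite ler_wpM2l //.
  rewrite -(@real_normK _ h) ?num_real // -(@real_normK _ (v - u)) ?num_real // -exprMn.
  by rewrite ler_sqr ?nnegrE // (le_trans _ vu).
apply: (le_trans (nrmM _ _)); rewrite nrm_scalar -[leRHS]mulrA.
by apply: ler_pM; rewrite ?nrm_ge0 ?mulr_ge0 // ler_wpM2l // hB'.
Qed.

Lemma symb_gsym J L p m F : (J.+1 <= L)%N -> gsym p m L F ->
  symb J rho (fun s x => (enorm x.2)^-1 ^+ p * (1 + itime s x)^-1 ^+ (p + m))
    (fun s x => F (itime s x) x.2).
Proof.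
move=> JL [G h e].
apply: (@symb_ext _ _ _ _ _ _ _ _ (fun s x => G (itime s x) x.2)).
  by move=> s x s01 Ox; rewrite e ?tau_ge0 ?O_gt0.
elim: h => {F G e} [|F G _ h1 _ h2|q c D pq hc].
- apply: symb_cst => //; last exact: lip_cst.
  exists 0 => // s x _ _; by rewrite nrm0 mul0r.
- exact: symbD.
apply: (@symb_ext _ _ _ _ _ _ _ _
  (fun s x => (c (itime s x))%:C%:M *m ((enorm x.2)^-1 ^+ q)%:C%:M *m D)).
  by move=> s x _ _; rewrite -scalar_mxM -rmorphM mul_scalar_mx.
apply: symbMr; apply: symb_wle (symbM (symb_tcl JL hc) (symb_enormV_exp O_gt0 J q)).
exists (N^-1 ^+ (q - p)); first by rewrite exprn_ge0 // invr_ge0 ltW.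
move=> s x s01 Ox; apply: zhyp_pow => //; [exact: tau_ge0|exact: O_gt0|exact: tauN].
Qed.

(** In the hyperbolic zone 1/|xi| <= (1 + t')/N, so cost 1/|xi| per derivative is the stronger
    requirement. *)
Lemma symb_cost J w f : (forall s x, 0 <= s <= 1 -> O x -> 0 <= w s x) ->
  symb J rho w f -> symb J (fun s x => 1 + itime s x) w f.
Proof.
move=> w0; apply: symb_weight => j _; exists (N^-1 ^+ j).
  by rewrite exprn_ge0 // invr_ge0 ltW.
move=> s x s01 Ox; rewrite mulrCA ler_wpM2l ?w0 // -exprMn.
have e0 := O_gt0 Ox.
apply: lerXn2r; rewrite ?nnegrE ?mulr_ge0 ?invr_ge0 ?(ltW N0) ?(ltW e0) ?(ltW (tau_gt0 s01 Ox)) //.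
rewrite ler_pdivlMl // -ler_pdivlMr ?invr_gt0 // invrK.
exact: tauN.
Qed.

(** The derivative is i J0 phi' Ph(phi). The weight (1 + t')|xi| of the phase becomes 1 + t' for
    phi', and this is the cost of each derivative. *)
Lemma symb_phase J (phi : R -> X -> R) :
  symb J rho (fun s x => (1 + itime s x) * enorm x.2) (fun s x => (phi s x)%:C%:M) ->
  symb J (fun s x => 1 + itime s x) (fun _ _ => 1) (fun s x => Ph (phi s x)).
Proof.
have B : bnd O (fun _ _ => 1) (fun s x => Ph (phi s x)).
  by exists 4 => // s x _ _; rewrite mulr1 nrm_Ph.
have D (u v : R) : Ph v - Ph u = (Ph (v - u) - 1%:M) *m Ph u.
  by rewrite mulmxBl -PhD subrK mul1mx.
have L : lip O (fun s x => (phi s x)%:C%:M) -> lip O (fun s x => Ph (phi s x)).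
  move=> H x Ox; have [L L0 h] := H x Ox; exists (4 * L * 4).
    by rewrite !mulr_ge0.
  move=> s s' s01 s01'; have := h s s' s01 s01'.
  rewrite -raddfB /= -rmorphB nrm_scalar D => h'.
  apply: (le_trans (nrmM _ _)).
  rewrite (_ : 4 * L * 4 * _ = 4 * (L * `|s - s'|) * 4); last by ring.
  apply: ler_pM; rewrite ?nrm_ge0 ?nrm_Ph //; apply: (le_trans (nrm_Ph1 _)).
  have := normr_ge0 (phi s x - phi s' x); lra.
elim: J => [|J IH] H; split=> //; try exact: (L (symb_lip H)).
move=> i; have [_ lphi /(_ i)[f' hf hf']] := H.
exists (fun s x => ('i *: J0 R) *m f' s x *m Ph (phi s x)); last first.
  apply: symb_eqw (symbM _ (IH (symbS H))) => [s x|]; first exact: mulr1.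
  apply: symbMl; apply: (@symb_eqw _ _ _ _ _ _ _ (fun s x => 1 + itime s x)).
    by move=> s x; rewrite mul1r.
  apply: symb_cost; first by move=> s x s01 Ox; rewrite ltW // tau_gt0.
  apply: symb_wle hf'; exists 1 => // s x _ Ox.
  by rewrite mul1r mulfK // gt_eqF // O_gt0.
move=> x Ox.
have [K [e [K0 e0 hK]]] := hf x Ox.
have [K' [e' [K0' e0' hK']]] := dquad_le hf (symb_lip hf') Ox.
pose C := nrm ('i *: J0 R); have C0 : 0 <= C by exact: nrm_ge0.
exists (4 * K' ^+ 2 * 4 + C * K * 4), (Num.min e e').
split; [by rewrite addr_ge0 // !mulr_ge0 ?sqr_ge0|by rewrite lt_min e0|].
move=> s h s01; rewrite lt_min => /andP[he he'] Oh.
have {}hK := hK s h s01 he Oh; have {}hK' := hK' s h s01 he' Oh.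
set u := phi s x in hK hK' *; set v := phi s (mvx i h x) in hK hK' *.
clearbody u v.
have vu : `|v - u| <= K' * `|h|.
  move: hK'; rewrite -raddfB /= -rmorphB nrm_scalar.
  by have := normr_ge0 (v - u); lra.
rewrite (_ : _ - _ = (Ph (v - u) - 1%:M - (v - u)%:C *: ('i *: J0 R)) *m Ph u +
   ('i *: J0 R) *m (v%:C%:M - u%:C%:M - h%:C *: f' s x) *m Ph u); last first.
  have e1 : ('i *: J0 R) *m (v%:C%:M - u%:C%:M - h%:C *: f' s x) =
      (v - u)%:C *: ('i *: J0 R) - h%:C *: (('i *: J0 R) *m f' s x).
    by rewrite !mulmxBr !mul_mx_scalar -scalemxAr -scalerBl rmorphB.
  rewrite e1 D; move: ('i *: J0 R) (Ph (v - u)) (Ph u) => Z Y W.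
  by rewrite -mulmxDl addrA subrK [RHS]mulmxBl scalemxAl.
apply: (le_trans (nrmD _ _)); rewrite mulrDl; apply: lerD.
  apply: (le_trans (nrmM _ _)).
  rewrite (_ : 4 * _ * 4 * _ = 4 * (K' ^+ 2 * h ^+ 2) * 4); last by ring.
  apply: ler_pM; rewrite ?nrm_ge0 ?nrm_Ph //; apply: (le_trans (nrm_Ph2 _)).
  rewrite ler_wpM2l // -(@real_normK _ h) ?num_real //.
  rewrite -(@real_normK _ (v - u)) ?num_real // -exprMn.
  by rewrite ler_sqr ?nnegrE // (le_trans _ vu).
apply: (le_trans (nrmM _ _)); rewrite mulrAC.
apply: ler_pM; rewrite ?nrm_ge0 ?nrm_Ph //; apply: (le_trans (nrmM _ _)).
by rewrite -mulrA ler_wpM2l.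
Qed.

End ComposedSymbols.

(** * Estimates for the amplitude *)

Section TimeEstimates.
Variable R : realType.
Local Notation M2 := 'M[R[i]]_2.
Implicit Types (t s x e c : R).

Lemma rder_quad A (f : R -> R) t d K e : 0 < e -> 0 <= K ->
  (forall x, A x -> `|x - t| < e ->
     `|f x - f t - (x - t) * d| <= K * (x - t) ^+ 2) ->
  rder A f t d.
Proof.
move=> e0 K0 H c c0.
have d0 : 0 < c / (1 * (1 + K)) by rewrite divr_gt0 // mul1r ltr_pwDl.
exists (Num.min e (c / (1 * (1 + K)))); first by rewrite lt_min e0.
move=> x Ax; rewrite lt_min => /andP[h1 h2]; apply: (le_trans (H x Ax h1)).
rewrite -(@real_normK _ (x - t)) ?num_real // expr2 mulrA ler_wpM2r //.
apply: (le_trans (ler_wpM2l K0 (ltW h2))).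
by rewrite mulrC -[leRHS]divr1 absorb // ltW.
Qed.

Lemma rder_inv1 t : 0 <= t ->
  rder `[0, +oo[ (fun x => (1 + x)^-1) t (- (1 + t)^-1 ^+ 2).
Proof.
move=> t0; apply: (@rder_quad _ _ _ _ 1 1) => // x; rewrite /= in_itv /= andbT => x0 _.
have x1 : 0 < 1 + x by rewrite ltr_pwDl.
have t1 : 0 < 1 + t by rewrite ltr_pwDl.
have -> : (1 + x)^-1 - (1 + t)^-1 - (x - t) * - (1 + t)^-1 ^+ 2 =
    (1 + x)^-1 * (1 + t)^-1 ^+ 2 * (x - t) ^+ 2.
  by field; rewrite !gt_eqF.
have b1 (y : R) : 0 <= y -> 0 <= (1 + y)^-1 <= 1.
  move=> y0; have y1 : 0 < 1 + y by rewrite ltr_pwDl.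
  apply/andP; split; first by rewrite invr_ge0 ltW.
  by rewrite invf_le1 // lerDl.
have /andP[p1 p2] := b1 _ x0; have /andP[q1 q2] := b1 _ t0.
have c1 : 0 <= (1 + x)^-1 * (1 + t)^-1 ^+ 2 by rewrite mulr_ge0 // sqr_ge0.
have s0 := sqr_ge0 (x - t).
rewrite (ger0_norm (mulr_ge0 c1 s0)) ler_wpM2r //.
by rewrite mulr_ile1 ?sqr_ge0 // exprn_ile1.
Qed.

(** The intervals from f t - W t to f t + W t are nested; the supremum of their left end points lies
    in all of them. *)
Lemma monotone_limit (f W : R -> R) s : (forall t, s <= t -> 0 <= W t) ->
  (forall t t', s <= t -> t <= t' -> `|f t' - f t| <= W t - W t') ->
  exists L, forall t, s <= t -> `|f t - L| <= W t.
Proof.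
move=> W0 H.
pose S := [set y | exists2 t, s <= t & y = f t - W t].
have K t t' : s <= t -> s <= t' -> f t - W t <= f t' + W t'.
  move=> st st'; pose T := Num.max t t'.
  have tT : t <= T by rewrite le_max lexx.
  have tT' : t' <= T by rewrite le_max lexx orbT.
  have := H t T st tT; have := H t' T st' tT'; rewrite !ler_norml.
  have := W0 T (le_trans st tT).
  by move=> h /andP[h1 h2] /andP[h3 h4]; lra.
have Ss t : s <= t -> S (f t - W t) by move=> st; exists t.
have hS : has_sup S.
  split; first by exists (f s - W s); exact: Ss.
  by exists (f s + W s) => y [t st ->]; apply: K.
exists (sup S) => t st.
have h1 : f t - W t <= sup S by apply: ub_le_sup; [case: hS|exact: Ss].
have h2 : sup S <= f t + W t.
  by apply: ge_sup; [case: hS|move=> y [t' st' ->]; exact: K].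
by rewrite ler_norml; apply/andP; split; lra.
Qed.

Lemma mx_limit (y : R -> M2) (W : R -> R) s : (forall t, s <= t -> 0 <= W t) ->
  (forall t t', s <= t -> t <= t' -> nrm (y t' - y t) <= W t - W t') ->
  exists L, forall t, s <= t -> nrm (y t - L) <= 8 * W t.
Proof.
move=> W0 H.
have hR i j t t' : s <= t -> t <= t' ->
    `|complex.Re (y t' i j) - complex.Re (y t i j)| <= W t - W t'.
  move=> st tt; apply: le_trans (H t t' st tt); apply: le_trans (nrm_entry _ i j).
  by rewrite /cnorm1 !mxE ReD ReN lerDl.
have hI i j t t' : s <= t -> t <= t' ->
    `|complex.Im (y t' i j) - complex.Im (y t i j)| <= W t - W t'.
  move=> st tt; apply: le_trans (H t t' st tt); apply: le_trans (nrm_entry _ i j).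
  by rewrite /cnorm1 !mxE ImD ImN lerDr.
have /choice[lr Hr] (ij : 'I_2 * 'I_2) := monotone_limit W0 (hR ij.1 ij.2).
have /choice[li Hi] (ij : 'I_2 * 'I_2) := monotone_limit W0 (hI ij.1 ij.2).
exists (\matrix_(i, j) (lr (i, j) +i* li (i, j))) => t st.
have hc i j : cnorm1 ((y t - \matrix_(i, j) (lr (i, j) +i* li (i, j))) i j) <= 2 * W t.
  rewrite /cnorm1 !mxE ReD ReN ImD ImN /=.
  have := Hr (i, j) t st; have := Hi (i, j) t st; rewrite /=; lra.
rewrite nrmE; have := hc ord0 ord0; have := hc ord0 ord_max.
have := hc ord_max ord0; have := hc ord_max ord_max; lra.
Qed.

Lemma adj2_mul (M : M2) : adj2 M *m M =
  (M ord0 ord0 * M ord_max ord_max - M ord0 ord_max * M ord_max ord0)%:M.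
Proof.
by apply: mx2P; rewrite !(mulmx2E, mxE) /= ?mulr1n ?mulr0n; ring.
Qed.

(** With d the determinant, sqn (d I) = 2|d|^2, so c bounds |d| from below. The inverse is d^-1
    [adj2 M], and d^-1 has l^1 norm at most C^2 / |d|^2. *)
Lemma nrm_inv_bound (M : M2) c C : 0 < c -> nrm M <= C ->
  c <= sqn (adj2 M *m M) -> M \in unitmx /\ nrm (invmx M) <= 2 * C ^+ 3 / c.
Proof.
move=> c0 MC; rewrite adj2_mul; set d := _ - _ => cd.
have sd : sqn d%:M = 2 * (complex.Re d ^+ 2 + complex.Im d ^+ 2).
  rewrite /sqn !big_ord_recl !big_ord0 !mxE /= ?mulr1n ?mulr0n /=; lra.
have q0 : 0 < complex.Re d ^+ 2 + complex.Im d ^+ 2.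
  by rewrite -(pmulr_rgt0 _ (ltr0n R 2)) -sd (lt_le_trans c0).
have d0 : d != 0.
  by apply: contraTneq q0 => ->; rewrite /= expr0n /= addr0 ltxx.
have dM : (d^-1 *: adj2 M) *m M = 1%:M.
  by rewrite -scalemxAl adj2_mul scale_scalar_mx mulVf.
have Mu : M \in unitmx by have [] := mulmx1_unit dM.
split=> //.
have -> : invmx M = d^-1 *: adj2 M by rewrite -[RHS]mulmx1 -(mulmxV Mu) mulmxA dM mul1mx.
have C0 : 0 <= C by exact: le_trans (nrm_ge0 _) MC.
have dC : cnorm1 d <= C ^+ 2.
  have : nrm d%:M <= C ^+ 2.
    rewrite -adj2_mul expr2; apply: (le_trans (nrmM _ _)).
    by rewrite nrm_adj2; apply: ler_pM; rewrite ?nrm_ge0.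
  by apply: le_trans; have := nrm_entry (d%:M : M2) ord0 ord0; rewrite mxE.
have dV : cnorm1 d^-1 <= 2 * C ^+ 2 / c.
  rewrite (_ : cnorm1 d^-1 = cnorm1 d / (complex.Re d ^+ 2 + complex.Im d ^+ 2)).
    rewrite ler_pdivlMr // mulrAC ler_pdivrMr // -mulrA; nra.
  move: q0; case: (d) => x y /= q0; rewrite /cnorm1 /= !normrM normrN normrM.
  by rewrite -mulrDl (@ger0_norm _ (_ ^-1)) // invr_ge0 ltW.
apply: (le_trans (nrmZ _ _)); rewrite nrm_adj2.
apply: (@le_trans _ _ (2 * C ^+ 2 / c * C)).
  by apply: ler_pM; rewrite ?nrm_ge0 ?cnorm1_ge0.
by rewrite exprSr; lra.
Qed.

End TimeEstimates.

Lemma divK_swap (F : fieldType) (x y : F) : x != 0 -> y != 0 -> x / y * (y / x) = 1.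
Proof. by move=> x0 y0; field; rewrite x0. Qed.

Lemma rder_divr (R : realType) (A : set R) f (t d c : R) :
  rder A f t d -> rder A (fun x => f x / c) t (d / c).
Proof. by move=> H; have := rderM H (rder_cst A c^-1 t); rewrite mulr0 addr0. Qed.

(** [G] is the inverse free evolution. It commutes with the diagonal terms r J and F, so only T is
    conjugated; of [H] it is only required that it undoes [G] on U. *)
Lemma conj_generator (R : realType) (F T U G H J : 'M[R[i]]_2) (r : R[i]) :
  U = H *m (G *m U) -> J *m G = G *m J -> G *m F = F *m G ->
  G *m ('i *: ((r *: J + F + T) *m U)) =
  'i *: (r *: (J *m (G *m U)) + F *m (G *m U) + (G *m T *m H) *m (G *m U)).
Proof.
move=> hU hJ hF.
have e1 : G *m (J *m U) = J *m (G *m U) by rewrite !mulmxA hJ.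
have e2 : G *m (F *m U) = F *m (G *m U) by rewrite !mulmxA hF.
have e3 : G *m (T *m U) = G *m T *m H *m (G *m U) by rewrite {1}hU !mulmxA.
by rewrite -e1 -e2 -e3 !mulmxDl -scalemxAl -scalemxAr !mulmxDr -scalemxAr.
Qed.

Lemma adj2_1 (R : realType) : adj2 (1%:M : 'M[R[i]]_2) = 1%:M.
Proof. by apply: mx2P; rewrite !mxE /= ?oppr0. Qed.

Lemma sqn_1 (R : realType) : sqn (1%:M : 'M[R[i]]_2) = 2.
Proof.
by rewrite /sqn !big_ord_recl !big_ord0 !mxE /= !(expr0n, expr1n) /=; lra.
Qed.

(** * The amplitude Q_k for k = j.+1: equation, bounds, inverse and limit *)

Section Transformed.
Variables (R : realType) (n l j : nat) (b m : R -> R) (N CI : R).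
Local Notation M2 := 'M[R[i]]_2.
Variable E : R -> R -> 'rV[R]_n -> M2.
Hypotheses (hb : tcl l 1 b) (hm : tcl l 2 m) (hjl : (j.+1 <= l)%N) (N0 : 0 < N).
Hypothesis hNu : forall (t : R) (xi : 'rV[R]_n), Zhyp N t xi ->
  Nmx b m j.+1 t xi \in unitmx.
Hypothesis hNi : forall (t : R) (xi : 'rV[R]_n), Zhyp N t xi ->
  nrm (invmx (Nmx b m j.+1 t xi)) <= CI.
Hypothesis hE : forall (s : R) (xi : 'rV[R]_n), Zhyp N s xi ->
     fundamental_solution s
       (fun t => Dmx xi + Fpred b m j.+1 t xi + Rk b m j.+1 t xi)
       (fun t => E t s xi).
Implicit Types (t s : R) (xi : 'rV[R]_n).

Local Notation FF := (@Fpred R n b m j.+1).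
Local Notation RR := (@Rk R n b m j.+1).
Local Notation e := (l - j.+1)%N.

Let el : (j.+1 + e = l)%N. Proof. exact: subnKC. Qed.

Lemma Zhyp_ge0 t xi : Zhyp N t xi -> 0 <= t. Proof. by case. Qed.

Lemma Zhyp_gt0 t xi : Zhyp N t xi -> 0 < enorm xi.
Proof.
move=> [t0 h]; rewrite lt_neqAle enorm_ge0 andbT; apply/eqP => e0.
by move: h; rewrite -e0 mulr0 leNgt N0.
Qed.

Lemma Zhyp_le t s xi : s <= t -> Zhyp N s xi -> Zhyp N t xi.
Proof.
move=> st [s0 h]; split; first exact: le_trans st.
by apply: (le_trans h); rewrite ler_wpM2r ?enorm_ge0 // lerD2l.
Qed.

Lemma Zhyp_neq0 xi : xi != 0 -> forall s, theta N (enorm xi) <= s -> 0 <= s ->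
  Zhyp N s xi.
Proof.
move=> /enorm_gt0 x0 s; rewrite /theta /Zhyp /= => h s0; split=> //.
move: h; case: ifPn => [_|]; first by rewrite lerBlDl ler_pdivrMr.
rewrite -ltNge => /ltW h _; apply: (le_trans h).
by rewrite ler_peMl ?enorm_ge0 // lerDl.
Qed.

Lemma Zhyp_theta t xi : Zhyp N t xi -> 0 <= theta N (enorm xi) <= t.
Proof.
move=> Z; have x0 := Zhyp_gt0 Z; have t0 := Zhyp_ge0 Z.
rewrite /theta; case: ifPn => h; last by rewrite lexx.
rewrite subr_ge0 ler_pdivlMr // mul1r h /= lerBlDl ler_pdivrMr //.
by case: Z.
Qed.

Lemma Zhyp_at_theta t xi : Zhyp N t xi -> Zhyp N (theta N (enorm xi)) xi.
Proof.
move=> Z; have /andP[th0 _] := Zhyp_theta Z; split=> //.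
rewrite /theta; case: ifPn => [_|]; first by rewrite addrC subrK divfK ?gt_eqF ?(Zhyp_gt0 Z).
by rewrite -ltNge addr0 mul1r => /ltW.
Qed.

Lemma rder_lambda t : 0 <= t ->
  rder `[0, +oo[ (lambda b) t (lambda b t * (2^-1 * b t)).
Proof.
move=> t0; apply: rder_expR; apply: rderZ.
have [L hL] : exists L, forall x y, 0 <= x -> 0 <= y -> `|b x - b y| <= L * `|x - y|.
  move: hb; rewrite (_ : l = l.-1.+1); last by rewrite prednK // (leq_trans _ hjl).
  by move/tcl_lip=> [B B0 hB]; exists B => x y x0 y0; exact: hB.
exact: rder_integral hL t t0.
Qed.

Lemma lambda_gt0 t : 0 < lambda b t.
Proof. exact: expR_gt0. Qed.

Lemma DmxE xi : Dmx xi = (enorm xi)%:C *: J0 R.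
Proof.
by apply: mx2P; rewrite !mxE /= ?mulr1 ?mulr0 ?mulrN1.
Qed.

Definition phs t s xi : R := (t - s) * enorm xi.

Definition Qmx t s xi : M2 :=
  (lambda b t / lambda b s)%:C *: (Ph (- phs t s xi) *m E t s xi).

(** F^(0) = (i b/2) I is cancelled by the logarithmic derivative b/2 of lambda. What remains is
    O(|xi|^-1 (1 + t)^-2). *)
Definition PP t xi : M2 := FF t xi - F0mx b t.

Definition Amx t s xi : M2 :=
  'i *: (PP t xi + Ph (- phs t s xi) *m RR t xi *m Ph (phs t s xi)).

Lemma E0mxE t s xi : E0mx t s xi = Ph (phs t s xi).
Proof. by []. Qed.

Lemma EQ t s xi : E t s xi = (lambda b s / lambda b t)%:C *: (E0mx t s xi *m Qmx t s xi).
Proof.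
rewrite E0mxE /Qmx -scalemxAr mulmxA PhN mul1mx scalerA -rmorphM /=.
by rewrite divK_swap ?scale1r // gt_eqF ?lambda_gt0.
Qed.

Lemma Qmx_diag s xi : Zhyp N s xi -> Qmx s s xi = 1%:M.
Proof.
move=> Z; rewrite /Qmx /phs subrr mul0r oppr0 Ph0 mul1mx divff ?gt_eqF ?lambda_gt0 //.
by rewrite scale1r; case: (hE Z).
Qed.

Lemma diag_Ph (D : M2) u : diag_part D = D -> Ph u *m D = D *m Ph u.
Proof.
move=> <-; apply: mx2P; rewrite !(mulmx2E, mxE) /=; ring.
Qed.

Lemma rder_phs A t s xi : rder A (fun t => - phs t s xi) t (- enorm xi).
Proof.
have := rderN (rderM (rderB (@rder_id R A t) (rder_cst A s t)) (rder_cst A (enorm xi) t)).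
by rewrite subr0 mul1r mulr0 addr0.
Qed.

Lemma Qmx_ode s t xi : Zhyp N s xi -> s <= t ->
  mder `[s, +oo[ (fun t => Qmx t s xi) t (Amx t s xi *m Qmx t s xi).
Proof.
move=> Z st; have s0 := Zhyp_ge0 Z; have t0 := le_trans s0 st.
have [_ /(_ t st)[/derivable_mder hd hD]] := hE Z.
rewrite hD in hd.
have hl : rder `[s, +oo[ (fun t => lambda b t / lambda b s) t
    (lambda b t / lambda b s * (2^-1 * b t)).
  rewrite mulrAC; apply: rder_divr; apply: rder_sub (rder_lambda t0) => x.
  by rewrite /= !in_itv /= !andbT; exact: le_trans.
have := mderMr_real hl (mderM (mder_Ph (rder_phs `[s, +oo[ t s xi)) hd).
congr mder; rewrite /Qmx -/(phs t s xi).
have [_ _ dF _] := NF_struct n hb hm el.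
have hF0 : F0mx b t = ('i * (b t)%:C / 2)%:M by exact: F0mxE.
have hP := diag_Ph (- phs t s xi) (dF t xi).
rewrite /Amx /PP DmxE.
have hEE : E t s xi = Ph (phs t s xi) *m (Ph (- phs t s xi) *m E t s xi).
  by rewrite mulmxA PhN mul1mx.
have hJ := J0_Ph (- phs t s xi).
have hlb (la be : R) : (la * (2^-1 * be))%:C = la%:C * (be%:C / 2) :> R[i].
  by rewrite !rmorphM /= fmorphV /= rmorph_nat [2^-1 * _]mulrC.
have hN : (- enorm xi)%:C = - (enorm xi)%:C :> R[i] by exact: (rmorphN (real_complex R)).
rewrite hlb hN hF0.
set G := Ph (- _) in hP hEE hJ *; set H := Ph _ in hEE *.
move: (FF t xi) (RR t xi) (E t s xi) G H (J0 R) (real_complex R (enorm xi))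
  (real_complex R (lambda b t / lambda b s)) (real_complex R (b t))
  hP hEE hJ => F T U G H J r la be hP hEE hJ {hd hD hl dF hF0 hlb hN}.
rewrite (conj_generator T r hEE hJ hP) -!scalemxAl -mulmxA.
rewrite -scalemxAr !mulmxDl mulNmx mul_scalar_mx.
move: (G *m U) => W; move: (G *m T *m H *m W) (F *m W) (J *m W) => V Y X.
apply/matrixP => p q; rewrite !mxE.
have i2 : 'i * 'i = -1 :> R[i] by rewrite -expr2 sqr_i.
ring: i2.
Qed.

Lemma PP_gsym : gsym 1 1 e.+1 PP.
Proof. by have [] := NF_struct n hb hm el. Qed.

Lemma Bk_gsym : gsym j.+1 1 e (@Bk R n b m j.+1).
Proof. by have [] := NF_struct n hb hm el. Qed.

Lemma nrm_i (D : M2) : nrm ('i *: D) <= nrm D.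
Proof.
by apply: (le_trans (nrmZ _ _)); rewrite /cnorm1 /= normr0 normr1 add0r mul1r.
Qed.

Lemma Amx_bound : exists2 CA, 0 <= CA & forall t s xi, Zhyp N t xi ->
  nrm (Amx t s xi) <= CA * ((enorm xi)^-1 * (1 + t)^-1 ^+ 2).
Proof.
have [C1 C10 h1] := gsym_bound N0 PP_gsym.
(* One power of |xi|^-1 suffices without xi-derivatives; the full order j.+1 is needed only in
   [symb_conj]. *)
have [C2 C20 h2] := gsym_bound N0 (gsym_le (ltn0Sn _) (leqnn _) Bk_gsym).
(* [CI] may be negative if the zone is empty. *)
pose C := Num.max 0 CI; have C0 : 0 <= C by rewrite le_max lexx.
exists (C1 + 4 * (C * C2) * 4); first by rewrite addr_ge0 ?mulr_ge0.
move=> t s xi Z; have t0 := Zhyp_ge0 Z; have x0 := Zhyp_gt0 Z; have [_ ZN] := Z.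
have {}h1 := h1 t xi t0 x0 ZN; have {}h2 := h2 t xi t0 x0 ZN.
rewrite addn1 expr1 in h1 h2; set w := _^-1 * _ in h1 h2 *.
apply: (le_trans (nrm_i _)); apply: (le_trans (nrmD _ _)); rewrite mulrDl.
apply: lerD => //.
apply: (le_trans (nrmM _ _)).
rewrite (_ : 4 * _ * 4 * w = 4 * (C * (C2 * w)) * 4); last by ring.
apply: ler_pM; rewrite ?nrm_ge0 ?nrm_Ph //.
apply: (le_trans (nrmM _ _)); apply: ler_pM; rewrite ?nrm_ge0 ?nrm_Ph //.
rewrite /Rk nrmN; apply: (le_trans (nrmM _ _)); apply: ler_pM; rewrite ?nrm_ge0 //.
by apply: (le_trans (hNi Z)); rewrite le_max lexx orbT.
Qed.

Lemma rder_weight c a t : 0 <= t -> 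
  rder `[0, +oo[ (fun t => - (c * (a * (1 + t)^-1))) t (c * (a * (1 + t)^-1 ^+ 2)).
Proof.
move=> t0; have := rderN (rderZ c (rderZ a (rder_inv1 t0))).
by rewrite !mulrN opprK.
Qed.

(** The increase from s to t is at most c / ((1 + s)|xi|), and (s, xi) lies in the hyperbolic zone.
    This makes the Gronwall factors uniform in t, s and xi. *)
Lemma weight_le s t xi c : 0 <= c -> Zhyp N s xi -> s <= t ->
  - (c * ((enorm xi)^-1 * (1 + t)^-1)) - - (c * ((enorm xi)^-1 * (1 + s)^-1)) <= c / N.
Proof.
move=> c0 Z st; have s0 := Zhyp_ge0 Z; have x0 := Zhyp_gt0 Z; have [_ ZN] := Z.
have t1 : 0 < 1 + t by rewrite ltr_pwDl // (le_trans s0).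
have s1 : 0 < 1 + s by rewrite ltr_pwDl.
rewrite opprK; apply: (@le_trans _ _ (c * ((enorm xi)^-1 * (1 + s)^-1))).
  by rewrite gerDr oppr_le0 !mulr_ge0 // invr_ge0 ltW.
by rewrite ler_wpM2l // -invfM lef_pV2 ?posrE ?mulr_gt0 // mulrC.
Qed.

Let seg s t : 0 <= s -> [set x | s <= x <= t] `<=` `[0, +oo[.
Proof. by move=> s0 x /andP[sx _]; rewrite /= in_itv /= (le_trans s0 sx). Qed.

Let seg' s t : [set x | s <= x <= t] `<=` `[s, +oo[.
Proof. by move=> x /andP[sx _]; rewrite /= in_itv /= sx. Qed.

Lemma Qmx_bound : exists2 CQ, 0 <= CQ & forall t s xi, Zhyp N s xi -> s <= t ->
  nrm (Qmx t s xi) <= CQ.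
Proof.
have [CA CA0 hA] := Amx_bound.
exists (16 * expR (96 * (CA / N))); first by rewrite mulr_ge0 ?expR_ge0.
move=> t s xi Z st; have s0 := Zhyp_ge0 Z; have x0 := Zhyp_gt0 Z.
have := @gronwall R (fun t => Qmx t s xi) (fun t => Amx t s xi *m Qmx t s xi)
  (fun t => - (CA * ((enorm xi)^-1 * (1 + t)^-1)))
  (fun t => CA * ((enorm xi)^-1 * (1 + t)^-1 ^+ 2)) 0 s t st (lexx _).
rewrite Qmx_diag // nrm1 expr0n /= addr0 => h.
rewrite -ler_sqr ?nnegrE ?nrm_ge0 ?mulr_ge0 ?expR_ge0 //.
apply: le_trans (h _ _ _) _.
- move=> u ust; apply: mder_sub (Qmx_ode Z _); first exact: seg'.
  by case/andP: ust.
- move=> u ust; apply: rder_sub (rder_weight _ _ _); first exact: seg.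
  by case/andP: ust => su _; exact: le_trans su.
- move=> u /andP[su ut]; have u0 := le_trans s0 su.
  rewrite addr0; split.
    by rewrite !mulr_ge0 ?invr_ge0 ?(ltW x0) ?addr_ge0.
  apply: (le_trans (nrmM _ _)); rewrite ler_wpM2r ?nrm_ge0 // hA //.
  exact: Zhyp_le Z.
rewrite exprMn expR_sqr (_ : 64 * 2 ^+ 2 = 16 ^+ 2); last by ring.
rewrite ler_wpM2l ?sqr_ge0 // ler_expR (_ : 2 * (96 * _) = 192 * (CA / N)); last by ring.
by rewrite ler_wpM2l // weight_le.
Qed.

(** Liouville's formula: y = adj(Q) Q = (det Q) I solves y' = tr(A) y. The trace is bounded by the
    norm of A, so [gronwall_lower] started from y = I bounds the determinant from below. *)
Lemma Qmx_unit : exists2 CV, 0 <= CV & forall t s xi, Zhyp N s xi -> s <= t ->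
  Qmx t s xi \in unitmx /\ nrm (invmx (Qmx t s xi)) <= CV.
Proof.
have [CA CA0 hA] := Amx_bound; have [CQ CQ0 hQ] := Qmx_bound.
pose c := expR (- (192 * (CA / N))).
have c0 : 0 < c by exact: expR_gt0.
exists (2 * CQ ^+ 3 / c); first by rewrite !mulr_ge0 ?exprn_ge0 ?invr_ge0 ?(ltW c0).
move=> t s xi Z st; have s0 := Zhyp_ge0 Z; have x0 := Zhyp_gt0 Z.
apply: nrm_inv_bound => //; first exact: hQ.
pose trA u := Amx u s xi ord0 ord0 + Amx u s xi ord_max ord_max.
pose y u := adj2 (Qmx u s xi) *m Qmx u s xi.
have := @gronwall_lower R y (fun u => trA u *: y u)
  (fun t => - (CA * ((enorm xi)^-1 * (1 + t)^-1)))
  (fun t => CA * ((enorm xi)^-1 * (1 + t)^-1 ^+ 2)) s t st.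
have -> : y s = 1%:M by rewrite /y Qmx_diag // adj2_1 mulmx1.
rewrite sqn_1 => h; rewrite -(@ler_pM2r _ (expR (192 * (CA / N)))) ?expR_gt0 //.
rewrite /c -expRD addNr expR0.
apply: (@le_trans _ _ 2); first by rewrite ler1n.
apply: le_trans (h _ _ _) _.
- move=> u /andP[su ut].
  have hu := mder_sub (@seg' s t) (Qmx_ode Z su).
  have := mderM (mder_adj2 hu) hu; congr mder.
  rewrite /y /trA; move: (Amx _ _ _) (Qmx _ _ _) => A Q.
  by apply: mx2P; rewrite !(mulmx2E, mxE) /= ?(mulmx2E, mxE) /=; ring.
- move=> u ust; apply: rder_sub (rder_weight _ _ _); first exact: seg.
  by case/andP: ust => su _; exact: le_trans su.
- move=> u /andP[su ut]; have u0 := le_trans s0 su; split.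
    by rewrite !mulr_ge0 ?invr_ge0 ?(ltW x0) ?addr_ge0.
  apply: (le_trans (nrmZ _ _)); rewrite ler_wpM2r ?nrm_ge0 //.
  apply: le_trans (hA u s xi (Zhyp_le su Z)); apply: (le_trans (cnorm1D _ _)).
  rewrite nrmE; have := cnorm1_ge0 (Amx u s xi ord0 ord_max).
  have := cnorm1_ge0 (Amx u s xi ord_max ord0); lra.
by rewrite ler_wpM2l ?sqn_ge0 // ler_expR ler_wpM2l // weight_le.
Qed.

Lemma Qmx_limit : exists Qoo : R -> 'rV[R]_n -> M2,
  (forall s xi, Zhyp N s xi -> Qoo s xi \in unitmx) /\
  exists2 C, 0 <= C & forall t s xi, Zhyp N s xi -> s <= t ->
    nrm (Qmx t s xi - Qoo s xi) <= C * ((enorm xi)^-1 * (1 + t)^-1).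
Proof.
have [CA CA0 hA] := Amx_bound; have [CQ CQ0 hQ] := Qmx_bound.
have [CV CV0 hV] := Qmx_unit.
have K s xi : exists L, Zhyp N s xi -> forall t, s <= t ->
    nrm (Qmx t s xi - L) <= 8 * (CA * CQ * ((enorm xi)^-1 * (1 + t)^-1)).
  have [Z|] := pselect (Zhyp N s xi); last by exists 0.
  have s0 := Zhyp_ge0 Z; have x0 := Zhyp_gt0 Z.
  have [t st|t t' st tt|L hL] := @mx_limit R (fun t => Qmx t s xi)
    (fun t => CA * CQ * ((enorm xi)^-1 * (1 + t)^-1)) s; last by exists L.
    have t0 := le_trans s0 st.
    by rewrite !mulr_ge0 ?invr_ge0 ?(ltW x0) ?addr_ge0.
  rewrite (_ : _ - _ = - (CA * CQ * ((enorm xi)^-1 * (1 + t')^-1)) -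
    - (CA * CQ * ((enorm xi)^-1 * (1 + t)^-1))); last by rewrite opprK addrC.
  have t0 := le_trans s0 st.
  apply: (@mder_growth R (fun t => Qmx t s xi) (fun t => Amx t s xi *m Qmx t s xi)
    (fun t => - (CA * CQ * ((enorm xi)^-1 * (1 + t)^-1)))
    (fun t => CA * CQ * ((enorm xi)^-1 * (1 + t)^-1 ^+ 2))) => // u ut.
  - have tu : t <= u by case/andP: ut.
    apply: mder_sub (Qmx_ode Z (le_trans st tu)) => x /andP[tx _].
    by rewrite /= in_itv /= (le_trans st tx).
  - apply: rder_sub (rder_weight _ _ _); first exact: seg.
    by case/andP: ut => su _; exact: le_trans su.
  - have tu : t <= u by case/andP: ut.
    have su := le_trans st tu.
    apply: (le_trans (nrmM _ _)).
    apply: (le_trans (ler_pM (nrm_ge0 _) (nrm_ge0 _) (hA u s xi (Zhyp_le su Z)) (hQ u s xi Z su))).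
    lra.
have /choice[Qoo hQoo] (sx : R * 'rV[R]_n) := K sx.1 sx.2.
exists (fun s xi => Qoo (s, xi)); split; last first.
  exists (8 * (CA * CQ)); first by rewrite !mulr_ge0.
  by move=> t s xi Z st; have := hQoo (s, xi) Z t st; rewrite /=; lra.
move=> s xi Z; have {}hQoo := hQoo (s, xi) Z; rewrite /= in hQoo.
have s0 := Zhyp_ge0 Z; have x0 := Zhyp_gt0 Z.
(* At time t = s + a the distance to the limit times the bound on Q^-1 is a/(1 + s + a) < 1, close
   enough for a Neumann type argument: v Qoo = 0 forces v = v (Q - Qoo) Q^-1. *)
pose a := 8 * (CA * CQ * (enorm xi)^-1) * CV.
have a0 : 0 <= a by rewrite !mulr_ge0 // invr_ge0 ltW.
pose t := s + a; have st : s <= t by rewrite lerDl.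
have [Qu Qi] := hV t s xi Z st.
have small : nrm (Qmx t s xi - Qoo (s, xi)) * nrm (invmx (Qmx t s xi)) < 1.
  apply: (@le_lt_trans _ _ (8 * (CA * CQ * ((enorm xi)^-1 * (1 + t)^-1)) * CV)).
    by apply: ler_pM; rewrite ?nrm_ge0 // hQoo.
  have t1 : 0 < 1 + t by rewrite ltr_pwDl // (le_trans s0).
  rewrite (_ : _ * CV = a / (1 + t)); last by rewrite /a; ring.
  by rewrite ltr_pdivrMr // mul1r /t addrA ltrDr ltr_pwDl.
rewrite -row_free_unit; apply: inj_row_free => v vQ.
(* The row v is repeated because [nrm] is defined on square matrices. *)
pose V : M2 := \matrix_(p, q) v ord0 q.
have VQ : V *m Qoo (s, xi) = 0.
  apply/matrixP => p q; move/rowP: vQ => /(_ q); rewrite !mxE => vQ.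
  by rewrite -[RHS]vQ; apply: eq_bigr => k _; rewrite mxE.
have VE : V = V *m ((Qmx t s xi - Qoo (s, xi)) *m invmx (Qmx t s xi)).
  by rewrite mulmxBl mulmxBr mulmxV // mulmxA VQ mul0mx subr0 mulmx1.
have V0 : V = 0.
  apply: nrm_eq0; apply/eqP; rewrite eq_le nrm_ge0 andbT leNgt; apply/negP => Vn.
  have : nrm V < nrm V; last by rewrite ltxx.
  rewrite {1}VE; apply: (le_lt_trans (nrmM _ _)).
  rewrite -[ltRHS]mulr1 ltr_pM2l //.
  exact: le_lt_trans (nrmM _ _) small.
apply/rowP => q; move/matrixP: V0 => /(_ ord0 q).
by rewrite !mxE.
Qed.

End Transformed.

(** * Derivatives of the amplitude in the frequency *)

Section AmplitudeSymbol.
Variables (R : realType) (n l j : nat) (b m : R -> R) (N CI : R).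
Local Notation M2 := 'M[R[i]]_2.
Local Notation X := (R * R * 'rV[R]_n)%type.
Variable E : R -> R -> 'rV[R]_n -> M2.
Hypotheses (hb : tcl l 1 b) (hm : tcl l 2 m) (hjl : (j.+1 <= l)%N) (N0 : 0 < N).
Hypothesis hNu : forall (t : R) (xi : 'rV[R]_n), Zhyp N t xi ->
  Nmx b m j.+1 t xi \in unitmx.
Hypothesis hNi : forall (t : R) (xi : 'rV[R]_n), Zhyp N t xi ->
  nrm (invmx (Nmx b m j.+1 t xi)) <= CI.
Hypothesis hE : forall (s : R) (xi : 'rV[R]_n), Zhyp N s xi ->
     fundamental_solution s
       (fun t => Dmx xi + Fpred b m j.+1 t xi + Rk b m j.+1 t xi)
       (fun t => E t s xi).
Variables (O : set X) (sx : X -> R).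
Hypothesis OZ : forall x, O x -> Zhyp N (sx x) x.2.
Hypothesis sxt : forall x, O x -> sx x <= x.1.1.
Local Notation symb := (symb (@mvx R n) O).
Local Notation rho := (fun (_ : R) (x : X) => (enorm x.2)^-1).
Local Notation I01 := [set z : R | 0 <= z <= 1].
Hypothesis sxS : forall J, symb J rho (fun _ x => 1 + sx x) (fun _ x => (1 + sx x)%:C%:M).
Local Notation tau := (itime sx).
Local Notation e := (l - j.+1)%N.

Let O_gt0 x : O x -> 0 < enorm x.2. Proof. by move/OZ/(Zhyp_gt0 N0). Qed.
Let sx0 x : O x -> 0 <= sx x. Proof. by move/OZ/Zhyp_ge0. Qed.
Let sxN x : O x -> N <= (1 + sx x) * enorm x.2. Proof. by move/OZ=> []. Qed.
Let t_ge0 := tau_ge0 sx0 sxt.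
Let t_gt0 := tau_gt0 sx0 sxt.
Let tN := tauN sxt sxN.

Let tZ s x : 0 <= s <= 1 -> O x -> Zhyp N (tau s x) x.2.
Proof. by move=> s01 Ox; split; [exact: t_ge0|exact: tN]. Qed.

Let symbP J p q L F := @symb_gsym R n O sx N N0 O_gt0 sx0 sxt sxN sxS J L p q F.

Definition phi (s : R) (x : X) : R := phs (tau s x) (sx x) x.2.

Lemma symb_phi J :
  symb J rho (fun s x => (1 + tau s x) * enorm x.2) (fun s x => (phi s x)%:C%:M).
Proof.
have h : symb J rho (fun s x => 1 + tau s x) (fun s x => (tau s x - sx x)%:C%:M).
  apply: (@symb_ext _ _ _ _ _ _ _ _ (fun s x => (1 + tau s x)%:C%:M - (1 + sx x)%:C%:M)).
    move=> s x _ _; rewrite -raddfB /= -rmorphB /=.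
    by congr (_%:C%:M); ring.
  apply: symbD; first exact: symb_tau.
  apply: symbN; apply: symb_wle (sxS J); exists 1 => // s x s01 Ox.
  by rewrite mul1r lerD2l; case/andP: (tau_bnd sxt s01 Ox).
apply: symb_ext (symbM h (symb_enorm O_gt0 J)) => s x _ _.
by rewrite -scalar_mxM -rmorphM.
Qed.

Lemma symb_Ph J : symb J (fun s x => 1 + tau s x) (fun _ _ => 1) (fun s x => Ph (phi s x)).
Proof. by apply: (symb_phase N0 O_gt0 sx0 sxt sxN); exact: symb_phi. Qed.

Lemma symb_PhN J :
  symb J (fun s x => 1 + tau s x) (fun _ _ => 1) (fun s x => Ph (- phi s x)).
Proof.
apply: (symb_phase N0 O_gt0 sx0 sxt sxN (phi := fun s x => - phi s x)).
apply: symb_ext (symbN (symb_phi J)) => s x _ _.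
by rewrite -raddfN /= -rmorphN.
Qed.

Lemma symb_Nmx J : (J.+1 <= e)%N ->
  symb J rho (fun _ _ => 1) (fun s x => Nmx b m j.+1 (tau s x) x.2).
Proof.
move=> Je; have [hN _ _ _] := NF_struct n hb hm (subnKC hjl).
apply: (@symb_ext _ _ _ _ _ _ _ _
  (fun s x => (Nmx b m j.+1 (tau s x) x.2 - 1%:M) + 1%:M)).
  by move=> s x _ _; rewrite subrK.
apply: symbD; last exact: symb_cst1.
apply: symb_wle (symbP (leqW Je) hN); exists N^-1; first by rewrite invr_ge0 ltW.
move=> s x s01 Ox; rewrite addn0 !expr1 mulr1 -invfM mulrC.
by rewrite lef_pV2 ?posrE ?mulr_gt0 ?t_gt0 ?O_gt0 ?tN.
Qed.

Lemma symb_Rk J : (J.+1 <= e)%N ->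
  symb J rho (fun s x => (enorm x.2)^-1 ^+ j.+1 * (1 + tau s x)^-1 ^+ j.+2)
    (fun s x => Rk b m j.+1 (tau s x) x.2).
Proof.
move=> Je; have [_ _ _ hB] := NF_struct n hb hm (subnKC hjl).
apply: symbN; apply: symb_eqw (symbM (w1 := fun _ _ => 1) _ (symbP Je hB)).
  by move=> s x; rewrite mul1r addn1.
apply: (symb_inv _ _ _ _ _ _ (symb_Nmx Je)).
- by move=> s x s01 Ox; apply: hNu; exact: tZ.
- exists (Num.max 0 CI); first by rewrite le_max lexx.
  move=> s x s01 Ox; rewrite mulr1; apply: (le_trans (hNi (tZ s01 Ox))).
  by rewrite le_max lexx orbT.
- by exists 1 => // s x _ _; rewrite mulr1.
- by move=> s x _ Ox; rewrite invr_ge0 (ltW (O_gt0 Ox)).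
- by move=> x Ox; exists 1.
- by move=> i x Ox; exists 1, 1; split.
Qed.

(** The bound |xi|^-1 (1 + t')^-2 for A, times 1 + t for the factor t - s that comes from
    differentiating t' in the new time variable. *)
Definition aw (s : R) (x : X) : R := (1 + x.1.1) * ((enorm x.2)^-1 * (1 + tau s x)^-1 ^+ 2).

Definition AA (s : R) (x : X) : M2 :=
  (x.1.1 - sx x)%:C *: Amx j b m (tau s x) (sx x) x.2.

Let inv_ge0 s x : 0 <= s <= 1 -> O x ->
  [/\ 0 <= (enorm x.2)^-1, 0 <= (1 + tau s x)^-1 & 0 <= 1 + tau s x].
Proof.
move=> s01 Ox; have h1 := O_gt0 Ox; have h2 := t_gt0 s01 Ox.
by rewrite !invr_ge0 !ltW.
Qed.

Lemma symb_conj J : (J.+1 <= e)%N -> (J <= j)%N ->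
  symb J rho (fun s x => (enorm x.2)^-1 * (1 + tau s x)^-1 ^+ 2)
   (fun s x => Ph (- phi s x) *m Rk b m j.+1 (tau s x) x.2 *m Ph (phi s x)).
Proof.
move=> Je Jj.
have hR := symb_cost N0 O_gt0 sx0 sxt sxN _ (symb_Rk Je).
have {}hR := symbM (symbM (symb_PhN J) (hR _)) (symb_Ph J).
apply: symb_weight (hR _) => [i iJ|s x s01 Ox]; last first.
  by have [h1 h2 h3] := inv_ge0 s01 Ox; rewrite mulr_ge0 // exprn_ge0.
have ij : (i <= j)%N by exact: leq_trans Jj.
(* Write T = 1 + t'. The weight of R_k is |xi|^-1 T^-2 times j factors (|xi| T)^-1. Against the loss
   T^i of i derivatives, i of these leave |xi|^-i, and the other j - i are at most 1/N each. *)
exists (N^-1 ^+ (j - i)); first by rewrite exprn_ge0 // invr_ge0 ltW.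
move=> s x s01 Ox; have [h1 h2 h3] := inv_ge0 s01 Ox.
have := @zhyp_pow _ N (tau s x) (enorm x.2) i j 2 N0 (t_ge0 s01 Ox) (O_gt0 Ox)
  (tN s01 Ox) ij.
have tt : (1 + tau s x)^-1 ^+ i * (1 + tau s x) ^+ i = 1.
  by rewrite -exprMn mulVf ?expr1n // gt_eqF // t_gt0.
have ji : (j = i + (j - i))%N by rewrite subnKC.
move=> h; have := ler_wpM2r (mulr_ge0 h1 (exprn_ge0 i h3)) h.
set c := N^-1 ^+ (j - i); set u := 1 + tau s x in tt *; set v := (enorm x.2)^-1.
have -> : u^-1 ^+ (j + 2) * v ^+ j * (v * u ^+ i) =
    1 * (v ^+ j.+1 * u^-1 ^+ j.+2) * 1 * u ^+ i.
  by rewrite addn2 [v ^+ j.+1]exprS; ring.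
have -> // : c * (v ^+ i * u^-1 ^+ (i + 2)) * (v * u ^+ i) = c * (v * u^-1 ^+ 2 * v ^+ i).
rewrite [u^-1 ^+ (i + 2)]exprD.
rewrite (_ : c * _ * _ = c * (v * u^-1 ^+ 2 * v ^+ i) * (u^-1 ^+ i * u ^+ i)); last by ring.
by rewrite tt mulr1.
Qed.

Lemma symb_AA J : (J.+1 <= e)%N -> (J <= j)%N -> symb J rho aw AA.
Proof.
move=> Je Jj.
have hP := symbP (leqW Je) (PP_gsym n hb hm hjl).
have h := symbM (symb_dt sx0 sxt sxS J) (symbZ 'i (symbD hP (symb_conj Je Jj))).
by apply: symb_ext h => s x _ _; rewrite mul_scalar_mx.
Qed.

Definition yy (s : R) (x : X) : M2 := Qmx b E (tau s x) (sx x) x.2.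

Lemma rder_tau A s x : rder A (fun s => tau s x) s (x.1.1 - sx x).
Proof.
have := rderD (rder_cst A (sx x) s) (rderM (@rder_id R A s) (rder_cst A (x.1.1 - sx x) s)).
by rewrite add0r mul1r mulr0 addr0.
Qed.

Lemma yy_ode s x : 0 <= s <= 1 -> O x -> mder I01 (yy^~ x) s (AA s x *m yy s x).
Proof.
move=> s01 Ox.
have st : sx x <= tau s x by case/andP: (tau_bnd sxt s01 Ox).
have := mder_comp _ (rder_tau I01 s x) (Qmx_ode hb hm hjl hE (OZ Ox) st).
rewrite /AA -scalemxAl; apply=> z /= z01; rewrite in_itv /= andbT.
by case/andP: (tau_bnd sxt z01 Ox).
Qed.

(* [pw] is a primitive of [aw] in [s], bounded by 1/N. *)
Definition pw (s : R) (x : X) : R :=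
  (1 + x.1.1) * (enorm x.2)^-1 * (1 + sx x)^-1 * (s * (1 + tau s x)^-1).

Lemma rder_pw s x : 0 <= s <= 1 -> O x -> rder I01 (pw^~ x) s (aw s x).
Proof.
move=> s01 Ox.
have h0 z : I01 z -> (`[0, +oo[%classic : set R) (tau z x).
  by move=> z01; rewrite /= in_itv /= andbT t_ge0.
have h1 := rder_comp h0 (rder_tau I01 s x) (rder_inv1 (t_ge0 s01 Ox)).
have := rderZ ((1 + x.1.1) * (enorm x.2)^-1 * (1 + sx x)^-1)
  (rderM (@rder_id R I01 s) h1).
congr rder; rewrite /aw.
have t1 := t_gt0 s01 Ox; have s1 : 0 < 1 + sx x by rewrite ltr_pwDl // sx0.
have e1 := O_gt0 Ox.
have hT : 1 + sx x = 1 + tau s x - s * (x.1.1 - sx x) by rewrite /itime; ring.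
have key : 1 * (1 + tau s x)^-1 + s * (- (1 + tau s x)^-1 ^+ 2 * (x.1.1 - sx x)) =
    (1 + sx x) * (1 + tau s x)^-1 ^+ 2.
  by rewrite hT; move: t1; set T := 1 + tau s x => t1; field; rewrite gt_eqF.
rewrite [X in _ * X]key; move: (_ ^+ 2) => u.
by field; rewrite !gt_eqF.
Qed.

(** [symb_ode] with zero source and kappa = 1, where Q plays both the solution and the fundamental
    solution [Phi]; the primitive [pw] supplies the constant [Cp] = 1/N. *)
Lemma symb_yy J : (J.+1 <= e)%N -> (J <= j)%N -> symb J rho (fun _ _ => 1) yy.
Proof.
move=> Je Jj.
have [CV CV0 hV] := Qmx_unit hb hm hjl N0 hNi hE.
have y0 x : yy 0 x = Qmx b E (sx x) (sx x) x.2 by rewrite /yy /itime mul0r addr0.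
have y1 x : O x -> yy 0 x = 1%:M by move=> Ox; rewrite y0 (Qmx_diag hE (OZ Ox)).
(* Set to I outside [O], so that the initial value is I at every point and moves leave it
   unchanged. *)
pose y (s : R) (x : X) : M2 := if asbool (O x) then yy s x else 1%:M.
have yE s x : O x -> y s x = yy s x by move=> Ox; rewrite /y asboolT.
apply: (@symb_ext _ _ _ _ _ _ _ _ y) => [s x _ Ox|]; first exact: yE.
have HA := symb_AA Je Jj.
have Hy s x : 0 <= s <= 1 -> O x -> mder I01 (y^~ x) s (AA s x *m y s x).
  by move=> s01 Ox; rewrite yE //; apply: mder_ext (yy_ode s01 Ox) => // z _; rewrite yE.
have yi0 x : y 0 x = 1%:M.
  by rewrite /y; case: asboolP => // Ox; exact: y1.
have k0 (x : X) : O x -> 0 <= (1 : R) by [].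
have r0 x : O x -> 0 <= (enorm x.2)^-1 by move=> Ox; rewrite invr_ge0 ltW // O_gt0.
have a0 s x : 0 <= s <= 1 -> O x -> 0 <= aw s x.
  move=> s01 Ox; have [h1 h2 h3] := inv_ge0 s01 Ox.
  by rewrite /aw !mulr_ge0 ?exprn_ge0 // addr_ge0 // (le_trans (sx0 Ox)) // sxt.
have pC s x : 0 <= s <= 1 -> O x -> pw s x - pw 0 x <= N^-1.
  move=> s01 Ox; have [h1 h2 h3] := inv_ge0 s01 Ox; have [s0 s1] := andP s01.
  rewrite /pw mul0r mulr0 subr0.
  have t1 := t_gt0 s01 Ox; have sx1 : 0 < 1 + sx x by rewrite ltr_pwDl // sx0.
  have e1 := O_gt0 Ox.
  apply: (@le_trans _ _ ((enorm x.2)^-1 * (1 + sx x)^-1)).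
    have e5 (u v w z : R) : u * v * w * (s * z) = v * w * (u * s * z) by ring.
    rewrite e5.
    have h4 : 0 <= (enorm x.2)^-1 * (1 + sx x)^-1 by rewrite mulr_ge0 // invr_ge0 ltW.
    have h5 : (1 + x.1.1) * s / (1 + tau s x) <= 1.
      rewrite ler_pdivrMr // mul1r /itime.
      have : 0 <= (1 - s) * (1 + sx x) by rewrite mulr_ge0 ?subr_ge0 // ltW.
      lra.
    by rewrite ler_piMr.
  by rewrite -invfM lef_pV2 ?posrE ?mulr_gt0 // mulrC sxN.
have yV s x : 0 <= s <= 1 -> O x -> y s x \in unitmx /\ nrm (invmx (y s x)) <= CV.
  move=> s01 Ox; rewrite yE //; apply: (hV _ _ _ (OZ Ox)).
  by case/andP: (tau_bnd sxt s01 Ox).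
have Hg : symb J rho (fun s x => aw s x * 1) (fun _ _ => 0).
  apply: symb_cst; [|exact: lip_cst|by []].
  by exists 0 => [|s x s01 Ox]; rewrite // nrm0 mul0r.
have Hy0 s x : 0 <= s <= 1 -> O x -> mder I01 (y^~ x) s (AA s x *m y s x + 0).
  by move=> s01 Ox; rewrite addr0; exact: Hy.
have yu s x (s01 : 0 <= s <= 1) (Ox : O x) : y s x \in unitmx := (yV s x s01 Ox).1.
have yi x : O x -> exists2 B, 0 <= B & forall s, 0 <= s <= 1 -> nrm (invmx (y s x)) <= B.
  by move=> Ox; exists CV => // s s01; have [] := yV s x s01 Ox.
have ym i h x : y 0 (mvx i h x) = y 0 x by rewrite !yi0.
have yb : exists2 C, 0 <= C & forall x, O x -> nrm (y 0 x) <= C * 1.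
  by exists 2 => // x Ox; rewrite yi0 nrm1 mulr1.
exact: (symb_ode r0 a0 rder_pw pC Hy (fun x _ => yi0 x) yu yi k0 HA Hg Hy0 ym yb).
Qed.

End AmplitudeSymbol.

(** * From symbol families to the derivatives of the statement *)

Section Transfer.
Variables (R : realType) (n : nat).
Local Notation M2 := 'M[R[i]]_2.
Local Notation X := (R * R * 'rV[R]_n)%type.
Implicit Types (O A : set X) (rho w : R -> X -> R) (f g : R -> X -> M2).
Local Notation mv := (@mvx R n).

Lemma lip_glue O A f : lip (O `&` A) f -> lip (O `\` A) f -> lip O f.
Proof.
move=> H1 H2 x Ox; have [Ax|nAx] := pselect (A x).
  exact: H1 x (conj Ox Ax).
exact: H2 x (conj Ox nAx).
Qed.

Lemma bnd_glue O A w f : (forall s x, 0 <= s <= 1 -> O x -> 0 <= w s x) ->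
  bnd (O `&` A) w f -> bnd (O `\` A) w f -> bnd O w f.
Proof.
move=> w0 [C1 C10 h1] [C2 C20 h2]; exists (C1 + C2); first exact: addr_ge0.
move=> s x s01 Ox; rewrite mulrDl; have wx := w0 s x s01 Ox.
have [Ax|nAx] := pselect (A x).
  by apply: (le_trans (h1 s x s01 (conj Ox Ax))); rewrite lerDl mulr_ge0.
by apply: (le_trans (h2 s x s01 (conj Ox nAx))); rewrite lerDr mulr_ge0.
Qed.

Lemma dquad_glue O A i f g :
  (forall x, O x -> exists2 e, 0 < e & forall h, `|h| < e -> O (mv i h x) ->
     (A (mv i h x) <-> A x)) ->
  dquad mv (O `&` A) i f g -> dquad mv (O `\` A) i f g -> dquad mv O i f g.
Proof.
move=> HA H1 H2 x Ox; have [e e0 he] := HA x Ox.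
have [Ax|nAx] := pselect (A x).
  have [K [e' [K0 e0' h]]] := H1 x (conj Ox Ax).
  exists K, (Num.min e e'); split=> //; first by rewrite lt_min e0.
  move=> s d s01; rewrite lt_min => /andP[de de'] Od; apply: h => //.
  by split=> //; apply/(he d de Od).
have [K [e' [K0 e0' h]]] := H2 x (conj Ox nAx).
exists K, (Num.min e e'); split=> //; first by rewrite lt_min e0.
move=> s d s01; rewrite lt_min => /andP[de de'] Od; apply: h => //.
by split=> // /(he d de Od).
Qed.

(** Remainders are local: small moves within [O] neither enter nor leave [A], so the derivatives
    found on the two pieces combine into one. *)
Lemma symb_glue O A J rho w f :
  (forall x i, O x -> exists2 e, 0 < e & forall h, `|h| < e -> O (mv i h x) ->
     (A (mv i h x) <-> A x)) ->
  (forall s x, 0 <= s <= 1 -> O x -> 0 <= w s x /\ 0 <= rho s x) ->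
  symb mv (O `&` A) J rho w f -> symb mv (O `\` A) J rho w f -> symb mv O J rho w f.
Proof.
move=> HA; elim: J w f => [|J IH] w f w0 H1 H2.
all: have w1 s x : 0 <= s <= 1 -> O x -> 0 <= w s x by move=> s01 Ox; case: (w0 s x s01 Ox).
all: have B := bnd_glue w1 (symb_bnd H1) (symb_bnd H2).
all: have L := lip_glue (symb_lip H1) (symb_lip H2).
all: split=> // i.
have [_ _ /(_ i)[g1 k1 k2]] := H1; have [_ _ /(_ i)[g2 k3 k4]] := H2.
pose g s x := if asbool (A x) then g1 s x else g2 s x.
have e1 s x : 0 <= s <= 1 -> (O `&` A) x -> g1 s x = g s x.
  by move=> _ [_ Ax]; rewrite /g asboolT.
have e2 s x : 0 <= s <= 1 -> (O `\` A) x -> g2 s x = g s x.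
  by move=> _ [_ Ax]; rewrite /g asboolF.
exists g.
  apply: (dquad_glue (HA^~ i)).
    move=> x Ox; have [K [e [K0 e0 h]]] := k1 x Ox; exists K, e; split=> // s d s01 de Od.
    by rewrite -e1 //; exact: h.
  move=> x Ox; have [K [e [K0 e0 h]]] := k3 x Ox; exists K, e; split=> // s d s01 de Od.
  by rewrite -e2 //; exact: h.
apply: IH; [|exact: symb_ext e1 k2|exact: symb_ext e2 k4].
by move=> s x s01 Ox; have [? ?] := w0 s x s01 Ox; rewrite mulr_ge0.
Qed.

Definition slice O (t s : R) : set 'rV[R]_n := [set xi | O ((t, s), xi)].

Lemma line0 (xi : 'rV[R]_n) i : line xi i 0 = xi.
Proof. by rewrite /line scale0r addr0. Qed.

(** At s = 1 the interpolated time is t, so f 1 will be the amplitude itself. The quadratic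
    remainder gives the derivative along a coordinate line, and accumulation identifies it with
    [Dxi1], the factor -i included. *)
Lemma symb_Dxi O J rho w f (sq : seq 'I_n) :
  (forall t s xi i, O ((t, s), xi) -> accum (line xi i @^-1` slice O t s) 0) ->
  (size sq <= J)%N -> symb mv O J rho w f ->
  exists2 g, symb mv O (J - size sq) rho (fun s x => w s x * rho s x ^+ size sq) g &
    forall t s, derivable_seq (slice O t s) sq (fun xi => f 1 ((t, s), xi)) /\
      forall xi, slice O t s xi ->
        Dxi_seq (slice O t s) sq (fun xi => f 1 ((t, s), xi)) xi = g 1 ((t, s), xi).
Proof.
move=> Hacc; elim: sq => [|i sq IH] /= sJ Hf.
  exists f; first by rewrite subn0; apply: symb_eqw Hf => s x; rewrite expr0 mulr1.
  by [].
have [g Hg hg] := IH (ltnW sJ) Hf.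
move: Hg; have -> : (J - size sq = (J - (size sq).+1).+1)%N by rewrite subnSK.
case=> _ _ /(_ i)[g' hd hg'].
exists (fun s x => - 'i *: g' s x).
  apply: symbZ; apply: symb_eqw hg' => s x; by rewrite exprSr mulrA.
move=> t s; have [h1 h2] := hg t s.
have K xi : slice O t s xi -> mder (line xi i @^-1` slice O t s)
    (Dxi_seq (slice O t s) sq (fun xi => f 1 ((t, s), xi)) \o line xi i) 0
    (g' 1 ((t, s), xi)).
  move=> Oxi; have [C [e [C0 e0 h]]] := hd ((t, s), xi) Oxi.
  apply: (mder_quad e0 C0) => x /= Ox; rewrite subr0 => xe.
  rewrite line0 !h2 //; apply: h => //.
  by rewrite ler01 lexx.
split=> [|xi Oxi]; first (split=> // xi Oxi).
  by have [] := mder_Dt (Hacc t s xi i Oxi) (K xi Oxi).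
by have [_ <-] := mder_Dt (Hacc t s xi i Oxi) (K xi Oxi).
Qed.

Lemma size_directions (alpha : multi_index n) : size (directions alpha) = mlen alpha.
Proof.
rewrite /directions size_flatten /shape -map_comp sumnE big_map big_enum /=.
by apply: eq_bigr => i _; rewrite size_nseq.
Qed.

End Transfer.

Section Final.
Variables (R : realType) (n : nat).
Local Notation M2 := 'M[R[i]]_2.
Local Notation X := (R * R * 'rV[R]_n)%type.
Local Notation rho := (fun (_ : R) (x : X) => (enorm x.2)^-1).

(** On each coordinate line one of the two senses does not decrease |xi|. The sets used below
    contain the nearby frequencies of no smaller norm, so boundary points of the zone are
    covered. *)
Lemma accum_line (S : set 'rV[R]_n) xi i :
  (exists2 e, 0 < e & forall xi', enorm xi <= enorm xi' ->
     `|enorm xi' - enorm xi| < e -> S xi') ->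
  accum (line xi i @^-1` S) 0.
Proof.
move=> [e e0 he] d d0.
pose c := Num.min e d / 2.
have c0 : 0 < c by rewrite divr_gt0 // lt_min e0.
have ce : c < e by rewrite ltr_pdivrMr // gt_min ltr_pMr // ltr1n.
have cd : c < d by rewrite ltr_pdivrMr // gt_min [X in _ || X]ltr_pMr // ltr1n orbT.
have [h h0 hx] : exists2 h, `|h| = c & 0 <= h * xi ord0 i.
  have [x0|/ltW x0] := leP 0 (xi ord0 i).
    by exists c; [rewrite gtr0_norm|rewrite mulr_ge0 // ltW].
  by exists (- c); [rewrite normrN gtr0_norm|rewrite mulNr -mulrN mulr_ge0 ?oppr_ge0 // ltW].
exists h; split; first by rewrite -normr_gt0 h0.
  by rewrite h0.
rewrite /= add0r; apply: he.
  rewrite -ler_sqr ?nnegrE ?enorm_ge0 // enorm_line.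
  by have := sqr_ge0 h; lra.
by apply: (le_lt_trans (enorm_line_dist _ _ _)); rewrite h0.
Qed.

Lemma itime1 (sx : X -> R) x : itime sx 1 x = x.1.1.
Proof. by rewrite /itime; ring. Qed.

(** Off the sphere |xi| = N, 1 + theta is N/|xi| on one side and 1 on the other, and the side does
    not change under small moves. *)
Lemma symb_theta (O : set X) N J : 0 < N ->
  (forall x, O x -> 0 < enorm x.2 /\ enorm x.2 <> N) ->
  symb (@mvx R n) O J rho (fun _ x => 1 + theta N (enorm x.2))
    (fun _ x => (1 + theta N (enorm x.2))%:C%:M).
Proof.
move=> N0 HO; pose A : set X := [set x | enorm x.2 < N].
have th0 x : O x -> 0 <= theta N (enorm x.2).
  move=> /HO[x0 _]; rewrite /theta; case: ifPn => // h.
  by rewrite subr_ge0 ler_pdivlMr // mul1r.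
apply: (@symb_glue R n O A).
- move=> x i Ox; have [x0 xN] := HO x Ox.
  exists `|enorm x.2 - N|; first by rewrite normr_gt0 subr_eq0; apply/eqP.
  move=> h hh _; have := enorm_line_dist x.2 i h; rewrite /A /mvx /=.
  move: (enorm (line _ _ _)) => y yx.
  have {}yx := le_lt_trans yx hh; move: yx.
  have [xN'|xN'] := ltP (enorm x.2) N.
    rewrite (ltr0_norm (_ : _ - N < 0)) ?subr_lt0 // ltr_norml => /andP[k1 k2].
    by split=> // _; lra.
  rewrite (ger0_norm (_ : 0 <= _ - N)) ?subr_ge0 // ltr_norml => /andP[k1 k2].
  by split=> // ?; lra.
- move=> s x _ Ox; have [x0 _] := HO x Ox.
  by rewrite invr_ge0 (ltW x0) addr_ge0 // th0.
- have O0 x : (O `&` A) x -> 0 < enorm x.2 by move=> [/HO[]].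
  have th x : (O `&` A) x -> 1 + theta N (enorm x.2) = N / enorm x.2.
    by move=> [_ /ltW Ax]; rewrite /theta Ax addrC subrK.
  apply: symb_ext (symb_weight _ (symbZ N%:C (symb_enormV O0 J))).
    move=> s x _ Ox; rewrite th // scale_scalar_mx.
    by rewrite (rmorphM (real_complex R)).
  move=> i _; exists N^-1; first by rewrite invr_ge0 ltW.
  by move=> s x _ Ox; rewrite th // !mulrA mulVf ?mul1r // gt_eqF.
have th x : (O `\` A) x -> 1 + theta N (enorm x.2) = 1.
  move=> [/HO[_ xN] /negP]; rewrite -leNgt => Ax; rewrite /theta ifN ?addr0 //.
  by rewrite -ltNge lt_neqAle Ax andbT eq_sym; apply/eqP.
apply: (@symb_ext _ _ _ _ _ _ _ _ (fun _ _ => 1%:M)) => [s x _ Ox|].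
  by rewrite th.
by apply: symb_cst1 => s x _ Ox; rewrite th.
Qed.

Lemma compact_enorm_ge (K : set 'rV[R]_n) : compact K -> ~ K 0 ->
  exists2 d, 0 < d & forall xi, K xi -> d <= enorm xi.
Proof.
move=> cK K0.
have : open (~` K).
  by apply: closed_openC; apply: compact_closed => //; exact: norm_hausdorff.
rewrite openE => /(_ 0 K0) /nbhs_ballP[d /= d0 hd].
exists d => // xi Kxi; rewrite leNgt; apply/negP => xd.
apply: (hd xi) => //=; rewrite /ball /= /mx_ball; split=> // i j.
rewrite ord1 /ball /= mxE sub0r normrN.
exact: le_lt_trans (entry_le_enorm _ _) xd.
Qed.

End Final.

Lemma symb_amplitude_Dxi (R : realType) (n l j : nat) (b m : R -> R) (N CI : R)
  (E : R -> R -> 'rV[R]_n -> 'M[R[i]]_2)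
  (O : set (R * R * 'rV[R]_n)) (sx : R * R * 'rV[R]_n -> R) (alpha : multi_index n) :
  tcl l 1 b -> tcl l 2 m -> (j.+1 <= l)%N -> 0 < N ->
  (forall (t : R) (xi : 'rV[R]_n), Zhyp N t xi -> Nmx b m j.+1 t xi \in unitmx) ->
  (forall (t : R) (xi : 'rV[R]_n), Zhyp N t xi ->
    nrm (invmx (Nmx b m j.+1 t xi)) <= CI) ->
  (forall (s : R) (xi : 'rV[R]_n), Zhyp N s xi ->
     fundamental_solution s
       (fun t => Dmx xi + Fpred b m j.+1 t xi + Rk b m j.+1 t xi)
       (fun t => E t s xi)) ->
  (forall x, O x -> Zhyp N (sx x) x.2) -> (forall x, O x -> sx x <= x.1.1) ->
  (forall J, symb (@mvx R n) O J (fun _ x => (enorm x.2)^-1) (fun _ x => 1 + sx x)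
     (fun _ x => (1 + sx x)%:C%:M)) ->
  (forall t s xi i, O ((t, s), xi) -> accum (line xi i @^-1` slice O t s) 0) ->
  (mlen alpha <= j)%N -> (mlen alpha < l - j.+1)%N ->
  exists C : R, forall t s : R,
    has_Dxi (slice O t s) alpha (fun xi => Qmx b E t (sx ((t, s), xi)) xi) /\
    forall xi, slice O t s xi ->
      mxnorm (Dxi (slice O t s) alpha (fun xi => Qmx b E t (sx ((t, s), xi)) xi) xi)
      <= C * enorm xi ^- mlen alpha.
Proof.
move=> hb hm hjl N0 hNu hNi hE OZ sxt sxS Oacc aj al.
have Hy := symb_yy hb hm hjl N0 hNu hNi hE OZ sxt sxS al aj.
have sa : (size (directions alpha) <= mlen alpha)%N by rewrite size_directions.
have [g Hg hg] := symb_Dxi Oacc sa Hy.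
have [C C0 hC] := symb_bnd Hg; exists C => t s.
have [h1 h2] := hg t s.
have e1 : (fun xi => Qmx b E t (sx ((t, s), xi)) xi) = (fun xi => yy b E sx 1 ((t, s), xi)).
  by apply/funext => xi; rewrite /yy itime1.
rewrite e1; split; first exact: h1.
move=> xi Oxi; apply: (le_trans (mxnorm_le_nrm _)); rewrite /Dxi (h2 xi Oxi).
by have := hC 1 ((t, s), xi); rewrite lexx ler01 /= size_directions mul1r exprVn; apply.
Qed.

Theorem theorem2p5 (R : realType) (n l k : nat) (b m : R -> R) (N : R)
  (E : R -> R -> 'rV[R]_n -> 'M[R[i]]_2)
  (hl : (1 <= l)%N) (hk1 : (1 <= k)%N) (hkl : (k <= l)%N)
  (hb : class_C `[0, +oo[ l b) (hm : class_C `[0, +oo[ l m)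
  (hb_decay : forall j : nat, (j <= l)%N -> exists C : R, forall t : R, 0 <= t ->
     `|derive_in_n `[0, +oo[ j b t| <= C * (1 + t) ^- j.+1)
  (hm_decay : forall j : nat, (j <= l)%N -> exists C : R, forall t : R, 0 <= t ->
     `|derive_in_n `[0, +oo[ j m t| <= C * (1 + t) ^- j.+2)
  (hN : 0 < N)
  (hNk : forall (t : R) (xi : 'rV[R]_n), Zhyp N t xi ->
     Nmx b m k t xi \in unitmx)
  (hNkinv : symbol_class N (l - k + 1) 0 0
     (fun (t : R) (xi : 'rV[R]_n) => invmx (Nmx b m k t xi)))
  (hE : forall (s : R) (xi : 'rV[R]_n), Zhyp N s xi ->
     fundamental_solution s
       (fun t => Dmx xi + Fpred b m k t xi + Rk b m k t xi)
       (fun t => E t s xi)) :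
  exists Q : R -> R -> 'rV[R]_n -> 'M[R[i]]_2,
    (forall (t s : R) (xi : 'rV[R]_n), Zhyp N s xi -> s <= t ->
       E t s xi = (lambda b s / lambda b t)%:C *: (E0mx t s xi *m Q t s xi)) /\
    (forall (s : R) (xi : 'rV[R]_n), xi != 0 ->
       fundamental_solution s (fun _ => Dmx xi) (fun t => E0mx t s xi)) /\
    (forall alpha : multi_index n,
       (mlen alpha + 1 <= k)%N -> (mlen alpha + k + 1 <= l)%N ->
       (exists C : R, forall t s : R, 0 <= s -> s <= t ->
          has_Dxi (Zhyp N s) alpha (Q t s) /\
          forall xi : 'rV[R]_n, xi != 0 -> theta N (enorm xi) <= s ->
            mxnorm (Dxi (Zhyp N s) alpha (Q t s) xi)
            <= C * enorm xi ^- mlen alpha) /\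
       (exists C : R, forall t : R, 0 <= t ->
          let O := Zhyp N t `\` [set xi | (0 < mlen alpha)%N /\ enorm xi = N] in
          let Qtheta := fun xi => Q t (theta N (enorm xi)) xi in
          has_Dxi O alpha Qtheta /\
          forall xi : 'rV[R]_n, O xi ->
            mxnorm (Dxi O alpha Qtheta xi) <= C * enorm xi ^- mlen alpha)) /\
    (forall (t s : R) (xi : 'rV[R]_n), Zhyp N s xi -> s <= t ->
       Q t s xi \in unitmx) /\
    (exists Qoo : R -> 'rV[R]_n -> 'M[R[i]]_2,
       (forall (s : R) (xi : 'rV[R]_n), Zhyp N s xi -> Qoo s xi \in unitmx) /\
       (forall K : set 'rV[R]_n, compact K -> ~ K 0 ->
          forall eps : R, 0 < eps -> exists T : R,
            forall (t s : R) (xi : 'rV[R]_n),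
              K xi -> Zhyp N s xi -> s <= t -> T <= t ->
              mxnorm (Q t s xi - Qoo s xi) <= eps)).
Proof.
have hbt : tcl l 1 b.
  by apply: class_C_tcl hb _ => i /hb_decay[C hC]; exists C => t t0; rewrite addn1 hC.
have hmt : tcl l 2 m.
  by apply: class_C_tcl hm _ => i /hm_decay[C hC]; exists C => t t0; rewrite addn2 hC.
have [CI hCI] : exists CI, forall (t : R) (xi : 'rV[R]_n), Zhyp N t xi ->
    nrm (invmx (Nmx b m k t xi)) <= CI.
  have d0 : directions [ffun=> 0%N] = [::] :> seq 'I_n.
    by apply: size0nil; rewrite size_directions /mlen big1 // => i _; rewrite ffunE.
  (* At order zero in t and xi the symbol estimate is a uniform bound on N_k^-1, as all exponents
     vanish; 8 converts the norm. *)
  have [_ [C hC]] := hNkinv 0%N [ffun=> 0%N] (leq0n _).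
  exists (8 * C) => t xi Z; apply: (le_trans (nrm_le_mxnorm _)).
  rewrite ler_wpM2l //; have := hC t xi Z; rewrite /Dt_Dxi /= /Dxi d0 /=.
  have -> : mlen ([ffun=> 0%N] : multi_index n) = 0%N.
    by rewrite /mlen big1 // => i _; rewrite ffunE.
  by rewrite !subr0 oppr0 !powRr0 !mulr1.
case: k hk1 hkl hNk hNkinv hE hCI => // j _ hjl hNk _ hE hCI.
exists (Qmx b E); split; [|split; [|split; [|split]]].
- by move=> t s xi _ _; exact: EQ.
- move=> s xi xi0; split; first by rewrite E0mxE /phs subrr mul0r Ph0.
  move=> t st.
  have H : mder `[s, +oo[ (fun t => E0mx t s xi) t
      ((enorm xi)%:C *: ('i *: (J0 R *m E0mx t s xi))).
    apply: mder_Ph.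
    have := rderM (rderB (@rder_id R `[s, +oo[ t) (rder_cst _ s t)) (rder_cst _ (enorm xi) t).
    by rewrite subr0 mul1r mulr0 addr0.
  have [h1 ->] := mder_Dt (accum_ray st) H; split=> //.
  by rewrite DmxE -scalemxAl !scalerA mulrAC mulNr -expr2 sqr_i opprK mul1r.
- move=> alpha; rewrite !addn1 ltnS => aj al.
  have {}al : (mlen alpha < l - j.+1)%N by rewrite ltn_subRL addnC.
  have part1 : exists C : R, forall t s : R, 0 <= s -> s <= t ->
      has_Dxi (Zhyp N s) alpha (Qmx b E t s) /\
      forall xi, Zhyp N s xi ->
        mxnorm (Dxi (Zhyp N s) alpha (Qmx b E t s) xi) <= C * enorm xi ^- mlen alpha.
    (* Initial time s independent of xi; for s <= t the slice of this set is the section of the zone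
       at time s. *)
    pose O : set (R * R * 'rV[R]_n) := [set x | x.1.2 <= x.1.1 /\ Zhyp N x.1.2 x.2].
    have [|||t s xi i [st Z]|C hC] := @symb_amplitude_Dxi R n l j b m N CI E O
        (fun x => x.1.2) alpha hbt hmt hjl hN hNk hCI hE _ _ _ _ aj al.
    + by move=> x [].
    + by move=> x [].
    + move=> J; apply: symb_cst => //; last exact: lip_cst.
      exists 2 => // s x _ [_ Z]; rewrite nrm_scalar ger0_norm // addr_ge0 //.
      exact: Zhyp_ge0 Z.
    + apply: accum_line; exists 1 => // xi' le _; split=> //.
      have [s0 h] := Z; split=> //; apply: (le_trans h).
      by rewrite ler_wpM2l // addr_ge0.
    exists C => t s s0 st; have := hC t s.
    by rewrite (_ : slice O t s = Zhyp N s) //; apply/seteqP; split => [xi []|xi Z].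
  split.
    have [C hC] := part1; exists C => t s s0 st; have [h1 h2] := hC t s s0 st.
    by split=> // xi xi0 th; apply: h2; exact: Zhyp_neq0.
  (* For alpha = 0 the estimate must include the sphere |xi| = N; no derivative occurs and
     [Qmx_bound] gives it directly. *)
  have [a0|a0] := posnP (mlen alpha).
    have [C C0 hC] := Qmx_bound hbt hmt hjl hN hCI hE.
    exists C => t t0 O Qt; rewrite /has_Dxi /Dxi.
    have -> : directions alpha = [::] by apply: size0nil; rewrite size_directions.
    split=> // xi [Z _]; rewrite /= a0 expr0 invr1 mulr1.
    apply: (le_trans (mxnorm_le_nrm _)).
    by apply: hC; [exact: Zhyp_at_theta Z|case/andP: (Zhyp_theta hN Z)].
  pose O : set (R * R * 'rV[R]_n) := [set x | Zhyp N x.1.1 x.2 /\ enorm x.2 <> N].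
  have [||J|t s xi i [Z xN]|C hC] := @symb_amplitude_Dxi R n l j b m N CI E O
      (fun x => theta N (enorm x.2)) alpha hbt hmt hjl hN hNk hCI hE _ _ _ _ aj al.
  + by move=> x [Z _]; exact: Zhyp_at_theta Z.
  + by move=> x [Z _]; case/andP: (Zhyp_theta hN Z).
  + by apply: symb_theta => // x [Z xN]; split=> //; exact: Zhyp_gt0 Z.
  + apply: accum_line; exists `|enorm xi - N|; first by rewrite normr_gt0 subr_eq0; apply/eqP.
    move=> xi' le lt; split.
      have [t0 h] := Z; split=> //; apply: (le_trans h).
      by rewrite ler_wpM2l // addr_ge0.
    by move=> /= e; move: lt; rewrite e distrC ltxx.
  (* The initial time is theta(|xi|), so the second coordinate is a dummy, set to 0. *)
  exists C => t t0 OO Qt; have [h1 h2] := hC t 0.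
  have eO : slice O t 0 = OO.
    apply/seteqP; split=> xi [Z xN]; split=> //.
      by case.
    by move=> e; apply: xN.
  by rewrite -eO; split; [exact: h1|exact: h2].
- move=> t s xi Z st; have [CV _ hV] := Qmx_unit hbt hmt hjl hN hCI hE.
  by have [] := hV t s xi Z st.
have [Qoo [hu [C C0 hC]]] := Qmx_limit hbt hmt hjl hN hCI hE.
exists Qoo; split=> // K cK K0 eps eps0.
have [d d0 hd] := compact_enorm_ge cK K0.
(* t >= T gives C <= d eps t, and d t <= |xi| (1 + t) on K. The choice does not depend on s. *)
exists (C / (d * eps)) => t s xi Kxi Z st Tt.
apply: (le_trans (mxnorm_le_nrm _)); apply: (le_trans (hC t s xi Z st)).
have t0 : 0 <= t by apply: le_trans st; exact: Zhyp_ge0 Z.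
have t1 : 0 < 1 + t by rewrite ltr_pwDl.
have dx := hd xi Kxi; have x0 := lt_le_trans d0 dx.
rewrite -invfM ler_pdivrMr ?mulr_gt0 //.
move: Tt; rewrite ler_pdivrMr ?mulr_gt0 // => Tt; apply: (le_trans Tt).
have dt : d * t <= enorm xi * (1 + t) by apply: ler_pM; rewrite ?(ltW d0) // lerDr.
by have := ler_wpM2l (ltW eps0) dt; lra.
Qed.
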